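(* Let $V$ be a $\mathbb Z$-graded real vector space and let $\alpha$ be a total-degree-one solution of the Maurer-Cartan equation on the square $I\times I$ (coordinates $(s,t)$, $I=[0,1]$) with values in $\mathfrak g=\prod_{n\ge0}\mathrm{Hom}(V^{\otimes n},V[1-n+\bullet])$, with $\alpha^{0,0}=\alpha^{1,0}=\alpha^{2,0}=0$ and $\alpha^{1,1}=0$. Assume that the $A_\infty$ structure is constant along the edges $s=0$ and $s=1$, i.e. on each of these edges $\alpha^{0,n}$ is independent of $t$ and the $dt$-component of $\alpha^{1,n}$ vanishes for all $n$; write $\mathcal A=\mathcal A_{s=0}$ and $\mathcal B=\mathcal A_{s=1}$ for the resulting $A_\infty$ algebras. For each $t\in I$ let $\mathscr F_t:\mathcal A\to\mathcal B$ be the $A_\infty$ morphism obtained by integrating along the path $s\mapsto(s,t)$, and let $\hat{\mathscr G}^n:\Omega^*(I,V)^{\otimes n}\to\Omega^*(I,V)$ ($n\geq 1$) be the maps obtained by the same tree formula from $\hat\alpha^{1,k}$, as defined in the context. Then $\hat{\mathscr G}$ defines a differential homotopy with respect to the family $\mathscr F_t$: letting $\iota:V\to\Omega^0(I,V)$ send $v$ to the constant function $v$, the maps $\phi^n=\hat{\mathscr G}^n\circ\iota^{\otimes n}$ are of the form $$\phi^n(a_1,\dots,a_n)(t)=\mathscr F^n_t(a_1,\dots,a_n)+dt\,\Theta^n_t(a_1,\dots,a_n)$$ and $\phi=(\phi^n)_{n\ge1}$ is an $A_\infty$ morphism $\mathcal A\to\Omega^*([0,1],\mathcal B)$.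
   Context: Degrees: $|a|$ is the degree of $a\in V$; $V[k]^i=V^{i+k}$; $\mathrm{Hom}(V^{\otimes n},V[k])$ is the space of $n$-linear maps of degree $k$. A map $f\in\mathrm{Hom}(V^{\otimes n},V[1-n+k])$ has shifted degree $\|f\|=k$. Put $\epsilon_j=\sum_{i=1}^j(|a_i|-1)$. $A_\infty$ algebra (zero curvature): maps $\mu^n\in\mathrm{Hom}(V^{\otimes n},V[2-n])$, $n\ge1$, with $\sum_{k+r=n+1}\sum_{j=0}^{k-1}(-1)^{\epsilon_j}\mu^k(a_1,\dots,a_j,\mu^r(a_{j+1},\dots,a_{j+r}),\dots,a_n)=0$ for all $n\ge 1$. $A_\infty$ morphism $\mathscr F:(V,\mu_{\mathcal A})\to(W,\mu_{\mathcal B})$: maps $\mathscr F^n\in\mathrm{Hom}(V^{\otimes n},W[1-n])$, $n\ge1$, with $\sum_{r}\sum_{s_1+\cdots+s_r=n}\mu^r_{\mathcal B}(\mathscr F^{s_1}(a_1,\dots),\dots,\mathscr F^{s_r}(\dots,a_n))=\sum_{m,j}(-1)^{\epsilon_j}\mathscr F^{n-m+1}(a_1,\dots,a_j,\mu^m_{\mathcal A}(a_{j+1},\dots,a_{j+m}),\dots,a_n)$ for all $n\ge 1$. Maurer-Cartan equation: $\mathfrak g^k=\prod_{n\ge0}\mathrm{Hom}(V^{\otimes n},V[1-n+k])$ with Gerstenhaber bracket $[f,g]=f\circ g-(-1)^{\|f\|\|g\|}g\circ f$, $(f\circ g)(a_1,\dots)=\sum_j(-1)^{\|g\|\epsilon_j}f(a_1,\dots,a_j,g(a_{j+1},\dots),\dots)$.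 On $\Omega^*(I\times I;\mathfrak g)$: $[\omega\otimes f,\theta\otimes g]=(-1)^{\|f\|\deg\theta}\omega\wedge\theta\otimes[f,g]$, de Rham differential $d$, total degree = form degree + degree in $\mathfrak g$. The equation is $d\alpha+\frac12[\alpha,\alpha]=0$ with $\alpha$ of total degree $1$, and $\alpha^{m,n}$ is its component in $\Omega^m(I\times I;\mathrm{Hom}(V^{\otimes n},V[2-m-n]))$. The $A_\infty$ algebra at a point $(s,t)$ is $(V,(\alpha^{0,n}_{(s,t)})_{n\ge1})$. Extension to forms: let $W=\Omega^*(I,V)=\Omega^*(I)\otimes V$ be the $V$-valued forms on the $t$-interval. A map $f\in\mathrm{Hom}(V^{\otimes n},V)$ of shifted degree $\|f\|$ extends to $W$ by $f(\omega_1\otimes v_1,\dots,\omega_n\otimes v_n)=(-1)^{\|f\|\sum_k\deg\omega_k+\sum_{j<k}(|v_j|-1)\deg\omega_k}\,\omega_1\wedge\cdots\wedge\omega_n\otimes f(v_1,\dots,v_n)$, extended pointwise to $f$ depending on $t$; a form $\theta\otimes f$ acts as $\theta\wedge f(\cdots)$. The $A_\infty$ algebra $\Omega^*([0,1],\mathcal B)=\Omega^*([0,1])\otimes\mathcal B$ has $\mu^1=d+\mu^1_{\mathcal B}$ and $\mu^n=\mu^n_{\mathcal B}$ for $n\ge2$, with $\mu^n_{\mathcal B}$ extended to forms in this way and $d$ the de Rham differential. Differential homotopy: for a family of $A_\infty$ morphisms $\mathscr F_t:\mathcal A\to\mathcal B$, $t\in[0,1]$, a collection $(\Theta_t^n)_{n\ge1}$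 is a differential homotopy with respect to $\mathscr F_t$ if the maps $\phi^n=\mathscr F^n_t+dt\,\Theta^n_t$ form an $A_\infty$ morphism $\mathcal A\to\Omega^*([0,1],\mathcal B)$. Tree formula: given a family $b_s^k$ ($s\in I$, $k\ge1$) of $k$-linear maps, set $T^1_0=\mathrm{Id}$, $T^n_0=0$ for $n\ne1$, and $T^n_i(s_1,\dots,s_i)=\sum_{k=1}^n\sum_{j=0}^{n-k}T^{n-k+1}_{i-1}(s_2,\dots,s_i)(1^{\otimes j}\otimes b^k_{s_1}\otimes1^{\otimes n-k-j})$. Write $\alpha^{1,n}=ds\otimes a^n_{s,t}+dt\otimes b^n_{s,t}$ and $\alpha^{2,n}=ds\wedge dt\otimes c^n_{s,t}$. (i) $\mathscr F_t^n=\delta_{n,1}\mathrm{Id}+\sum_{i=1}^{n-1}(-1)^i\int_{0\le s_1\le\cdots\le s_i\le1}T^n_i\,ds_1\cdots ds_i$, with $T_i^n$ built from the maps $a^k_{s,t}$ on $V$. (ii) $\hat{\mathscr G}^n=\delta_{n,1}\mathrm{Id}+\sum_{i=1}^{n}(-1)^i\int_{0\le s_1\le\cdots\le s_i\le1}T^n_i\,ds_1\cdots ds_i$, with $T_i^n$ built from the maps $\hat a^k_s=a^k_{s,t}+dt\otimes c^k_{s,t}$ on $W$; here $\hat\alpha^{1,k}=ds\otimes\hat a^k_s$. (Since $\hat a^1_s=dt\otimes c^1_{s,t}$, any composite containing two of the $\hat a^1$'s vanishes.) *)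

(* Defs.v *)
From HB Require Import structures.
From mathcomp Require Import all_boot all_order all_algebra.
From mathcomp Require Import all_classical all_reals all_analysis.

Set Implicit Arguments.
Unset Strict Implicit.
Unset Printing Implicit Defensive.

Import Order.TTheory GRing.Theory Num.Theory.
Import numFieldNormedType.Exports.

Local Open Scope classical_set_scope.
Local Open Scope ring_scope.

(* A Z-graded vector space [gcar] inside an ambient vector space [M], given by
   the projections onto its homogeneous components.  The ambient space allows
   the forms on the interval to be treated as a subspace of all functions. *)
Record gspace (R : realType) (M : lmodType R) := GSpace {
  gcar : set M;
  gproj : int -> M -> M;
  gcar0 : gcar 0;
  gcarP : forall c u v, gcar u -> gcar v -> gcar (c *: u + v);
  gproj_linear : forall i, linear (gproj i);
  gproj_car : forall i v, gcar v -> gcar (gproj i v);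
  gproj_proj : forall i j v, gcar v ->
    gproj i (gproj j v) = if i == j then gproj j v else 0;
  gproj_sum : forall v, gcar v ->
    exists2 J : seq int, uniq J & v = \sum_(i <- J) gproj i v }.

Section Graded.
Context {R : realType}.

Definition gdeg (M : lmodType R) (gM : gspace M) (k : int) : set M :=
  [set v | gcar gM v /\ gproj gM k v = v].

Definition homog (M : lmodType R) (gM : gspace M) (a : seq M) (d : seq int) :
    Prop :=
  size d = size a /\
  forall i, (i < size a)%N -> gdeg gM (nth 0 d i) (nth 0 a i).

(* epsilon_j = sum_(i <= j) (|a_i| - 1) *)
Definition eps (d : seq int) (j : nat) : int := \sum_(e <- take j d) (e - 1).

(* A family (f^n)_n of maps f^n : M^n -> N is encoded as f : seq M -> N, f^n
   being the restriction of f to lists of length n.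
   [hom_deg gM gN n k f] says f^n \in Hom(M^{\otimes n}, N[k]). *)
Definition hom_deg (M N : lmodType R) (gM : gspace M) (gN : gspace N)
    (n : nat) (k : int) (f : seq M -> N) : Prop :=
  (forall (x y : seq M) (c : R) (u v : M),
     (size x + size y).+1 = n ->
     (forall i, gcar gM (nth 0 x i)) -> (forall i, gcar gM (nth 0 y i)) ->
     gcar gM u -> gcar gM v ->
     f (x ++ (c *: u + v) :: y) = c *: f (x ++ u :: y) + f (x ++ v :: y)) /\
  (forall (a : seq M) (d : seq int),
     size a = n -> homog gM a d -> gdeg gN ((\sum_(e <- d) e) + k) (f a)).

(* f(a_1, .., a_j, g(a_{j+1}, .., a_{j+r}), a_{j+r+1}, .., a_n) *)
Definition insert (M N : lmodType R) (f : seq M -> N) (g : seq M -> M)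
    (j r : nat) (a : seq M) : N :=
  f (take j a ++ g (take r (drop j a)) :: drop (j + r) a).

Definition ainf_algebra (M : lmodType R) (gM : gspace M) (mu : seq M -> M) :
    Prop :=
  (forall n, (0 < n)%N -> hom_deg gM gM n (2 - n%:Z) mu) /\
  (forall (a : seq M) (d : seq int), (0 < size a)%N -> homog gM a d ->
     \sum_(1 <= r < (size a).+1) \sum_(0 <= j < (size a - r).+1)
        ((-1 : R) ^ eps d j) *: insert mu mu j r a = 0).

(* The left-hand side sums over the compositions s_1 + ... + s_r = n into
   positive parts; [reshape s a] cuts [a] into blocks of sizes s_1, .., s_r. *)
Definition ainf_morphism (M N : lmodType R) (gM : gspace M) (gN : gspace N)
    (muM : seq M -> M) (muN : seq N -> N) (F : seq M -> N) : Prop :=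
  [/\ ainf_algebra gM muM, ainf_algebra gN muN,
      forall n, (0 < n)%N -> hom_deg gM gN n (1 - n%:Z) F &
      forall (a : seq M) (d : seq int), (0 < size a)%N -> homog gM a d ->
        \sum_(1 <= r < (size a).+1)
          \sum_(s : r.-tuple 'I_(size a).+1 |
                  all (fun i : nat => 0 < i)%N [seq val i | i <- s] &&
                  (sumn [seq val i | i <- s] == size a))
            muN [seq F b | b <- reshape [seq val i | i <- s] a]
        = \sum_(1 <= r < (size a).+1) \sum_(0 <= j < (size a - r).+1)
            ((-1 : R) ^ eps d j) *: insert F muM j r a].

End Graded.

Section Smooth.
Context {R : realType}.
Local Notation I := {i01 R}.

Definition smooth1 (g : R -> R) : Prop :=
  forall (k : nat) (x : R), derivable (derive1n k g) x 1.

Fixpoint Ck2 (k : nat) (g : R -> R -> R) : Prop :=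
  continuous (fun z : R * R => g z.1 z.2) /\
  match k with
  | 0%N => True
  | k'.+1 =>
      [/\ forall s t, derivable (fun s' => g s' t) s 1,
          forall s t, derivable (g s) t 1,
          Ck2 k' (fun s t => derive1 (fun s' => g s' t) s) &
          Ck2 k' (fun s t => derive1 (g s) t)]
  end.

Definition smooth2 (g : R -> R -> R) : Prop := forall k, Ck2 k g.

(* Functions on I (resp. I x I) are smooth if they extend smoothly to the line
   (resp. the plane).  No topology is put on V: a V-valued function is a finite
   sum of scalar functions times vectors, i.e. an element of C^\infty \otimes V,
   and is differentiated and integrated coefficientwise. *)
Definition tensor_rep (V : lmodType R) (P : set (R -> R)) (C : set V)
    (u : I -> V) (N : nat) (g : 'I_N -> R -> R) (v : 'I_N -> V) : Prop :=
  [/\ forall i, P (g i), forall i, C (v i) &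
      forall t : I, u t = \sum_(i < N) g i t%:num *: v i].

Definition vsmooth (V : lmodType R) (C : set V) (u : I -> V) : Prop :=
  exists N (g : 'I_N -> R -> R) v, tensor_rep smooth1 C u g v.

Definition vsmooth2 (V : lmodType R) (u : I -> I -> V) : Prop :=
  exists N (g : 'I_N -> R -> R -> R) (v : 'I_N -> V),
    (forall i, smooth2 (g i)) /\
    forall s t : I, u s t = \sum_(i < N) g i s%:num t%:num *: v i.

Definition vderiv (V : lmodType R) (u : I -> V) (t : I) : V :=
  xget 0 [set w | exists N (g : 'I_N -> R -> R) v,
    tensor_rep smooth1 setT u g v /\
    w = \sum_(i < N) derive1 (g i) t%:num *: v i].

(* \int_S^1 u(s) ds *)
Definition vint (V : lmodType R) (S : I) (u : I -> V) : V :=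
  xget 0 [set w | exists N (g : 'I_N -> R -> R) v,
    tensor_rep [set h | continuous h] setT u g v /\
    w = \sum_(i < N)
          (\int[lebesgue_measure]_(x in `[S%:num, (1 : R)]) g i x) *: v i].

End Smooth.

Section MaurerCartan.
Context {R : realType} {V : lmodType R}.
Variable gV : gspace V.
Local Notation I := {i01 R}.

(* v |-> (-1)^(l (|v| - 1)) v, extended linearly.  Applied to a_1, .., a_j it
   produces the sign (-1)^(l epsilon_j). *)
Definition twist (l : int) (v : V) : V :=
  \sum_(i \in [set: int]) ((-1 : R) ^ (l * (i - 1))) *: gproj gV i v.

(* f \circ g, for g of shifted degree l *)
Definition gcirc (l : int) (f g : seq V -> V) (a : seq V) : V :=
  \sum_(0 <= r < (size a).+1) \sum_(0 <= j < (size a - r).+1)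
    f ([seq twist l v | v <- take j a]
         ++ g (take r (drop j a)) :: drop (j + r) a).

(* [f, g], for f, g of shifted degrees k, l *)
Definition gbracket (k l : int) (f g : seq V -> V) (a : seq V) : V :=
  gcirc l f g a - ((-1 : R) ^ (k * l)) *: gcirc k g f a.

(* A g-valued form on I x I: [alpha p q] is the coefficient of
   ds^p \wedge dt^q, with p, q \in {0, 1}. *)
Definition sqform := bool -> bool -> I -> I -> seq V -> V.

(* Smooth forms of total degree D: the component of form degree m has degree
   D - m in g, where g^k = \prod_n Hom(V^{\otimes n}, V[1 - n + k]).
   Smoothness is required for each fixed list of arguments, which is the weakest
   notion; it is finite-rank smoothness in Hom when V is finite dimensional. *)
Definition sqform_degree (D : int) (alpha : sqform) : Prop :=
  forall p q : bool,
    (forall s t n, hom_deg gV gV n (1 - n%:Z + (D - (p + q)%N%:Z))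
                     (alpha p q s t)) /\
    (forall a, vsmooth2 (fun s t => alpha p q s t a)).

Definition sq_d (alpha : sqform) : sqform := fun p q s t a =>
  match p, q with
  | false, false => 0
  | true, false => vderiv (fun s' => alpha false false s' t a) s
  | false, true => vderiv (fun t' => alpha false false s t' a) t
  | true, true => vderiv (fun s' => alpha false true s' t a) s
                  - vderiv (fun t' => alpha true false s t' a) t
  end.

(* [omega f, theta g] = (-1)^(||f|| deg theta) omega \wedge theta [f, g] for
   forms of total degrees D and E, with omega = ds^p1 dt^q1 and
   theta = ds^p2 dt^q2; the factor (-1)^(q1 p2) reorders their product. *)
Definition sq_bracket (D E : int) (alpha beta : sqform) : sqform :=
  fun p q s t a =>
  \sum_(p1 : bool) \sum_(q1 : bool)
  \sum_(p2 : bool | (p1 + p2 == p)%N) \sum_(q2 : bool | (q1 + q2 == q)%N)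
    ((-1 : R) ^ ((D - (p1 + q1)%N%:Z) * (p2 + q2)%N%:Z) * (-1) ^+ (q1 * p2))
    *: gbracket (D - (p1 + q1)%N%:Z) (E - (p2 + q2)%N%:Z)
         (alpha p1 q1 s t) (beta p2 q2 s t) a.

Definition maurer_cartan (alpha : sqform) : Prop :=
  sqform_degree 1 alpha /\
  forall p q s t a,
    sq_d alpha p q s t a + (2^-1 : R) *: sq_bracket 1 1 alpha alpha p q s t a
    = 0.

End MaurerCartan.

Arguments sqform {R} V.

Section Omega.
Context {R : realType} {V : lmodType R}.
Variable gV : gspace V.
Local Notation I := {i01 R}.

(* The pair (u, u') stands for u + dt u', without any regularity. *)
Local Notation form := ((I -> V) * (I -> V))%type.

Lemma vsmooth0 : vsmooth (gcar gV) (fun=> 0 : V).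
Proof.
exists 0%N, (fun _ _ => 0), (fun=> 0); split => [[]//|[]//|t].
by rewrite big_ord0.
Qed.

Lemma smooth1_scale (c : R) (g : R -> R) :
  smooth1 g -> smooth1 (fun x => c * g x).
Proof.
move=> sg k.
have -> : derive1n k (fun x => c * g x) = (fun x => c * derive1n k g x).
  elim: k => [//|k IH].
  rewrite [LHS]derive1nS IH; apply/funext => x.
  by rewrite !derive1E deriveZ ?derive1nS ?derive1E//; exact: sg.
by move=> x; apply: derivableM; [exact: derivable_cst|exact: sg].
Qed.

Lemma vsmoothP (c : R) (u w : I -> V) :
  vsmooth (gcar gV) u -> vsmooth (gcar gV) w ->
  vsmooth (gcar gV) (c *: u + w).
Proof.
move=> [m [g [v [sg cv eu]]]] [n [h [x [sh cx ew]]]].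
exists (m + n)%N,
  (fun i => match fintype.split i with inl j => fun y => c * g j y | inr j => h j end),
  (fun i => match fintype.split i with inl j => v j | inr j => x j end).
split=> [i|i|t].
- by case: fintype.splitP => j _; [exact: smooth1_scale (sg j)|exact: sh].
- by case: fintype.splitP.
have -> : (c *: u + w) t = c *: u t + w t by [].
rewrite big_split_ord/= eu ew scaler_sumr; congr (_ + _).
  by apply: eq_bigr => i _; rewrite (unsplitK (inl i)) scalerA.
by apply: eq_bigr => i _; rewrite (unsplitK (inr i)).
Qed.

Lemma gcar_sum (T : Type) (r : seq T) (c : T -> R) (v : T -> V) :
  (forall i, gcar gV (v i)) -> gcar gV (\sum_(i <- r) c i *: v i).
Proof.
move=> cv; elim: r => [|i r IH]; first by rewrite big_nil; exact: gcar0.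
by rewrite big_cons; exact: gcarP.
Qed.

Lemma vsmooth_car (u : I -> V) (t : I) :
  vsmooth (gcar gV) u -> gcar gV (u t).
Proof. by case=> N [g [v [_ cv ->]]]; exact: gcar_sum. Qed.

Lemma gproj0 i : gproj gV i 0 = 0.
Proof.
have := gproj_linear gV i (-1) 0 0.
by rewrite !scaleN1r !addNr.
Qed.

Lemma gproj_lsum i (T : Type) (r : seq T) (c : T -> R) (v : T -> V) :
  gproj gV i (\sum_(j <- r) c j *: v j) = \sum_(j <- r) c j *: gproj gV i (v j).
Proof.
elim: r => [|j r IH]; first by rewrite !big_nil gproj0.
by rewrite !big_cons gproj_linear IH.
Qed.

Lemma vsmooth_proj i (u : I -> V) :
  vsmooth (gcar gV) u -> vsmooth (gcar gV) (fun t => gproj gV i (u t)).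
Proof.
move=> [m [g [v [sg cv eu]]]].
exists m, g, (fun j => gproj gV i (v j)); split=> [//|j|t].
  exact: gproj_car.
by rewrite eu gproj_lsum.
Qed.

Lemma gproj_supp v : gcar gV v -> exists J : seq int,
  forall J', uniq J' -> {subset J <= J'} -> v = \sum_(i <- J') gproj gV i v.
Proof.
move=> cv; have [J uJ ev] := gproj_sum cv.
exists J => J' uJ' sJ.
have P0 i : i \notin J -> gproj gV i v = 0.
  move=> iJ; rewrite ev.
  have -> : \sum_(j <- J) gproj gV j v = \sum_(j <- J) (1:R) *: gproj gV j v.
    by apply: eq_bigr => j _; rewrite scale1r.
  rewrite gproj_lsum big_seq big1// => j jJ.
  rewrite scale1r gproj_proj//; case: eqP => // ij.
  by rewrite ij jJ in iJ.
have Z : \sum_(i <- J' | i \notin J) gproj gV i v = 0.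
  by rewrite big1// => i /P0.
rewrite (bigID (mem J))/= Z addr0.
rewrite -big_filter {1}ev; apply: perm_big; apply: uniq_perm => //.
  exact: filter_uniq.
move=> i; rewrite mem_filter /=.
by case: (boolP (i \in J)) => //= /sJ ->.
Qed.

Lemma vsmooth_supp (u : I -> V) : vsmooth (gcar gV) u -> exists J : seq int,
  forall J', uniq J' -> {subset J <= J'} ->
  forall t, u t = \sum_(i <- J') gproj gV i (u t).
Proof.
move=> [m [g [v [_ cv eu]]]].
have /choice[J HJ] := fun i => gproj_supp (cv i).
exists (flatten [seq J i | i : 'I_m]) => J' uJ' sJ t.
rewrite eu; under [RHS]eq_bigr do rewrite gproj_lsum.
rewrite exchange_big /=; apply: eq_bigr => i _.
rewrite -scaler_sumr -(HJ i)// => k kJ; apply: sJ.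
apply/flattenP; exists (J i) => //; apply/mapP; exists i => //.
by rewrite mem_enum.
Qed.

(* \Omega^*(I, V) = \Omega^*(I) \otimes V, whose degree k part is
   C^\infty(I) \otimes V^k + dt C^\infty(I) \otimes V^(k-1). *)
Definition Omega_car : set form :=
  [set w | vsmooth (gcar gV) w.1 /\ vsmooth (gcar gV) w.2].

Definition Omega_proj (k : int) (w : form) : form :=
  (fun t => gproj gV k (w.1 t), fun t => gproj gV (k - 1) (w.2 t)).

Lemma Omega_car0 : Omega_car 0.
Proof. by split; exact: vsmooth0. Qed.

Lemma Omega_carP (c : R) (u v : form) :
  Omega_car u -> Omega_car v -> Omega_car (c *: u + v).
Proof. by move=> [? ?] [? ?]; split; exact: vsmoothP. Qed.

Lemma Omega_proj_linear i : linear (Omega_proj i).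
Proof.
move=> c u v; apply/pair_equal_spec; split; apply/funext => t;
  exact: gproj_linear.
Qed.

Lemma Omega_proj_car i w : Omega_car w -> Omega_car (Omega_proj i w).
Proof. by move=> [? ?]; split; exact: vsmooth_proj. Qed.

Lemma Omega_proj_proj i j w : Omega_car w ->
  Omega_proj i (Omega_proj j w) = if i == j then Omega_proj j w else 0.
Proof.
move=> [w1 w2].
have -> : (if i == j then Omega_proj j w else 0) =
    (fun t => if i == j then gproj gV j (w.1 t) else 0,
     fun t => if i == j then gproj gV (j - 1) (w.2 t) else 0).
  by case: eqP.
apply/pair_equal_spec; split; apply/funext => t /=; rewrite gproj_proj//.
- exact: vsmooth_car.
- by rewrite (inj_eq (addIr _)).
- exact: vsmooth_car.
Qed.

Lemma Omega_proj_sum w : Omega_car w ->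
  exists2 J : seq int, uniq J & w = \sum_(i <- J) Omega_proj i w.
Proof.
move=> [/vsmooth_supp[J1 H1] /vsmooth_supp[J2 H2]].
set J := undup (J1 ++ [seq i + 1 | i <- J2]).
have uJ : uniq J by exact: undup_uniq.
exists J => //.
have E (K : seq int) t :
    ((\sum_(i <- K) Omega_proj i w).1 t =
       \sum_(i <- K) gproj gV i (w.1 t)) /\
    ((\sum_(i <- K) Omega_proj i w).2 t =
       \sum_(i <- K) gproj gV (i - 1) (w.2 t)).
  elim: K => [|k K [IH1 IH2]]; first by rewrite !big_nil.
  by rewrite !big_cons -IH1 -IH2.
rewrite [LHS]surjective_pairing [RHS]surjective_pairing.
apply/pair_equal_spec; split; apply/funext => t.
  rewrite (E J t).1; apply: H1 => // i iJ.
  by rewrite mem_undup mem_cat iJ.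
rewrite (E J t).2 -(big_map (fun i => i - 1) xpredT (fun i => gproj gV i _)).
apply: H2; first by rewrite map_inj_uniq//; exact: addIr.
move=> i iJ; apply/mapP; exists (i + 1); last by rewrite addrK.
by rewrite mem_undup mem_cat; apply/orP; right; apply/mapP; exists i.
Qed.

Definition Omega : gspace form :=
  GSpace Omega_car0 Omega_carP Omega_proj_linear Omega_proj_car
    Omega_proj_proj Omega_proj_sum.

Definition const_form (v : V) : form := (fun=> v, fun=> 0).

Definition form_d (w : form) : form := (fun=> 0, vderiv w.1).

Definition dt_wedge (w : form) : form := (fun=> 0, w.1).

(* Extension to forms of a family f_t of shifted degree k.  As dt dt = 0, at
   most one argument contributes its dt component; pulling dt out of the j-th
   argument gives the sign (-1)^(k + sum_(i < j) (|v_i| - 1)). *)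
Definition form_ext (k : int) (f : I -> seq V -> V) (w : seq form) : form :=
  (fun t => f t [seq x.1 t | x <- w],
   fun t => \sum_(0 <= j < size w) ((-1 : R) ^ k) *:
     f t ([seq twist gV 1 (x.1 t) | x <- take j w]
            ++ (nth 0 w j).2 t :: [seq x.1 t | x <- drop j.+1 w])).

Definition Omega_mu (mu : seq V -> V) (w : seq form) : form :=
  (if w is [:: x] then form_d x else 0) + form_ext 1 (fun=> mu) w.

Definition diff_homotopy (muA muB : seq V -> V) (F Theta : I -> seq V -> V) :
    Prop :=
  (forall t, ainf_morphism gV gV muA muB (F t)) /\
  ainf_morphism gV Omega muA (Omega_mu muB)
    (fun a => (F^~ a, Theta^~ a)).

End Omega.

Section Tree.
Context {R : realType}.
Local Notation I := {i01 R}.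

(* T^n_i(s_1, .., s_i), with n = size x and s = [:: s_1; ..; s_i] *)
Fixpoint tree (M : lmodType R) (b : I -> seq M -> M) (s : seq I) (x : seq M) :
    M :=
  match s with
  | [::] => if x is [:: v] then v else 0
  | s1 :: s' => \sum_(1 <= k < (size x).+1) \sum_(0 <= j < (size x - k).+1)
                  insert (tree b s') (b s1) j k x
  end.

(* The iterated integral over S <= s_1 <= ... <= s_i <= 1 of an M-valued
   function, where [J S u] is the integral of u over [S, 1]. *)
Fixpoint simplex_int (M : lmodType R) (J : I -> (I -> M) -> M) (i : nat)
    (S : I) (Phi : seq I -> M) : M :=
  match i with
  | 0%N => Phi [::]
  | i'.+1 => J S (fun s1 => simplex_int J i' s1 (fun s' => Phi (s1 :: s')))
  end.

(* delta_{n,1} Id + sum_(1 <= i <= m) (-1)^i \int T^n_i *)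
Definition tree_formula (M : lmodType R) (J : I -> (I -> M) -> M)
    (b : I -> seq M -> M) (m : nat) (x : seq M) : M :=
  (if x is [:: v] then v else 0) +
  \sum_(1 <= i < m.+1)
    ((-1 : R) ^+ i) *: simplex_int J i 0%:i01 (fun s => tree b s x).

Context {V : lmodType R}.
Variable gV : gspace V.
Local Notation form := ((I -> V) * (I -> V))%type.

(* The integral over s \in [S, 1] of forms in t, for each t *)
Definition form_int (S : I) (w : I -> form) : form :=
  (fun t => vint S (fun s => (w s).1 t), fun t => vint S (fun s => (w s).2 t)).

Definition path_morphism (alpha : sqform V) (t : I) (x : seq V) : V :=
  tree_formula (@vint R V) (fun s => alpha true false s t) (size x).-1 x.

(* \hat a_s = a_{s,t} + dt c_{s,t}, with a, c of shifted degrees 0, -1 *)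
Definition hat_a (alpha : sqform V) (s : I) (w : seq form) : form :=
  form_ext gV 0 (alpha true false s) w
  + dt_wedge (form_ext gV (-1) (alpha true true s) w).

Definition hat_G (alpha : sqform V) (w : seq form) : form :=
  tree_formula form_int (hat_a alpha) (size w) w.

End Tree.

(* Main.v *)
Require Import Defs.
From HB Require Import structures.
From mathcomp Require Import all_boot all_order all_algebra.
From mathcomp Require Import all_classical all_reals all_analysis.
From mathcomp Require Import ring lra zify.

Set Implicit Arguments.
Unset Strict Implicit.
Unset Printing Implicit Defensive.

Import Order.TTheory GRing.Theory Num.Theory.
Import numFieldNormedType.Exports.

Local Open Scope classical_set_scope.
Local Open Scope ring_scope.

(* Write m, a, b, c for the 1, ds, dt and ds dt components of alpha, and f \o g
   for the circle product.  Integrating the tree formula over [s, 1] instead of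
   [0, 1] gives families F_s and H_s with dF/ds = F \o a, F_1 = Id and
   dH/ds = H \o a + F \o c, H_1 = 0; the homotopy is H_0.  The Maurer-Cartan
   equation and the pre-Lie identity
     (K \o f) \o g - K \o (f \o g)
       = (-1)^(||f|| ||g||) ((K \o g) \o f - K \o (g \o f))
   show that the defect u of the equation saying that F_s is a morphism from the
   structure m_s to m_1 satisfies du/ds = u \o a and u_1 = 0.  As a^1 = 0, u \o a
   only involves lists with fewer arguments, so u = 0 by induction on their
   number.  The same argument then gives
     dF/dt = sum m_1(F, .., H, .., F) + H \o m + F \o b,
   and b vanishes at s = 0. *)

(** * Functions on the square that are smooth in the second variable *)

Section Scalars.
Context {R : realType}.

(** In the tree formula the vertex at the smallest parameter [s_1] acts first, on the inputs.
    Peeling it off turns the sum over [s, 1] into the integral equation F_s = Id - int_s^1 F_r \o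
    a_r dr. This is why the lower limit is made variable; the signs (-1)^i compensate the sign of
    differentiation in a lower limit. As [- \o a] acts as a derivation on the composites m_1(F, ..,
    F), these obey the same linear equation as F. The derivative of sum m_1(F, .., H, .., F) also
    contains composites in which [c] sits inside some F. They add up to (sum m_1(F, .., F)) \o c and
    become (F \o m) \o c through the morphism equation, which therefore has to precede the homotopy
    equation. Two obstacles shape the rest. Signs depend on degrees while the maps take arbitrary
    vectors: [twist] turns the sign into a linear operator, so that identities hold on all lists.
    And V has no topology: functions are finite sums of scalar functions times vectors, in many
    ways, so derivatives and integrals have to be shown independent of the representation. *)

Definition dt2 (g : R -> R -> R) : R -> R -> R := fun s t => derive1 (g s) t.

(* Boundedness in s, locally uniform in t, stands in for joint continuity: with
   continuity in s it is all that differentiation under the integral sign needs,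
   and unlike joint continuity it is immediate for integrals over [s, 1]. *)
Fixpoint tsmooth_upto (k : nat) (g : R -> R -> R) : Prop :=
  [/\ forall t : R, continuous (g^~ t),
      forall M : R, exists B : R, forall s t : R, `|t| <= M -> `|g s t| <= B &
      if k is k'.+1 then
        (forall s t : R, derivable (g s) t 1) /\ tsmooth_upto k' (dt2 g)
      else True].

Definition tsmooth g := forall k, tsmooth_upto k g.

Lemma tsmooth_uptoW k g : tsmooth_upto k.+1 g -> tsmooth_upto k g.
Proof.
elim: k g => [|k IH] g; first by move=> [].
by move=> [? ? [? /IH ?]]; split.
Qed.

Lemma tsmoothP g : tsmooth g ->
  [/\ forall t : R, continuous (g^~ t),
      forall M : R, exists B : R, forall s t : R, `|t| <= M -> `|g s t| <= B,
      forall s t : R, derivable (g s) t 1 & tsmooth (dt2 g)].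
Proof.
move=> sg; have [c b [d _]] := sg 1%N; split=> // k.
by have [_ _ []] := sg k.+1.
Qed.

Lemma tsmooth_upto_cst k (c : R) : tsmooth_upto k (fun _ _ => c).
Proof.
elim: k c => [|k IH] c; split=> //; try by move=> t; exact: cst_continuous.
- by move=> M; exists `|c|.
- by move=> M; exists `|c|.
- split; first by move=> s t; exact: derivable_cst.
  have -> : dt2 (fun _ _ => c) = fun _ _ => 0.
    by apply/funext => s; apply/funext => t; rewrite /dt2 derive1_cst.
  exact: IH.
Qed.

Lemma tsmooth_uptoD k g h :
  tsmooth_upto k g -> tsmooth_upto k h ->
  tsmooth_upto k (fun s t => g s t + h s t).
Proof.
elim: k g h => [|k IH] g h [cg bg dg] [ch bh dh]; split=> //;
  try by move=> t s; apply: cvgD; [exact: cg|exact: ch].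
- move=> M; have [B1 H1] := bg M; have [B2 H2] := bh M.
  exists (B1 + B2) => s t tM.
  by rewrite (le_trans (ler_normD _ _))// lerD ?H1 ?H2.
- move=> M; have [B1 H1] := bg M; have [B2 H2] := bh M.
  exists (B1 + B2) => s t tM.
  by rewrite (le_trans (ler_normD _ _))// lerD ?H1 ?H2.
- case: dg dh => [dg pg] [dh ph]; split.
    by move=> s t; apply: derivableD; [exact: dg|exact: dh].
  have -> : dt2 (fun s t => g s t + h s t) = fun s t => dt2 g s t + dt2 h s t.
    apply/funext => s; apply/funext => t; rewrite /dt2 !derive1E.
    by rewrite deriveD.
  exact: IH.
Qed.

Lemma tsmooth_uptoM k g h :
  tsmooth_upto k g -> tsmooth_upto k h ->
  tsmooth_upto k (fun s t => g s t * h s t).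
Proof.
elim: k g h => [|k IH] g h Pg Ph; have [cg bg dg] := Pg; have [ch bh dh] := Ph;
  split=> //; try by move=> t s; apply: cvgM; [exact: cg|exact: ch].
- move=> M; have [B1 H1] := bg M; have [B2 H2] := bh M.
  exists (B1 * B2) => s t tM.
  by rewrite normrM ler_pM ?H1 ?H2.
- move=> M; have [B1 H1] := bg M; have [B2 H2] := bh M.
  exists (B1 * B2) => s t tM.
  by rewrite normrM ler_pM ?H1 ?H2.
- case: dg dh => [dg pg] [dh ph]; split.
    by move=> s t; apply: derivableM; [exact: dg|exact: dh].
  have -> : dt2 (fun s t => g s t * h s t) =
      fun s t => g s t * dt2 h s t + h s t * dt2 g s t.
    apply/funext => s; apply/funext => t; rewrite /dt2 !derive1E.
    by rewrite deriveM.
  by apply: tsmooth_uptoD; apply: IH => //; exact: tsmooth_uptoW.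
Qed.

Lemma tsmooth_cst (c : R) : tsmooth (fun _ _ => c).
Proof. by move=> k; exact: tsmooth_upto_cst. Qed.

Lemma tsmoothD g h : tsmooth g -> tsmooth h -> tsmooth (fun s t => g s t + h s t).
Proof. by move=> Pg Ph k; exact: tsmooth_uptoD. Qed.

Lemma tsmoothM g h : tsmooth g -> tsmooth h -> tsmooth (fun s t => g s t * h s t).
Proof. by move=> Pg Ph k; exact: tsmooth_uptoM. Qed.

Lemma tsmooth_smooth1 g s : tsmooth g -> smooth1 (g s).
Proof.
move=> sg k; elim: k g sg => [|k IH] g sg x.
  by have [_ _ + _] := tsmoothP sg; apply.
have [_ _ _ sg'] := tsmoothP sg.
by rewrite derive1Sn; exact: (IH _ sg').
Qed.

(** Composing with this retraction onto [0, 1] makes a function bounded for all real s, as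
    [tsmooth_upto] requires, at the price of differentiability in s at 0 and 1. *)
Definition clamp (s : R) : R := Num.max 0 (Num.min s 1).

Lemma clampP s : 0 <= clamp s <= 1.
Proof. by rewrite /clamp le_max lexx /= ge_max ler01 ge_min lexx orbT. Qed.

Lemma clamp_id s : 0 <= s <= 1 -> clamp s = s.
Proof. by move=> /andP[s0 s1]; rewrite /clamp min_l// max_r. Qed.

Lemma clamp_continuous : continuous clamp.
Proof.
move=> s; apply: (@continuous_max _ R^o (fun=> 0) (fun x => Num.min x 1)).
  exact: cst_continuous.
by apply: (@continuous_min _ R^o id (fun=> 1)); [exact: cvg_id|exact: cst_continuous].
Qed.

Lemma compact_norm_bound (T : topologicalType) (K : set T) (f : T -> R) :
  compact K -> continuous f -> exists B, forall x, K x -> `|f x| <= B.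
Proof.
move=> cK cf; have := continuous_compact (continuous_subspaceT cf) cK.
move=> /compact_bounded[M [_ HM]]; exists (M + 1) => x Kx.
by apply: (HM (M + 1)); [rewrite ltrDl|exists x].
Qed.

(** The bounds come from compactness of [0, 1] x [-M, M], and differentiation in t commutes with
    clamping s. *)
Lemma Ck2_tsmooth k g : Ck2 k g -> tsmooth_upto k (fun s t => g (clamp s) t).
Proof.
have base (h : R -> R -> R) : continuous (fun z : R * R => h z.1 z.2) ->
    (forall t, continuous (fun s => h (clamp s) t)) /\
    forall M, exists B, forall s t, `|t| <= M -> `|h (clamp s) t| <= B.
  move=> ch; split=> [t s|M].
    apply: (@continuous2_cvg _ _ _ _ _ _ clamp (fun=> t) h (clamp s) t).
    - by have := ch (clamp s, t); apply.
    - exact: clamp_continuous.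
    - exact: cvg_cst.
  have K : compact (`[0:R, 1] `*` `[- M, M]).
    by apply: (@compact_setX R R); exact: segment_compact.
  have [B HB] := compact_norm_bound K ch.
  exists B => s t tM; apply: (HB (clamp s, t)).
  by split; rewrite /= in_itv/= ?clampP// -ler_norml.
elim: k g => [|k IH] g [cg dg]; have [c b] := base _ cg; split => //.
case: dg => _ d2 _ c2; split; first by move=> s t; exact: d2.
by apply: (IH (dt2 g)); exact: c2.
Qed.

Lemma smooth2_tsmooth g : smooth2 g -> tsmooth (fun s t => g (clamp s) t).
Proof. by move=> sg k; exact: Ck2_tsmooth. Qed.

Lemma smooth1_tsmooth g : smooth1 g -> tsmooth (fun _ => g).
Proof.
move=> sg k; elim: k g sg => [|k IH] g sg.
all: have cg : continuous g by move=> t; apply: differentiable_continuous;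
   apply/derivable1_diffP; exact: (sg 0%N).
all: have bd (M : R) : exists B, forall (s : R) (t : R), `|t| <= M -> `|g t| <= B.
1,3: have [B HB] := compact_norm_bound (@segment_compact _ (- M) M) cg.
1,2: by exists B => _ t tM; apply: HB; rewrite /= in_itv/= -ler_norml.
all: split => //; try by move=> t; exact: cst_continuous.
split; first by move=> _ t; exact: (sg 0%N).
by apply: IH => j x; rewrite -derive1Sn; exact: (sg j.+1).
Qed.

End Scalars.

(** * Integrals over [S, 1] depending on a parameter *)

Section Integrals.
Context {R : realType}.
Local Notation mu := (@lebesgue_measure R).

Lemma continuous_integrable (f : R -> R) (a b : R) :
  continuous f -> mu.-integrable `[a, b] (EFin \o f).
Proof.
move=> cf; apply: continuous_compact_integrable; first exact: segment_compact.
exact: continuous_subspaceT.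
Qed.

Lemma derivable_is_derive (f : R -> R) (x l : R) :
  derivable f x 1 -> derive1 f x = l -> is_derive x 1 f l.
Proof. by move=> d <-; split; [exact: d|rewrite derive1E]. Qed.

Lemma is_derive_derive1 (f : R -> R) (x l : R) :
  is_derive x 1 f l -> derive1 f x = l.
Proof. by move=> d; rewrite derive1E derive_val. Qed.

(** The base point -1 lies strictly to the left of [0, 1], so the fundamental theorem of calculus in
    the upper limit applies at every point of [0, 1], including 0. *)
Definition pint (y : R) (g : R -> R -> R) (t : R) : R :=
  \int[mu]_(x in `[-1, y]) g x t.

(** Written as a difference of integrals with variable upper limit, which is where the minus sign of
    its derivative in S comes from. It agrees with the integral over [S, 1] for S in [0, 1] and is
    constant in S outside. *)
Definition tail_int (g : R -> R -> R) : R -> R -> R :=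
  fun S t => pint 1 g t - pint (clamp S) g t.

Lemma tail_intE (g : R -> R -> R) (S t : R) : (forall t : R, continuous (g^~ t)) -> 0 <= S <= 1 ->
  tail_int g S t = \int[mu]_(x in `[S, 1]) g x t.
Proof.
move=> cg /andP[S0 S1]; rewrite /tail_int clamp_id ?S0// /pint.
have S1' : -1 <= S by lra.
rewrite Rintegral_itvB ?bnd_simp//; last exact: continuous_integrable.
rewrite Rintegral_itv_obnd_cbnd//.
apply: integrableS (continuous_integrable S 1 (cg t)) => //.
by apply: subset_itvr; rewrite bnd_simp.
Qed.

Lemma pint_derivable (g : R -> R -> R) (t y : R) : continuous (g^~ t) -> -1 < y ->
  is_derive y 1 (fun z => pint z g t) (g y t).
Proof.
move=> cg y1; have yy : y < y + 1 by rewrite ltrDl.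
have [d e] := continuous_FTC1_closed yy
  (continuous_integrable (-1) (y + 1) cg) y1 (cg y).
exact: derivable_is_derive d e.
Qed.

Lemma pint_bound (g : R -> R -> R) (t y B : R) : continuous (g^~ t) ->
  (forall s, `|g s t| <= B) -> -1 <= y <= 1 -> `|pint y g t| <= B * 2.
Proof.
move=> cg gB /andP[y0 y1].
have mg := continuous_integrable (-1) y cg.
have B0 : 0 <= B by exact: le_trans (gB 0).
apply: le_trans (le_normr_Rintegral _ mg) _ => //.
apply: (@le_trans _ _ (\int[mu]_(x in `[-1, y]) B)).
  apply: le_Rintegral => //.
  - apply: continuous_integrable => x; apply: continuous_comp; first exact: cg.
    exact: norm_continuous.
  - by apply: continuous_integrable; exact: cst_continuous.
rewrite Rintegral_cst//= (lebesgue_measure_itv `[-1, y])/=.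
case: ifP => /= _; last by rewrite mulr0 mulr_ge0.
by rewrite ler_wpM2l// opprK; lra.
Qed.

Lemma pint_dt (g : R -> R -> R) (y : R) : tsmooth_upto 1 g -> -1 <= y <= 1 ->
  (forall t : R, derivable (pint y g) t 1) /\
  derive1 (pint y g) = pint y (dt2 g).
Proof.
move=> [cg _ [dg [cg' bg' _]]] y1.
have [dP eP] : (forall t : R, derivable (pint y g) t 1) /\
    (forall t : R, derive1 (pint y g) t = pint y (dt2 g) t); last first.
  by split=> //; exact/funext.
apply/all_and2 => t; 
(* A bound for the t-derivative on the unit neighbourhood of t, uniform in s: a constant is then an
   integrable dominating function. *)
have [B HB] := bg' (`|t| + 1).
have It : `](t - 1), (t + 1)[%classic t by rewrite /= in_itv/=; lra.
have intf (x : R) : `](t - 1), (t + 1)[%classic x ->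
    mu.-integrable `[-1, y] (EFin \o (fun u => g u x)).
  by move=> _; exact: continuous_integrable.
have df (x z : R) : `](t - 1), (t + 1)[%classic x -> `[-1, y]%classic z ->
   derivable (fun u => g z u) x 1 by move=> _ _; exact: dg.
have G0 (z : R) : 0 <= `|B| by [].
have intG : mu.-integrable `[-1, y] (EFin \o (fun=> `|B|)).
  by apply: continuous_integrable; exact: cst_continuous.
have ub (x z : R) : `](t - 1), (t + 1)[%classic x -> `[-1, y]%classic z ->
    `|partial1of2 (fun u z => g z u) x z| <= `|B|.
  rewrite /= in_itv/= => xt _; apply: le_trans (ler_norm B).
  apply: HB; rewrite -(subrK t x) addrC (le_trans (ler_normD _ _))//.
  by rewrite lerD2l ler_norml; move: xt; clear; lra.
split.
  have := derivable_under_integral (mu := mu) (f := fun u z => g z u)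
    (measurable_itv _) It intf df G0 intG ub.
  exact.
have := differentiation_under_integral (mu := mu) (f := fun u z => g z u)
  (measurable_itv _) It intf df G0 intG ub.
exact.
Qed.

Lemma tsmooth_pint (g : R -> R -> R) :
  tsmooth g -> tsmooth (fun s t => pint (clamp s) g t).
Proof.
have cs (s : R) : -1 <= clamp s <= 1 by have := clampP s; clear; lra.
have base (h : R -> R -> R) : tsmooth h ->
    (forall t : R, continuous (fun s => pint (clamp s) h t)) /\
    forall M : R, exists B : R, forall s t : R, `|t| <= M ->
      `|pint (clamp s) h t| <= B.
  move=> /tsmoothP[ch bh _ _]; split=> [t s|M].
    apply: (@continuous_comp _ _ _ clamp (fun y => pint y h t)).
      exact: clamp_continuous.
    have cs1 : -1 < clamp s by have := clampP s; clear; lra.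
    apply: differentiable_continuous; apply/derivable1_diffP.
    by have [] := pint_derivable (ch t) cs1.
  have [B HB] := bh M; exists (B * 2) => s t tM.
  by apply: pint_bound => // u; exact: HB.
move=> sg k; elim: k g sg => [|k IH] g sg; have [c b] := base g sg.
  by split; [exact: c|exact: b|].
have [_ _ _ sg'] := tsmoothP sg.
split; [exact: c|exact: b|].
split=> [s t|]; first by have [] := pint_dt (sg 1%N) (cs s).
have -> : dt2 (fun s t => pint (clamp s) g t) =
    fun s t => pint (clamp s) (dt2 g) t.
  by apply/funext => s; rewrite /dt2; have [_ ->] := pint_dt (sg 1%N) (cs s).
exact: IH.
Qed.

Lemma tsmooth_const_s (g : R -> R -> R) (s : R) : tsmooth g -> tsmooth (fun _ t => g s t).
Proof. by move=> sg; apply: smooth1_tsmooth; exact: tsmooth_smooth1. Qed.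

Lemma tsmooth_tail_int (g : R -> R -> R) : tsmooth g -> tsmooth (tail_int g).
Proof.
move=> sg; apply: tsmoothD.
  have := tsmooth_const_s 1 (tsmooth_pint sg).
  by rewrite clamp_id// ler01 lexx.
rewrite [X in tsmooth X](_ : _ = fun s t => (-1) * pint (clamp s) g t).
  by apply: tsmoothM; [exact: tsmooth_cst|exact: tsmooth_pint].
by apply/funext => s; apply/funext => t; rewrite mulN1r.
Qed.

Lemma dt2_tail_int (g : R -> R -> R) : tsmooth g -> dt2 (tail_int g) = tail_int (dt2 g).
Proof.
move=> sg; apply/funext => s; apply/funext => t.
have cs : -1 <= clamp s <= 1 by have := clampP s; clear; lra.
have c1 : -1 <= (1:R) <= 1 by lra.
have [d1 e1] := pint_dt (sg 1%N) cs.
have [d2 e2] := pint_dt (sg 1%N) c1.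
have D1 := derivable_is_derive (d1 t) (congr1 (fun f => f t) e1).
have D2 := derivable_is_derive (d2 t) (congr1 (fun f => f t) e2).
exact: is_derive_derive1 (is_deriveB D2 D1).
Qed.

Lemma near_unit_itv (s : R) : 0 < s < 1 -> \forall z \near s, 0 <= z <= 1.
Proof.
move=> s01; have s' : s \in `]0, 1[ by rewrite in_itv.
apply: filterS (near_in_itvoo s') => z; rewrite in_itv/= => z01; lra.
Qed.

Lemma tail_int_ds (g : R -> R -> R) (t s : R) : continuous (g^~ t) -> 0 < s < 1 ->
  is_derive s 1 (fun s => tail_int g s t) (- g s t).
Proof.
move=> cg s01.
have s1' : -1 < s by lra.
have D : is_derive s 1 (fun z => pint 1 g t - pint z g t) (- g s t).
  have D1 := pint_derivable cg s1'.
  by have := is_deriveB (is_derive_cst (pint 1 g t) s 1) D1; rewrite sub0r.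
apply: (near_eq_is_derive _ D).
apply: filterS (near_unit_itv s01) => z z01.
by rewrite /tail_int clamp_id.
Qed.

(** This makes the derivative of a function on [0, 1] independent of its smooth extension, also at
    the end points, where it follows by continuity of the derivative from the interior. *)
Lemma smooth1_zero_derive (g : R -> R) : smooth1 g ->
  (forall t : R, 0 <= t <= 1 -> g t = 0) ->
  forall t : R, 0 <= t <= 1 -> derive1 g t = 0.
Proof.
move=> sg g0.
have int (x : R) : 0 < x < 1 -> derive1 g x = 0.
  move=> x01; rewrite derive1E.
  have D : is_derive x 1 (fun=> 0 : R) 0 by exact: is_derive_cst.
  apply: (@derive_val _ _ _ _ _ g).
  apply: (near_eq_is_derive _ D).
  by apply: filterS (near_unit_itv x01) => z z01; rewrite g0.
move=> t /andP[t0 t1].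
apply: contrapT => /eqP N.
have c : {for t, continuous (derive1 g)}.
  by apply: differentiable_continuous; apply/derivable1_diffP; exact: (sg 1%N).
have Hn : \forall x \near t, derive1 g x != 0 by exact: (cvgr_neq0 _ c N).
have [e /= e0 He] := (nbhs_ballP t _).1 Hn.
pose d := Num.min 1 e.
have d0 : 0 < d by rewrite lt_min ltr01.
have d1 : d <= 1 by rewrite ge_min lexx.
have de : d <= e by rewrite ge_min lexx orbT.
(* Moving from t towards the midpoint by a fraction d of the way enters the open interval, and the
   distance covered is at most d / 2 < e. *)
have x01 : 0 < t + (2^-1 - t) * d < 1.
  have h1 : 0 <= t * (1 - d) by rewrite mulr_ge0// subr_ge0.
  have h2 : 0 <= (1 - t) * (1 - d) by rewrite mulr_ge0// subr_ge0.
  by move: h1 h2 d0; clear; lra.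
have /He : ball t e (t + (2^-1 - t) * d).
  rewrite /ball/= opprD addNKr normrN normrM (gtr0_norm d0).
  have h : `|2^-1 - t| <= 2^-1 by rewrite ler_norml; move: t0 t1; clear; lra.
  have h' : `|2^-1 - t| * d <= 2^-1 * d by rewrite ler_wpM2r// ltW.
  by move: h' d0 de; clear; lra.
by rewrite int// eqxx.
Qed.

(** The mean value theorem asks for the derivative in the open interval only, which is all that
    clamped coefficients provide. *)
Lemma zero_derive_cst (g : R -> R) : continuous g ->
  (forall s : R, 0 < s < 1 -> is_derive s 1 g 0) ->
  forall s : R, 0 <= s <= 1 -> g s = g 1.
Proof.
move=> cg dg s /andP[s0]; rewrite le_eqVlt => /predU1P[->//|s1].
have [x||c _] := @MVT R g (fun=> 0) s 1 s1.
- by rewrite in_itv/= => /andP[sx x1]; apply: dg; rewrite (le_lt_trans s0 sx).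
- exact: continuous_subspaceT.
- by rewrite mul0r => /eqP; rewrite subr_eq0 => /eqP.
Qed.

End Integrals.

(** * Vector-valued functions *)

Section Tensors.
Context {R : realType}.
Local Notation I := {i01 R}.
Local Notation mu := (@lebesgue_measure R).

(* Induction on the number of vectors: a vector in the span of the others is
   eliminated, and otherwise its coefficient vanishes. *)
Lemma tensor_transfer (V : lmodType R) (X Y : Type)
    (D : (X -> R) -> (Y -> R) -> Prop) :
  (forall c g g' h h', D g g' -> D h h' ->
     D (fun x => c * g x + h x) (fun y => c * g' y + h' y)) ->
  (forall g g', D g g' -> (forall x, g x = 0) -> forall y, g' y = 0) ->
  forall N (g : 'I_N -> X -> R) (g' : 'I_N -> Y -> R) (v : 'I_N -> V),
  (forall i, D (g i) (g' i)) -> (forall x, \sum_i g i x *: v i = 0) ->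
  forall y, \sum_i g' i y *: v i = 0.
Proof.
move=> Dlin D0; elim=> [|N IH] g g' v Dg g0 y; first by rewrite big_ord0.
have [[c vc]|nc] := pselect (exists c : 'I_N -> R,
    v ord0 = \sum_i c i *: v (lift ord0 i)).
  have key (Z : Type) (k : 'I_N.+1 -> Z -> R) z : \sum_i k i z *: v i =
      \sum_i (c i * k ord0 z + k (lift ord0 i) z) *: v (lift ord0 i).
    rewrite big_ord_recl vc scaler_sumr -big_split/=; apply: eq_bigr => i _.
    by rewrite scalerA mulrC -scalerDl.
  rewrite key; apply: (IH (fun i x => c i * g ord0 x + g (lift ord0 i) x)
    (fun i y => c i * g' ord0 y + g' (lift ord0 i) y)) => [i|x].
    exact: Dlin.
  by rewrite -key.
have g00 x : g ord0 x = 0.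
  apply: contrapT => /eqP gx; apply: nc.
  exists (fun i => - (g ord0 x)^-1 * g (lift ord0 i) x).
  have /eqP := g0 x; rewrite big_ord_recl addr_eq0 => /eqP E.
  rewrite -[LHS]scale1r -(mulVf gx) -scalerA E scalerN -scaleNr scaler_sumr.
  by apply: eq_bigr => i _; rewrite scalerA.
rewrite big_ord_recl (D0 _ _ (Dg ord0) g00) scale0r add0r.
apply: (IH (fun i => g (lift ord0 i)) (fun i => g' (lift ord0 i))) => // x.
by have := g0 x; rewrite big_ord_recl g00 scale0r add0r.
Qed.

(** [D] is the graph of a linear operation on scalar functions. Applied coefficientwise, the
    operation gives the same result for any two representations of one vector-valued function. *)
Lemma tensor_transfer2 (V : lmodType R) (X Y : Type)
    (D : (X -> R) -> (Y -> R) -> Prop) :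
  (forall c g g' h h', D g g' -> D h h' ->
     D (fun x => c * g x + h x) (fun y => c * g' y + h' y)) ->
  (forall g g', D g g' -> (forall x, g x = 0) -> forall y, g' y = 0) ->
  forall N (g : 'I_N -> X -> R) (g' : 'I_N -> Y -> R) (v : 'I_N -> V)
         M (h : 'I_M -> X -> R) (h' : 'I_M -> Y -> R) (w : 'I_M -> V),
  (forall i, D (g i) (g' i)) -> (forall i, D (h i) (h' i)) ->
  (forall x, \sum_i g i x *: v i = \sum_i h i x *: w i) ->
  forall y, \sum_i g' i y *: v i = \sum_i h' i y *: w i.
Proof.
move=> Dlin D0 N g g' v M h h' w Dg Dh E y.
pose cat (Z : Type) (k : 'I_N -> Z -> R) (l : 'I_M -> Z -> R) i :=
  match fintype.split i with inl j => k j | inr j => l j end.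
pose u i := match fintype.split i with inl j => v j | inr j => - w j end.
have catE (Z : Type) (k : 'I_N -> Z -> R) (l : 'I_M -> Z -> R) z :
    \sum_i cat Z k l i z *: u i = \sum_i k i z *: v i - \sum_i l i z *: w i.
  rewrite big_split_ord/= -sumrN; congr (_ + _); apply: eq_bigr => i _.
    by rewrite /cat /u (unsplitK (inl i)).
  by rewrite /cat /u (unsplitK (inr i)) scalerN.
apply/eqP; rewrite -subr_eq0 -catE; apply/eqP.
apply: (tensor_transfer Dlin D0 (g := cat X g h) (g' := cat Y g' h')) => [i|x].
  by rewrite /cat; case: fintype.split.
by rewrite catE E subrr.
Qed.

Lemma smooth1_lin (c : R) (g h : R -> R) : smooth1 g -> smooth1 h ->
  smooth1 (fun x => c * g x + h x).
Proof.
move=> sg sh; apply: (@tsmooth_smooth1 _ (fun _ x => c * g x + h x) 0).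
exact: (tsmoothD (tsmoothM (tsmooth_cst c) (smooth1_tsmooth sg))
  (smooth1_tsmooth sh)).
Qed.

Lemma unit_itv_lift (x : R) : 0 <= x <= 1 -> exists t : I, t%:num = x.
Proof. by move=> /andP[x0 x1]; exists (Itv01 x0 x1). Qed.

(** [vderiv] picks some representation by choice; every other one gives the same value, since the
    derivative is a linear operation that vanishes on the zero function. *)
Lemma vderivE (V : lmodType R) (u : I -> V) N (g : 'I_N -> R -> R) v (t : I) :
  tensor_rep smooth1 setT u g v ->
  vderiv u t = \sum_(i < N) derive1 (g i) t%:num *: v i.
Proof.
move=> rep; rewrite /vderiv.
set P := [set w | _].
have /(xgetPex 0) : exists w, P w by eexists; exists N, g, v; split.
move=> [M [h [w [[sh _ eh] ->]]]]; case: rep => sg _ eg.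
(* The scalar functions are known on [0, 1] only, so the graph of the operation quantifies over
   smooth extensions; its output is a single number, hence indexed by [unit]. *)
pose D (k : I -> R) (k' : unit -> R) := exists2 l : R -> R, smooth1 l &
  (forall t : I, k t = l t%:num) /\ k' tt = derive1 l t%:num.
apply: (tensor_transfer2 (D := D) _ _ (g := fun i (t : I) => h i t%:num)
   (g' := fun i (_ : unit) => derive1 (h i) t%:num)
   (h := fun i (t : I) => g i t%:num)
   (h' := fun i (_ : unit) => derive1 (g i) t%:num) _ _ _ tt).
- move=> c k k' l l' [k0 sk [ek ek']] [l0 sl [el el']].
  exists (fun x => c * k0 x + l0 x); first exact: smooth1_lin.
  split; first by move=> x; rewrite ek el.
  have Hk := derivable_is_derive (sk 0%N t%:num) erefl.
  have Hl := derivable_is_derive (sl 0%N t%:num) erefl.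
  have E := is_deriveD (is_deriveZ c Hk) Hl.
  by rewrite ek' el'; apply/esym; exact: (is_derive_derive1 E).
- move=> k k' [l sl [ek ek']] k0 [].
  rewrite ek'; apply: smooth1_zero_derive => //; last by rewrite ge0 le1.
  by move=> x /unit_itv_lift[x' <-]; rewrite -ek.
- by move=> i; exists (h i).
- by move=> i; exists (g i).
- by move=> x; rewrite -eg -eh.
Qed.

Lemma vintE (V : lmodType R) (u : I -> V) N (g : 'I_N -> R -> R) v (S : I) :
  tensor_rep [set h | continuous h] setT u g v ->
  vint S u = \sum_(i < N) (\int[mu]_(x in `[S%:num, (1 : R)]) g i x) *: v i.
Proof.
move=> rep; rewrite /vint.
set P := [set w | _].
have /(xgetPex 0) : exists w, P w by eexists; exists N, g, v; split.
move=> [M [h [w [[ch _ eh] ->]]]]; case: rep => cg _ eg.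
pose D (k : I -> R) (k' : unit -> R) := exists2 l : R -> R, continuous l &
  (forall t : I, k t = l t%:num) /\
  k' tt = \int[mu]_(x in `[S%:num, (1 : R)]) l x.
apply: (tensor_transfer2 (D := D) _ _ (g := fun i (t : I) => h i t%:num)
   (g' := fun i (_ : unit) => \int[mu]_(x in `[S%:num, (1 : R)]) h i x)
   (h := fun i (t : I) => g i t%:num)
   (h' := fun i (_ : unit) => \int[mu]_(x in `[S%:num, (1 : R)]) g i x)
   _ _ _ tt).
- move=> c k k' l l' [k0 ck [ek ek']] [l0 cl [el el']].
  have ck' : continuous (fun x : R => c * k0 x).
    by move=> x; apply: cvgM; [exact: cvg_cst|exact: ck].
  exists (fun x => c * k0 x + l0 x).
    by move=> x; apply: cvgD; [exact: ck'|exact: cl].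
  split; first by move=> x; rewrite ek el.
  by rewrite RintegralD ?RintegralZl ?ek' ?el'//; exact: continuous_integrable.
- move=> k k' [l cl [ek ek']] k0 [].
  rewrite ek' (_ : 0 = \int[mu]_(x in `[S%:num, (1 : R)]) 0); last first.
    by rewrite Rintegral_cst// mul0r.
  apply: eq_Rintegral => x; rewrite inE/= in_itv/= => /andP[Sx x1].
  have /unit_itv_lift[x' <-] : 0 <= x <= 1 by rewrite x1 (le_trans _ Sx)// ge0.
  by rewrite -ek k0.
- by move=> i; exists (h i); [exact: ch|].
- by move=> i; exists (g i); [exact: cg|].
- by move=> x; rewrite -eg -eh.
Qed.

Section VectorValued.
Context {V : lmodType R}.
Implicit Types u w : I -> I -> V.

(** [u] and [u'] are sums over the same vectors with coefficients paired by [D]. Taking for [D] the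
    derivative in s, the derivative in t or the integral over [s, 1], one set of closure lemmas
    serves all three operations. *)
Inductive vten (D : (I -> I -> R) -> (I -> I -> R) -> Prop) :
    (I -> I -> V) -> (I -> I -> V) -> Prop :=
| vten0 : vten D (fun _ _ => 0) (fun _ _ => 0)
| vten_cons g g' v u u' : D g g' -> vten D u u' ->
    vten D (fun s t => g s t *: v + u s t) (fun s t => g' s t *: v + u' s t).

Lemma vten_ext D u u' w w' : vten D u u' ->
  (forall s t, u s t = w s t) -> (forall s t, u' s t = w' s t) -> vten D w w'.
Proof.
move=> Du uw uw'; have -> : w = u by apply/funext=> s; apply/funext.
by have -> : w' = u' by apply/funext=> s; apply/funext.
Qed.

Lemma vten_sum D N (g g' : 'I_N -> I -> I -> R) (v : 'I_N -> V) :
  (forall i, D (g i) (g' i)) ->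
  vten D (fun s t => \sum_i g i s t *: v i) (fun s t => \sum_i g' i s t *: v i).
Proof.
elim: N g g' v => [|N IH] g g' v Dg.
  by apply: vten_ext (vten0 D) _ _ => s t; rewrite big_ord0.
apply: vten_ext (vten_cons (v ord0) (Dg ord0) (IH (fun i => g (lift ord0 i))
  (fun i => g' (lift ord0 i)) (fun i => v (lift ord0 i)) _)) _ _ => //.
all: by move=> s t; rewrite big_ord_recl.
Qed.

Lemma vten_rep D u u' : vten D u u' ->
  exists N (g g' : 'I_N -> I -> I -> R) (v : 'I_N -> V),
    [/\ forall i, D (g i) (g' i), forall s t, u s t = \sum_i g i s t *: v i &
        forall s t, u' s t = \sum_i g' i s t *: v i].
Proof.
elim=> [|g g' v {}u {}u' Dg _ [N [h [h' [w [Dh eu eu']]]]]].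
  exists 0%N, (fun _ _ _ => 0), (fun _ _ _ => 0), (fun=> 0); split=> [[]//|s t|s t];
  by rewrite big_ord0.
exists N.+1, (fun i => if unlift ord0 i is Some j then h j else g),
  (fun i => if unlift ord0 i is Some j then h' j else g'),
  (fun i => if unlift ord0 i is Some j then w j else v); split=> [i|s t|s t].
- by case: unliftP.
- rewrite big_ord_recl unlift_none eu; congr (_ + _).
  by apply: eq_bigr => i _; rewrite liftK.
- rewrite big_ord_recl unlift_none eu'; congr (_ + _).
  by apply: eq_bigr => i _; rewrite liftK.
Qed.

Lemma vtenD D u u' w w' : vten D u u' -> vten D w w' ->
  vten D (fun s t => u s t + w s t) (fun s t => u' s t + w' s t).
Proof.
move=> Du Dw; elim: Du => [|g g' v {}u {}u' Dg _ IH].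
  by apply: vten_ext Dw _ _ => s t; rewrite add0r.
by apply: vten_ext (vten_cons v Dg IH) _ _ => s t; rewrite addrA.
Qed.

End VectorValued.

Lemma vten_lin (V W : lmodType R) (f : V -> W) D u u' :
  linear f -> vten D u u' ->
  vten D (fun s t => f (u s t)) (fun s t => f (u' s t)).
Proof.
move=> fl; have f0 : f 0 = 0.
  by have := fl (-1) 0 0; rewrite scaler0 addr0 scaleN1r addNr.
elim=> [|g g' v {}u {}u' Dg _ IH].
  by apply: vten_ext (vten0 D) _ _ => s t; rewrite f0.
by apply: vten_ext (vten_cons (f v) Dg IH) _ _ => s t; rewrite fl.
Qed.

Section Leibniz.
Context {V : lmodType R}.
Implicit Types u w : I -> I -> V.
Variable D : (I -> I -> R) -> (I -> I -> R) -> Prop.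
Hypothesis D_cst : forall c : R, D (fun _ _ => c) (fun _ _ => 0).
Hypothesis D_mul : forall g g' h h', D g g' -> D h h' ->
  D (fun s t => g s t * h s t) (fun s t => g' s t * h s t + g s t * h' s t).

Lemma vten_scale g g' u u' : D g g' -> vten D u u' ->
  vten D (fun s t => g s t *: u s t)
         (fun s t => g' s t *: u s t + g s t *: u' s t).
Proof.
move=> Dg; elim=> [|h h' v {}u {}u' Dh _ IH].
  by apply: vten_ext (vten0 D) _ _ => s t; rewrite !scaler0 ?addr0.
apply: vten_ext (vten_cons v (D_mul Dg Dh) IH) _ _ => s t.
  by rewrite scalerDr scalerA.
rewrite !scalerDr !scalerA scalerDl -!addrA; congr (_ + _).
by rewrite addrCA.
Qed.

Lemma vten_cst (v : V) : vten D (fun _ _ => v) (fun _ _ => 0).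
Proof.
apply: vten_ext (vten_cons v (D_cst 1) (vten0 D)) _ _ => s t.
  by rewrite scale1r addr0.
by rewrite scale0r addr0.
Qed.

(** Leibniz rule for evaluating a family of linear maps. Such a family is differentiable only at
    each fixed vector; this suffices because [u] is a finite combination of fixed vectors. *)
Lemma vten_subst (f f' : I -> I -> V -> V) u u' :
  (forall s t, linear (f s t)) -> (forall s t, linear (f' s t)) ->
  (forall v, vten D (fun s t => f s t v) (fun s t => f' s t v)) ->
  vten D u u' ->
  vten D (fun s t => f s t (u s t))
         (fun s t => f' s t (u s t) + f s t (u' s t)).
Proof.
move=> fl fl' Df.
have f0 s t : f s t 0 = 0.
  by have := fl s t (-1) 0 0; rewrite scaler0 addr0 scaleN1r addNr.
have f0' s t : f' s t 0 = 0.
  by have := fl' s t (-1) 0 0; rewrite scaler0 addr0 scaleN1r addNr.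
elim=> [|h h' v {}u {}u' Dh _ IH].
  by apply: vten_ext (vten0 D) _ _ => s t; rewrite ?f0 ?f0' ?addr0.
apply: vten_ext (vtenD (vten_scale Dh (Df v)) IH) _ _ => s t.
  by rewrite fl.
by rewrite fl fl' [X in X + _ = _]addrC addrACA.
Qed.

End Leibniz.

Definition restr (h : R -> R -> R) : I -> I -> R := fun s t => h s%:num t%:num.

(* The derivative in s is only required for 0 < s < 1: coefficients are made
   constant in s outside [0, 1], so they need not be differentiable at 0 and 1. *)
Definition ds_scal (g g' : I -> I -> R) : Prop := exists h h',
  [/\ tsmooth h, g = restr h, g' = restr h' &
      forall s t : R, 0 < s < 1 -> is_derive s 1 (h^~ t) (h' s t)].

Definition dt_scal (g g' : I -> I -> R) : Prop := exists h,
  [/\ tsmooth h, g = restr h & g' = restr (dt2 h)].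

Definition int_scal (g g' : I -> I -> R) : Prop := exists h,
  [/\ tsmooth h, g = restr h & g' = restr (tail_int h)].

Definition is_ds (V : lmodType R) := @vten V ds_scal.
Definition is_dt (V : lmodType R) := @vten V dt_scal.

Lemma ds_cst (c : R) : ds_scal (fun _ _ => c) (fun _ _ => 0).
Proof.
exists (fun _ _ => c), (fun _ _ => 0); split=> //; first exact: tsmooth_cst.
by move=> s t _; exact: is_derive_cst.
Qed.

Lemma dt_cst (c : R) : dt_scal (fun _ _ => c) (fun _ _ => 0).
Proof.
exists (fun _ _ => c); split=> //; first exact: tsmooth_cst.
by apply/funext => s; apply/funext => t; rewrite /restr /dt2 derive1_cst.
Qed.

Lemma ds_mul g g' h h' : ds_scal g g' -> ds_scal h h' ->
  ds_scal (fun s t => g s t * h s t)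
          (fun s t => g' s t * h s t + g s t * h' s t).
Proof.
move=> [g0 [g0' [sg -> -> dg]]] [h0 [h0' [sh -> -> dh]]].
exists (fun s t => g0 s t * h0 s t),
  (fun s t => g0' s t * h0 s t + g0 s t * h0' s t); split=> //.
  exact: tsmoothM.
move=> s t s01; have d1 := dg s t s01; have d2 := dh s t s01.
have := is_deriveM d1 d2; congr is_derive.
by rewrite addrC mulrC.
Qed.

Lemma dt_mul g g' h h' : dt_scal g g' -> dt_scal h h' ->
  dt_scal (fun s t => g s t * h s t)
          (fun s t => g' s t * h s t + g s t * h' s t).
Proof.
move=> [g0 [sg -> ->]] [h0 [sh -> ->]].
exists (fun s t => g0 s t * h0 s t); split=> //; first exact: tsmoothM.
apply/funext => s; apply/funext => t; rewrite /restr /dt2.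
have [_ _ d1 _] := tsmoothP sg; have [_ _ d2 _] := tsmoothP sh.
have D1 := derivable_is_derive (d1 s%:num t%:num) erefl.
have D2 := derivable_is_derive (d2 s%:num t%:num) erefl.
have E := is_deriveM D1 D2.
apply/esym; etransitivity; first exact: (is_derive_derive1 E).
by rewrite addrC; congr (_ + _); rewrite /GRing.scale/= mulrC.
Qed.

(** * Families of vectors over the square: derivatives and tail integrals *)

Section Calculus.
Context {V : lmodType R}.
Implicit Types u w : I -> I -> V.

Definition vsm u := exists u', is_dt u u'.

Lemma vsm_rep u : vsm u -> exists N (h : 'I_N -> R -> R -> R) (v : 'I_N -> V),
  (forall i, tsmooth (h i)) /\ forall s t, u s t = \sum_i restr (h i) s t *: v i.
Proof.
move=> [u' /vten_rep[N [g [g' [v [/choice[h Dg] eu _]]]]]].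
exists N, h, v; split=> [i|s t]; first by have [] := Dg i.
by rewrite eu; apply: eq_bigr => i _; have [_ -> _] := Dg i.
Qed.

Lemma rep_is_dt u N (h : 'I_N -> R -> R -> R) (v : 'I_N -> V) :
  (forall i, tsmooth (h i)) ->
  (forall s t, u s t = \sum_i restr (h i) s t *: v i) ->
  is_dt u (fun s t => \sum_i restr (dt2 (h i)) s t *: v i).
Proof.
move=> sh eu; apply: (vten_ext (vten_sum (D := dt_scal) (g := fun i => restr (h i))
  (g' := fun i => restr (dt2 (h i))) v _)) => // i.
by exists (h i).
Qed.

Lemma rep_vsm u N (h : 'I_N -> R -> R -> R) (v : 'I_N -> V) :
  (forall i, tsmooth (h i)) ->
  (forall s t, u s t = \sum_i restr (h i) s t *: v i) -> vsm u.
Proof. by move=> sh eu; eexists; exact: (rep_is_dt sh eu). Qed.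

Lemma is_dt_vderiv u u' : is_dt u u' ->
  forall s t, u' s t = vderiv (u s) t.
Proof.
move=> /vten_rep[N [g [g' [v [/choice[h Dg] eu eu']]]]] s t.
rewrite (@vderivE _ _ N (fun i => h i s%:num) v); last first.
  split=> // [i|x]; first by apply: tsmooth_smooth1; have [] := Dg i.
  by rewrite eu; apply: eq_bigr => i _; have [_ -> _] := Dg i.
by rewrite eu'; apply: eq_bigr => i _; have [_ _ ->] := Dg i.
Qed.

Lemma is_dt_deriv u : vsm u -> is_dt u (fun s t => vderiv (u s) t).
Proof.
by move=> [u' du]; apply: (vten_ext du) => // s t; rewrite (is_dt_vderiv du).
Qed.

Lemma is_dt_vsm' u u' : is_dt u u' -> vsm u'.
Proof.
move=> /vten_rep[N [g [g' [v [/choice[h Dg] _ eu]]]]].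
apply: (@rep_vsm _ N (fun i => dt2 (h i)) v) => [i|s t].
  by have [/tsmoothP[]] := Dg i.
by rewrite eu; apply: eq_bigr => i _; have [_ _ ->] := Dg i.
Qed.

Definition vtail u : I -> I -> V := fun S t => vint S (u^~ t).

Lemma rep_vtail u N (h : 'I_N -> R -> R -> R) (v : 'I_N -> V) :
  (forall i, tsmooth (h i)) ->
  (forall s t, u s t = \sum_i restr (h i) s t *: v i) ->
  forall S t, vtail u S t = \sum_i restr (tail_int (h i)) S t *: v i.
Proof.
move=> sh eu S t; rewrite /vtail (@vintE _ _ N (fun i => (h i)^~ t%:num) v).
  apply: eq_bigr => i _; rewrite /restr tail_intE ?ge0 ?le1//.
  by have [] := tsmoothP (sh i).
by split=> // i; have [c _ _ _] := tsmoothP (sh i); exact: c.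
Qed.

Lemma vtail_ds u : vsm u -> is_ds (vtail u) (fun s t => - u s t).
Proof.
move=> /vsm_rep[N [h [v [sh eu]]]].
apply: (vten_ext (vten_sum (D := ds_scal) (g := fun i => restr (tail_int (h i)))
  (g' := fun i => restr (fun s t => - h i s t)) v _)) => [i|s t|s t].
- exists (tail_int (h i)), (fun s t => - h i s t); split=> //.
    exact: tsmooth_tail_int.
  by move=> s t s01; have [c _ _ _] := tsmoothP (sh i); exact: (tail_int_ds (c t) s01).
- by rewrite (rep_vtail sh eu).
- by rewrite eu -sumrN; apply: eq_bigr => i _; rewrite -scaleNr.
Qed.

Lemma vtail_dt u u' : is_dt u u' -> is_dt (vtail u) (vtail u').
Proof.
move=> du; have [N [h [v [sh eu]]]] := vsm_rep (ex_intro _ _ du).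
have sI i := tsmooth_tail_int (sh i).
apply: (vten_ext (rep_is_dt sI (rep_vtail sh eu))) => // s t.
have sh' i : tsmooth (dt2 (h i)) by have [] := tsmoothP (sh i).
(* [u'] may come with a representation unrelated to the coefficients [h], but both compute
   [vderiv]. *)
have eu' s' t' : u' s' t' = \sum_i restr (dt2 (h i)) s' t' *: v i.
  by rewrite (is_dt_vderiv du) -(is_dt_vderiv (rep_is_dt sh eu)).
rewrite (rep_vtail sh' eu').
by apply: eq_bigr => i _; rewrite dt2_tail_int.
Qed.

Lemma vtail_vsm u : vsm u -> vsm (vtail u).
Proof. by move=> [u' du]; exists (vtail u'); exact: vtail_dt. Qed.

(** A coefficientwise argument fails, because a vanishing sum over dependent vectors does not make
    its coefficients vanish. [tensor_transfer] is used instead, for the operation that takes the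
    s-derivative of a coefficient to its difference from the value at s = 1. *)
Lemma is_ds0_cst u u' : is_ds u u' -> (forall s t, u' s t = 0) ->
  forall s t, u s t = u 1%:i01 t.
Proof.
move=> /vten_rep[N [g [g' [v [/choice[h Dg] eu eu']]]]] u0 s t.
pose D (k' k : I * I -> R) := exists l l',
  [/\ tsmooth l, forall z : I * I, k' z = restr l' z.1 z.2,
      forall z : I * I, k z = l z.1%:num z.2%:num - l 1 z.2%:num &
      forall s t : R, 0 < s < 1 -> is_derive s 1 (l^~ t) (l' s t)].
have := @tensor_transfer V _ _ D _ _ N (fun i z => g' i z.1 z.2)
  (fun i z => g i z.1 z.2 - g i 1%:i01 z.2) v _ _ (s, t).
move=> /= H; apply/eqP; rewrite -subr_eq0 !eu -sumrB; apply/eqP.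
under eq_bigr do rewrite -scalerBl.
apply: H => {s t}.
- move=> c k' k m' m [l [l' [sl ek' ek dl]]] [n [n' [sn em' em dn]]].
  exists (fun s t => c * l s t + n s t), (fun s t => c * l' s t + n' s t).
  split.
  + exact: (tsmoothD (tsmoothM (tsmooth_cst c) sl) sn).
  + by move=> z; rewrite ek' em'.
  + by move=> z; rewrite ek em; ring.
  + move=> s t s01; have d1 := dl s t s01; have d2 := dn s t s01.
    exact: (is_deriveD (is_deriveZ c d1) d2).
- move=> k' k [l [l' [sl ek' ek dl]]] k0 [s t].
  have [cl _ _ _] := tsmoothP sl.
  rewrite ek; apply/eqP; rewrite subr_eq0; apply/eqP.
  apply: (zero_derive_cst (cl _)); last by rewrite ge0 le1.
  move=> x x01; have := dl x t%:num x01.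
  have [x' ex] : exists x' : I, x'%:num = x.
    by apply: unit_itv_lift; move: x01; clear; lra.
  by have := k0 (x', t); rewrite ek' /restr/= ex => ->.
- move=> i; have [l' [sh eg eg' dh]] := Dg i.
  by exists (h i), l'; split=> // -[s t]; rewrite ?eg' ?eg.
- by move=> [s t]; rewrite -eu' u0.
Qed.

Lemma vsmooth2_rep u : vsmooth2 u ->
  vsm u /\ is_ds u (fun s t => vderiv (u^~ t) s).
Proof.
move=> [N [g [v [sg eu]]]].
have eu' s t : u s t = \sum_i restr (fun s t => g i (clamp s) t) s t *: v i.
  by rewrite eu; apply: eq_bigr => i _; rewrite /restr clamp_id// ge0 le1.
split; first by apply: (rep_vsm _ eu') => i; exact: smooth2_tsmooth.
pose g' i s t := derive1 ((g i)^~ t) s.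
apply: (vten_ext (vten_sum (D := ds_scal)
  (g := fun i => restr (fun s t => g i (clamp s) t))
  (g' := fun i => restr (g' i)) v _)) => [i|s t|s t].
- exists (fun s t => g i (clamp s) t), (g' i); split=> //.
    exact: smooth2_tsmooth.
  move=> s t s01; have [_ [d _ _ _]] := sg i 1%N.
  have D := derivable_is_derive (d s t) erefl.
  apply: (near_eq_is_derive _ D).
  by apply: filterS (near_unit_itv s01) => z z01; rewrite clamp_id.
- by rewrite eu'.
- rewrite (@vderivE _ _ N (fun i => (g i)^~ t%:num) v) => //.
  split=> // i k x.
  have : smooth2 (g i) by exact: sg.
  elim: k {sg eu eu' g'} (g i) => [|k IH] h sh.
    by have [_ [d _ _ _]] := sh 1%N; exact: d.
  rewrite derive1Sn.
  apply: (IH (fun s t => derive1 (h^~ t) s)) => l.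
  by have [_ []] := sh l.+1.
Qed.

End Calculus.
End Tensors.

(** * Sums over factorizations of a list *)

Section Splittings.
Context {T : Type}.

Section Zmod.
Context {Z : zmodType}.
Implicit Types (F G : seq T -> seq T -> Z) (x : seq T).

(* The sum of F p q over all factorizations x = p ++ q *)
Fixpoint spl F x : Z :=
  if x is v :: x' then F [::] x + spl (fun p q => F (v :: p) q) x'
  else F [::] [::].

Definition spl3 (F : seq T -> seq T -> seq T -> Z) x : Z :=
  spl (fun p r => spl (F p) r) x.

Definition spl5 (F : seq T -> seq T -> seq T -> seq T -> seq T -> Z) x : Z :=
  spl (fun a r => spl (fun b r => spl3 (F a b) r) r) x.

Lemma spl_big F x :
  spl F x = \sum_(0 <= j < (size x).+1) F (take j x) (drop j x).
Proof.
elim: x F => [|v x IH] F /=; first by rewrite big_nat1.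
by rewrite big_nat_recl//= IH.
Qed.

Lemma eq_spl_in F G x : (forall p q, p ++ q = x -> F p q = G p q) ->
  spl F x = spl G x.
Proof.
elim: x F G => [|v x IH] F G FG /=; first exact: FG.
by rewrite FG// (IH _ (fun p q => G (v :: p) q))// => p q e; rewrite FG//= e.
Qed.

Lemma eq_spl F G x : (forall p q, F p q = G p q) -> spl F x = spl G x.
Proof. by move=> FG; exact: eq_spl_in. Qed.

Lemma eq_spl3 (F G : seq T -> seq T -> seq T -> Z) x :
  (forall p q s, F p q s = G p q s) -> spl3 F x = spl3 G x.
Proof. by move=> FG; apply: eq_spl => p r; exact: eq_spl. Qed.

Lemma spl0 x : spl (fun _ _ => 0) x = 0.
Proof. by elim: x => //= v x ->; rewrite addr0. Qed.

Lemma splD F G x : spl (fun p q => F p q + G p q) x = spl F x + spl G x.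
Proof.
elim: x F G => //= v x IH F G.
by rewrite (IH (fun p q => F (v :: p) q)) addrACA.
Qed.

Lemma spl3D (F G : seq T -> seq T -> seq T -> Z) x :
  spl3 (fun p q s => F p q s + G p q s) x = spl3 F x + spl3 G x.
Proof. by rewrite -splD; apply: eq_spl => p r; rewrite splD. Qed.

Lemma spl_coassoc (F : seq T -> seq T -> seq T -> Z) x :
  spl (fun p q => spl (fun p1 p2 => F p1 p2 q) p) x = spl3 F x.
Proof.
rewrite /spl3; elim: x F => //= v x IH F.
rewrite (splD (fun _ _ => _)) -addrA; congr (_ + _); congr (_ + _).
exact: IH.
Qed.

Lemma spl_cat_cons F p w s : spl F (p ++ w :: s) =
  spl (fun p1 p2 => F p1 (p2 ++ w :: s)) p +
  spl (fun s1 s2 => F (p ++ w :: s1) s2) s.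
Proof. by elim: p F => //= v p IH F; rewrite IH addrA. Qed.

(** The middle factor lies to the left of [w], contains it, or lies to its right. When [w] is the
    result of an insertion, these are the possible positions of a second insertion. *)
Lemma spl3_cat_cons (F : seq T -> seq T -> seq T -> Z) p w s :
  spl3 F (p ++ w :: s) =
    spl3 (fun p1 p2 p3 => F p1 p2 (p3 ++ w :: s)) p
  + spl (fun p1 p2 => spl (fun s1 s2 => F p1 (p2 ++ w :: s1) s2) s) p
  + spl3 (fun s1 s2 s3 => F (p ++ w :: s1) s2 s3) s.
Proof.
rewrite /spl3 spl_cat_cons; congr (_ + _).
by rewrite -splD; apply: eq_spl => p1 p2; rewrite spl_cat_cons.
Qed.

End Zmod.

Lemma spl_morph (Z Z' : zmodType) (h : Z -> Z') F x :
  {morph h : a b / a + b} -> h (spl F x) = spl (fun p q => h (F p q)) x.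
Proof. by move=> hD; elim: x F => //= v x IH F; rewrite hD IH. Qed.

Lemma spl3_morph (Z Z' : zmodType) (h : Z -> Z') F x :
  {morph h : a b / a + b} -> h (spl3 F x) = spl3 (fun p q s => h (F p q s)) x.
Proof.
by move=> hD; rewrite /spl3 spl_morph//; apply: eq_spl => p r; exact: spl_morph.
Qed.

Lemma spl_scale (K : nzRingType) (Z : lmodType K) (c : K)
    (F : seq T -> seq T -> Z) x :
  spl (fun p q => c *: F p q) x = c *: spl F x.
Proof. by rewrite (@spl_morph _ _ ( *:%R c))//; exact: scalerDr. Qed.

Lemma splN (Z : zmodType) (F : seq T -> seq T -> Z) x :
  spl (fun p q => - F p q) x = - spl F x.
Proof. by rewrite (@spl_morph _ _ -%R)//; exact: opprD. Qed.

Lemma spl3_scale (K : nzRingType) (Z : lmodType K) (c : K)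
    (F : seq T -> seq T -> seq T -> Z) x :
  spl3 (fun p q s => c *: F p q s) x = c *: spl3 F x.
Proof. by rewrite (@spl3_morph _ _ ( *:%R c))//; exact: scalerDr. Qed.

Lemma spl3N (Z : zmodType) (F : seq T -> seq T -> seq T -> Z) x :
  spl3 (fun p q s => - F p q s) x = - spl3 F x.
Proof. by rewrite (@spl3_morph _ _ -%R)//; exact: opprD. Qed.

Lemma spl5_scale (K : nzRingType) (Z : lmodType K) (c : K)
    (F : seq T -> seq T -> seq T -> seq T -> seq T -> Z) x :
  spl5 (fun a b p q s => c *: F a b p q s) x = c *: spl5 F x.
Proof.
rewrite /spl5 -spl_scale; apply: eq_spl => a r; rewrite -spl_scale.
by apply: eq_spl => b r'; rewrite spl3_scale.
Qed.

Section Rearrange.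
Context {Z : zmodType}.
Implicit Types (F : seq T -> seq T -> seq T -> seq T -> seq T -> Z).

Lemma spl_exchange (F : seq T -> seq T -> seq T -> seq T -> Z) x y :
  spl (fun p q => spl (F p q) y) x = spl (fun a b => spl (fun p q => F p q a b) x) y.
Proof.
elim: x F => //= v x IH F; rewrite IH -splD; exact: eq_spl.
Qed.

(** Here and in the next two lemmas, a factorization into five blocks is reached from one into three
    by cutting the middle factor, both outer factors, or the left factor. *)
Lemma spl5_inside F x :
  spl3 (fun p q s => spl3 (fun a b c => F p a b c s) q) x = spl5 F x.
Proof.
apply: eq_spl => p r; rewrite /spl3.
rewrite (spl_coassoc (fun a r' s => spl (fun b c => F p a b c s) r')).
by apply: eq_spl => a r'; exact: spl_coassoc.
Qed.

Lemma spl5_around F x :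
  spl3 (fun p q s => spl (fun a b => spl (fun c d => F a b q c d) s) p) x
  = spl5 F x.
Proof.
rewrite -[RHS]spl_coassoc; apply: eq_spl => p r.
by rewrite (spl_exchange (fun q s a b => spl (fun c d => F a b q c d) s)).
Qed.

Lemma spl5_left F x :
  spl3 (fun p q s => spl3 (fun a b c => F a b c q s) p) x = spl5 F x.
Proof.
have -> : spl5 F x = spl (fun p r =>
    spl (fun a b => spl (fun c r' => spl (fun q s => F a b c q s) r') r) p) x.
  by rewrite [RHS]spl_coassoc.
transitivity (spl (fun p r => spl (fun a r' => spl (fun b c =>
   spl (fun q s => F a b c q s) r) r') p) x).
  apply: eq_spl => p r; rewrite spl_exchange; apply: eq_spl => a r'.
  by rewrite spl_exchange.
rewrite [LHS]spl_coassoc [RHS]spl_coassoc.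
by apply: eq_spl => a r; rewrite [LHS]spl_coassoc.
Qed.

Lemma spl4_left (F : seq T -> seq T -> seq T -> seq T -> Z) x :
  spl3 (fun p q s => spl (fun a b => F a b q s) p) x
  = spl (fun a r => spl3 (F a) r) x.
Proof.
transitivity (spl (fun p r => spl (fun a b => spl (F a b) r) p) x).
  apply: eq_spl => p r.
  by rewrite (spl_exchange (fun q s a b => F a b q s)).
by rewrite [LHS]spl_coassoc.
Qed.

Lemma spl4_right (F : seq T -> seq T -> seq T -> seq T -> Z) x :
  spl3 (fun p q s => spl (fun c d => F p q c d) s) x
  = spl (fun y d => spl3 (fun p q c => F p q c d) y) x.
Proof.
rewrite [RHS](spl_coassoc (fun p r d => spl (fun q c => F p q c d) r)).
by apply: eq_spl => p r; rewrite [RHS]spl_coassoc.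
Qed.

End Rearrange.
End Splittings.

Lemma spl_map (T U : Type) (Z : zmodType) (h : T -> U)
    (F : seq U -> seq U -> Z) x :
  spl F (map h x) = spl (fun p q => F (map h p) (map h q)) x.
Proof. by elim: x F => //= v x IH F; rewrite IH. Qed.

Lemma spl3_map (T U : Type) (Z : zmodType) (h : T -> U)
    (F : seq U -> seq U -> seq U -> Z) x :
  spl3 F (map h x) = spl3 (fun p q s => F (map h p) (map h q) (map h s)) x.
Proof. by rewrite /spl3 spl_map; apply: eq_spl => p r; rewrite spl_map. Qed.

(** * Multilinear maps and signs *)

Section Multilinear.
Context {R : realType}.

Definition mlin (M N : lmodType R) (f : seq M -> N) : Prop :=
  forall p q, linear (fun v => f (p ++ v :: q)).

Lemma lin0 (M N : lmodType R) (f : M -> N) : linear f -> f 0 = 0.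
Proof. by move=> fl; have := fl (-1) 0 0; rewrite scaler0 addr0 scaleN1r addNr. Qed.

Lemma linD (M N : lmodType R) (f : M -> N) : linear f -> {morph f : u v / u + v}.
Proof. by move=> fl u v; have := fl 1 u v; rewrite !scale1r. Qed.

Lemma linZ (M N : lmodType R) (f : M -> N) c u : linear f -> f (c *: u) = c *: f u.
Proof. by move=> fl; have := fl c u 0; rewrite !addr0 (lin0 fl) addr0. Qed.

Lemma linN (M N : lmodType R) (f : M -> N) u : linear f -> f (- u) = - f u.
Proof. by move=> fl; rewrite -scaleN1r linZ// scaleN1r. Qed.

Lemma lin_sum (M N : lmodType R) (f : M -> N) (T : Type) (r : seq T) (F : T -> M) :
  linear f -> f (\sum_(i <- r) F i) = \sum_(i <- r) f (F i).
Proof.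
move=> fl; elim: r => [|i r IH]; first by rewrite !big_nil lin0.
by rewrite !big_cons linD// IH.
Qed.

Lemma mlin0 (M N : lmodType R) (f : seq M -> N) p q : mlin f -> f (p ++ 0 :: q) = 0.
Proof. by move=> fm; exact: (lin0 (fm p q)). Qed.

Lemma mlinZ (M N : lmodType R) (f : seq M -> N) p q c u : mlin f ->
  f (p ++ (c *: u) :: q) = c *: f (p ++ u :: q).
Proof. by move=> fm; exact: (linZ c u (fm p q)). Qed.

Lemma mlin_prefix (M N : lmodType R) (f : seq M -> N) p :
  mlin f -> mlin (fun x => f (p ++ x)).
Proof. by move=> fm a q c u v; rewrite !catA; exact: fm. Qed.

Lemma mlin_cons (M N : lmodType R) (f : seq M -> N) v :
  mlin f -> mlin (fun x => f (v :: x)).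
Proof. by move=> fm; exact: (mlin_prefix [:: v]). Qed.

Lemma mlin_add (M N : lmodType R) (f g : seq M -> N) : mlin f -> mlin g ->
  mlin (fun x => f x + g x).
Proof. by move=> fm gm p q c u v; rewrite fm gm scalerDr addrACA. Qed.

Lemma mlin_scale (M N : lmodType R) c (f : seq M -> N) : mlin f ->
  mlin (fun x => c *: f x).
Proof. by move=> fm p q d u v; rewrite fm scalerDr !scalerA mulrC. Qed.

Lemma mlin_opp (M N : lmodType R) (f : seq M -> N) : mlin f ->
  mlin (fun x => - f x).
Proof. by move=> fm p q d u v; rewrite fm opprD scalerN. Qed.

Lemma mlin_comp (M N P : lmodType R) (h : N -> P) (f : seq M -> N) :
  linear h -> mlin f -> mlin (h \o f).
Proof. by move=> hl fm p q d u v; rewrite /= fm hl. Qed.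

End Multilinear.

Section Graded.
Context {R : realType} {V : lmodType R}.
Variable gV : gspace V.
Hypothesis gV_full : gcar gV = setT.

Local Notation tw := (twist gV).
Local Notation gc := (gcirc gV).
Local Notation sgn k := ((-1 : R) ^ (k : int)).

Lemma gcar_full v : gcar gV v. Proof. by rewrite gV_full. Qed.

(** The finitely supported sum in [twist] may be taken over any finite set containing [J], uniformly
    in [l]. Linearity needs a common index set for several vectors. *)
Lemma twistE v : exists J : seq int, forall J', uniq J' -> {subset J <= J'} ->
  forall l, tw l v = \sum_(i <- J') sgn (l * (i - 1)) *: gproj gV i v.
Proof.
have [J HJ] := gproj_supp (gcar_full v).
exists (undup J) => J' uJ' sJ l.
have P0 i : i \notin J -> gproj gV i v = 0.
  have uJ : uniq (undup J) by exact: undup_uniq.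
  move=> iJ; rewrite {1}(HJ _ uJ) ?(lin_sum _ _ (gproj_linear gV i)); last first.
    by move=> j; rewrite mem_undup.
  rewrite big_seq big1// => j; rewrite mem_undup => jJ.
  rewrite gproj_proj; last exact: gcar_full.
  by case: eqP => // ij; rewrite ij jJ in iJ.
rewrite /twist -(fsbig_widen [set` J'])//; last first.
  move=> i [_ /= iJ']; rewrite P0 ?scaler0//.
  by apply/negP => iJ; apply: iJ'; apply: sJ; rewrite mem_undup.
by rewrite (fsbig_seq _ _ uJ').
Qed.

Lemma twist_linear l : linear (tw l).
Proof.
move=> c u v.
have [J1 H1] := twistE u; have [J2 H2] := twistE v.
have [J3 H3] := twistE (c *: u + v).
pose J := undup (J1 ++ J2 ++ J3).
have uJ : uniq J by exact: undup_uniq.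
rewrite (H1 J) ?(H2 J) ?(H3 J)//; try
  by move=> i iJ; rewrite mem_undup !mem_cat iJ ?orbT.
rewrite scaler_sumr -big_split/=; apply: eq_bigr => i _.
by rewrite gproj_linear scalerDr !scalerA mulrC.
Qed.

Lemma gproj_gdeg i v : gdeg gV i (gproj gV i v).
Proof.
split; first exact: gcar_full.
by rewrite gproj_proj ?eqxx//; exact: gcar_full.
Qed.

Lemma gproj_homog i k v : gdeg gV k v -> gproj gV i v = if i == k then v else 0.
Proof.
move=> [_ <-]; rewrite gproj_proj; last exact: gcar_full.
by case: eqP.
Qed.

Lemma twist_homog l k v : gdeg gV k v -> tw l v = sgn (l * (k - 1)) *: v.
Proof.
move=> vk; have [J HJ] := twistE v.
have uJ : uniq (undup (k :: J)) by exact: undup_uniq.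
have sJ : {subset J <= undup (k :: J)}.
  by move=> i iJ; rewrite mem_undup inE iJ orbT.
have kJ : k \in undup (k :: J) by rewrite mem_undup inE eqxx.
rewrite (HJ _ uJ sJ) (bigD1_seq k kJ uJ).
rewrite (gproj_homog _ vk) eqxx big1 /= ?addr0// => i /negPf ik.
by rewrite (gproj_homog _ vk) ik scaler0.
Qed.

Lemma lin_homog_ext (N : lmodType R) (f g : V -> N) : linear f -> linear g ->
  (forall k v, gdeg gV k v -> f v = g v) -> forall v, f v = g v.
Proof.
move=> fl gl fg v; have [J _ ->] := gproj_sum (gcar_full v).
rewrite !lin_sum//; apply: eq_bigr => i _; exact: fg (gproj_gdeg i v).
Qed.

(** Each entry is a sum of homogeneous ones. Treating the entries one by one behind a homogeneous
    prefix reduces identities of multilinear maps to lists on which [twist] is an actual sign. *)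
Lemma mlin_homog_ext (N : lmodType R) (f g : seq V -> N) : mlin f -> mlin g ->
  (forall a d, homog gV a d -> f a = g a) -> forall a, f a = g a.
Proof.
move=> fm gm fg a.
suff: forall p d, homog gV p d -> f (p ++ a) = g (p ++ a).
  by move=> /(_ [::] [::]); apply; split.
elim: a => [|v a IH] p d hp; first by rewrite cats0; exact: fg hp.
apply: (lin_homog_ext (fm p a) (gm p a)) => k {}v vk.
rewrite -!cat_rcons; apply: (IH _ (rcons d k)).
case: hp => sd hp; split; first by rewrite !size_rcons sd.
move=> i; rewrite size_rcons ltnS leq_eqVlt !nth_rcons sd => /predU1P[->|ip].
  by rewrite ltnn eqxx.
by rewrite ip; exact: hp.
Qed.

Lemma sgnD (a b : int) : sgn (a + b) = sgn a * sgn b.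
Proof. by rewrite expfzDr// oppr_eq0 oner_eq0. Qed.

Lemma sgn_sqr (a : int) : sgn a * sgn a = 1.
Proof. by rewrite -expfzMl mulrNN mulr1 exp1rz. Qed.

Lemma sgnN (a : int) : sgn (- a) = sgn a.
Proof.
have := sgn_sqr a; rewrite -{1}(mulr1 (sgn a)) => H.
by apply: (mulIf (x := sgn a)); rewrite ?expfz_neq0 ?oppr_eq0 ?oner_eq0//
  -sgnD addNr expr0z sgn_sqr.
Qed.

Lemma twistD l l' v : tw l (tw l' v) = tw (l + l') v.
Proof.
apply: (lin_homog_ext (f := fun v => tw l (tw l' v)) (g := tw (l + l')))
  => {v} [c u v||k v vk]; first by rewrite !twist_linear.
- exact: twist_linear.
- rewrite (twist_homog _ vk) linZ ?(twist_homog _ vk) ?scalerA; last exact: twist_linear.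
  by rewrite -sgnD -mulrDl addrC.
Qed.

Lemma twistC l l' v : tw l (tw l' v) = tw l' (tw l v).
Proof. by rewrite !twistD addrC. Qed.

Lemma twist0 v : tw 0 v = v.
Proof.
apply: (lin_homog_ext (f := tw 0) (g := id)) => // {v} [|k v vk].
  exact: twist_linear.
by rewrite (twist_homog _ vk) mul0r expr0z scale1r.
Qed.

Lemma twistN l v : tw (- l) v = tw l v.
Proof.
apply: (lin_homog_ext (f := tw (- l)) (g := tw l)) => {v} [||k v vk];
  try exact: twist_linear.
by rewrite !(twist_homog _ vk) mulNr sgnN.
Qed.

(** Equivalently |f(a)| - 1 = sum (|a_i| - 1) + k. In the shifted grading the condition does not
    mention the arity, so it covers Hom(V^n, V[1-n+k]) for all n at once. *)
Definition sdeg (k : int) (f : seq V -> V) : Prop := forall a d,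
  homog gV a d -> gdeg gV (\sum_(e <- d) (e - 1) + k + 1) (f a).

Lemma sum_shift (d : seq int) :
  \sum_(e <- d) (e - 1) = \sum_(e <- d) e - (size d)%:Z.
Proof.
elim: d => [|e d IH]; first by rewrite !big_nil.
by rewrite !big_cons IH /=; lia.
Qed.

Lemma homog_cons v a e d : homog gV (v :: a) (e :: d) <->
  gdeg gV e v /\ homog gV a d.
Proof.
split=> [[/= [sd] h]|[hv [sd h]]].
  split; first exact: (h 0%N).
  by split=> // i ia; exact: (h i.+1).
by split=> [/=|[|i] ia]; [rewrite sd|exact: hv|exact: h].
Qed.

Lemma homog_nil d : homog gV [::] d -> d = [::].
Proof. by case=> /size0nil. Qed.

Lemma homog_cat p q d : homog gV (p ++ q) d ->
  exists d1 d2, [/\ d = d1 ++ d2, homog gV p d1 & homog gV q d2].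
Proof.
elim: p d => [|v p IH] d /=; first by exists [::], d; split.
case: d => [[]//|e d] /homog_cons[ve /IH[d1 [d2 [-> h1 h2]]]].
by exists (e :: d1), d2; split=> //; exact/homog_cons.
Qed.

Lemma cat_homog p q d1 d2 : homog gV p d1 -> homog gV q d2 ->
  homog gV (p ++ q) (d1 ++ d2).
Proof.
elim: p d1 => [|v p IH] d1; first by move=> /homog_nil ->.
case: d1 => [[]//|e d1] /homog_cons[ve hp] hq /=.
by apply/homog_cons; split=> //; exact: IH.
Qed.

Lemma gdegZ k c v : gdeg gV k v -> gdeg gV k (c *: v).
Proof.
move=> [_ e]; split; first exact: gcar_full.
by rewrite (linZ _ _ (gproj_linear gV k)) e.
Qed.

Lemma gdegD k u v : gdeg gV k u -> gdeg gV k v -> gdeg gV k (u + v).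
Proof.
move=> [_ e] [_ e']; split; first exact: gcar_full.
by rewrite (linD (gproj_linear gV k)) e e'.
Qed.

Lemma gdeg0 k : gdeg gV k 0.
Proof. by split; [exact: gcar_full|rewrite (lin0 (gproj_linear gV k))]. Qed.

Lemma homog_twist l a d : homog gV a d -> homog gV (map (tw l) a) d.
Proof.
elim: a d => [|v a IH] [|e d]; try by move=> [].
move=> /homog_cons[ve /IH h]; apply/homog_cons; split=> //.
by rewrite (twist_homog _ ve); exact: gdegZ.
Qed.

Lemma mlin_twist (N : lmodType R) (f : seq V -> N) l a d : mlin f ->
  homog gV a d -> f (map (tw l) a) = sgn (l * \sum_(e <- d) (e - 1)) *: f a.
Proof.
elim: a d f => [|v a IH] d f fm.
  by move=> /homog_nil ->; rewrite big_nil mulr0 expr0z scale1r.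
case: d => [[]//|e d] /homog_cons[ve ha] /=.
rewrite (IH d (fun x => f (tw l v :: x)))//; last exact: mlin_cons.
rewrite (twist_homog _ ve) (mlinZ [::])//= scalerA big_cons -sgnD.
by congr (sgn _ *: _); ring.
Qed.

Lemma mlin_map_twist (N : lmodType R) (f : seq V -> N) l : mlin f ->
  mlin (fun x => f (map (tw l) x)).
Proof.
move=> fm p q c u v; rewrite !map_cat/= twist_linear; exact: fm.
Qed.

(** The Koszul rule: moving the twist from the value to the arguments costs (-1)^(l k). *)
Lemma twist_sdeg l k (f : seq V -> V) x : mlin f -> sdeg k f ->
  tw l (f x) = sgn (l * k) *: f (map (tw l) x).
Proof.
move=> fm fk; apply: (mlin_homog_ext (f := fun x => tw l (f x))
  (g := fun x => sgn (l * k) *: f (map (tw l) x))) => {x}.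
- by apply: mlin_comp => //; exact: twist_linear.
- by apply: mlin_scale; exact: mlin_map_twist.
- move=> a d ha; rewrite (twist_homog _ (fk a d ha)) (mlin_twist _ fm ha).
  by rewrite scalerA -sgnD; congr (sgn _ *: _); ring.
Qed.

End Graded.

(** * The circle product *)

(** Bridges two orders of summation: [gcirc] runs over the length of the inserted block first,
    [spl3] over its position. *)
Lemma exchange_triangle (Z : nmodType) (n : nat) (X : nat -> nat -> Z) :
  \sum_(0 <= r < n.+1) \sum_(0 <= j < (n - r).+1) X r j =
  \sum_(0 <= j < n.+1) \sum_(0 <= r < (n - j).+1) X r j.
Proof.
have widen (Y : nat -> nat -> Z) :
    \sum_(0 <= r < n.+1) \sum_(0 <= j < (n - r).+1) Y r j =
    \sum_(0 <= r < n.+1) \sum_(0 <= j < n.+1) if (r + j <= n)%N then Y r j else 0.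
  apply: eq_big_nat => r /andP[_ rn].
  rewrite (big_nat_widen _ _ n.+1) ?ltnS ?leq_subr// big_mkcond/=.
  apply: eq_big_nat => j _; rewrite ltnS leq_subRL//.
rewrite widen exchange_big/= (widen (fun j r => X r j)).
by apply: eq_bigr => j _; apply: eq_bigr => r _; rewrite addnC.
Qed.

Lemma spl3_big (T : Type) (Z : zmodType) (F : seq T -> seq T -> seq T -> Z) a :
  spl3 F a = \sum_(0 <= r < (size a).+1) \sum_(0 <= j < (size a - r).+1)
    F (take j a) (take r (drop j a)) (drop (j + r) a).
Proof.
rewrite exchange_triangle /spl3 spl_big; apply: eq_big_nat => j _.
rewrite spl_big size_drop; apply: eq_big_nat => r _.
by rewrite drop_drop addnC.
Qed.

Section Circle.
Context {R : realType} {V : lmodType R}.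
Variable gV : gspace V.
Hypothesis gV_full : gcar gV = setT.

Local Notation tw := (twist gV).
Local Notation gc := (gcirc gV).
Local Notation sgn k := ((-1 : R) ^ (k : int)).
Implicit Types (f g K : seq V -> V).

Lemma gcircE l f g a :
  gc l f g a = spl3 (fun p q s => f (map (tw l) p ++ g q :: s)) a.
Proof. by rewrite spl3_big. Qed.

Lemma spl_linear (T : Type) (U : lmodType R) (F : U -> seq T -> seq T -> V) x :
  (forall p q, linear (fun v => F v p q)) -> linear (fun v => spl (F v) x).
Proof.
move=> Fl c u v; rewrite -spl_scale -splD; apply: eq_spl => p q; exact: Fl.
Qed.

Lemma spl3_linear (T : Type) (U : lmodType R) (F : U -> seq T -> seq T -> seq T -> V) x :
  (forall p q s, linear (fun v => F v p q s)) -> linear (fun v => spl3 (F v) x).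
Proof. by move=> Fl; apply: spl_linear => p r; exact: spl_linear. Qed.

Lemma linear_add (U W : lmodType R) (f g : U -> W) : linear f -> linear g ->
  linear (fun v => f v + g v).
Proof. by move=> fl gl c u v; rewrite fl gl scalerDr addrACA. Qed.

Lemma gc_mlin l f g : mlin f -> mlin g -> mlin (gc l f g).
Proof.
move=> fm gm p q.
have twl := twist_linear gV_full l.
suff H : linear (fun v => spl3 (fun a b c => f (map (tw l) a ++ g b :: c)) (p ++ v :: q)).
  by move=> c u v; rewrite !gcircE; exact: H.
have E v := spl3_cat_cons (fun a b c => f (map (tw l) a ++ g b :: c)) p v q.
move=> c u v; rewrite !E {E}; move: c u v.
apply: linear_add; first apply: linear_add.
- apply: spl3_linear => a b s c u v.
  by have := fm (map (tw l) a ++ g b :: s) q c u v; rewrite -!catA.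
- apply: spl_linear => a b; apply: spl_linear => d e c u v.
  by rewrite gm fm.
- apply: spl3_linear => a b s c u v.
  by rewrite !map_cat/= twl -!catA/=; exact: fm.
Qed.

Lemma eq_gc l f f' g g' x : (forall y, f y = f' y) -> (forall y, g y = g' y) ->
  gc l f g x = gc l f' g' x.
Proof.
by move=> ff gg; rewrite !gcircE; apply: eq_spl3 => p q s; rewrite ff gg.
Qed.

Lemma gcDl l f f' g x : gc l (fun y => f y + f' y) g x = gc l f g x + gc l f' g x.
Proof. by rewrite !gcircE spl3D. Qed.

Lemma gcNl l f g x : gc l (fun y => - f y) g x = - gc l f g x.
Proof. by rewrite !gcircE spl3N. Qed.

Lemma gcDr l f g g' x : mlin f ->
  gc l f (fun y => g y + g' y) x = gc l f g x + gc l f g' x.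
Proof.
move=> fm; rewrite !gcircE -spl3D; apply: eq_spl3 => p q s.
exact: (linD (fm _ _)).
Qed.

Lemma gcNr l f g x : mlin f -> gc l f (fun y => - g y) x = - gc l f g x.
Proof.
move=> fm; rewrite !gcircE -spl3N; apply: eq_spl3 => p q s.
exact: (linN _ (fm _ _)).
Qed.

Lemma gc_parity l f g x : gc (- l) f g x = gc l f g x.
Proof.
rewrite !gcircE; apply: eq_spl3 => p q s.
by congr (f (_ ++ _)); apply: eq_map => v; rewrite twistN.
Qed.

Lemma gc0E f g x : gc 0 f g x = spl3 (fun p q s => f (p ++ g q :: s)) x.
Proof.
rewrite gcircE; apply: eq_spl3 => p q s.
by congr (f (_ ++ _)); rewrite -[RHS]map_id; apply: eq_map => v; rewrite twist0.
Qed.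

Lemma gdeg_spl (T : Type) k (F : seq T -> seq T -> V) x :
  (forall p q, p ++ q = x -> gdeg gV k (F p q)) -> gdeg gV k (spl F x).
Proof.
elim: x F => [|v x IH] F FG /=; first exact: FG.
by apply: gdegD => //; [exact: FG|apply: IH => p q e; apply: FG; rewrite /= e].
Qed.

Lemma gc_sdeg l f g k k' : sdeg gV k f -> sdeg gV k' g ->
  sdeg gV (k + k') (gc l f g).
Proof.
move=> fk gk a d ha; rewrite gcircE.
apply: gdeg_spl => p r epr; apply: gdeg_spl => q s eqs; subst r a.
have [d1 [d' [-> h1 h']]] := homog_cat ha.
have [d2 [d3 [-> h2 h3]]] := homog_cat h'.
have hg := gk _ _ h2.
have := fk _ _ (cat_homog (homog_twist gV_full l h1)
  ((homog_cons gV _ _ _ _).2 (conj hg h3))).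
congr gdeg; rewrite !big_cat/= big_cons; ring.
Qed.

(* Both sides expand to the insertions of f and g in disjoint places, which
   are symmetric in f and g. *)
Lemma gc_prelie l l' K f g x : mlin K -> mlin f -> mlin g ->
  sdeg gV l f -> sdeg gV l' g ->
  gc l' (gc l K f) g x - gc (l + l') K (gc l' f g) x =
  sgn (l * l') *: (gc l (gc l' K g) f x - gc (l + l') K (gc l g f) x).
Proof.
move=> Km fm gm fd gd.
pose T2 := map (fun v => tw l (tw l' v)).
pose A (k' : int) (h h' : seq V -> V) := spl5 (fun a b c d e =>
  K (T2 a ++ h (map (tw k') b) :: map (tw k') c ++ h' d :: e)) x.
have T2C k k' (p : seq V) : k = l /\ k' = l' \/ k = l' /\ k' = l ->
    map (tw k) (map (tw k') p) = T2 p.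
  move=> kk; rewrite -map_comp; apply: eq_map => v /=.
  by case: kk => -[-> ->]; rewrite ?(twistC gV_full l').
(* The arguments of [h] lie to the left of the entry produced by [h'], contain it, or lie to its
   right. In the last case the twist belonging to [h] passes [h'], which gives the sign. Exchanging
   [h] and [h'] swaps the two outer terms up to that sign. *)
have key k k' (h h' : seq V -> V) : k = l /\ k' = l' \/ k = l' /\ k' = l ->
    mlin h -> mlin h' -> sdeg gV k h -> sdeg gV k' h' ->
    gc k' (gc k K h) h' x = A k' h h' + gc (k + k') K (gc k' h h') x
      + sgn (k * k') *: A k h' h.
  move=> kk hm hm' hd hd'.
  rewrite gcircE.
  under eq_spl3 do rewrite gcircE spl3_cat_cons.
  rewrite !spl3D; congr (_ + _ + _).
  - rewrite /A -spl5_left; apply: eq_spl3 => p q s.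
    rewrite spl3_map; apply: eq_spl3 => p1 p2 p3.
    by rewrite (T2C _ _ _ kk).
  - rewrite gcircE.
    have -> : spl3 (fun p q s => K (map (tw (k + k')) p ++ gc k' h h' q :: s)) x =
        spl3 (fun p q s => spl3 (fun a b c =>
          K (map (tw (k + k')) p ++ h (map (tw k') a ++ h' b :: c) :: s)) q) x.
      apply: eq_spl3 => p q s; rewrite gcircE.
      by rewrite (spl3_morph (h := fun v => K (_ ++ v :: s)))//; exact: (linD (Km _ _)).
    rewrite (spl5_inside (fun p a b c s =>
       K (map (tw (k + k')) p ++ h (map (tw k') a ++ h' b :: c) :: s))) -spl5_around.
    apply: eq_spl3 => p q s; rewrite spl_map; apply: eq_spl => a b.
    apply: eq_spl => c d; congr (K (_ ++ _)).
    by rewrite -map_comp; apply: eq_map => v /=; rewrite twistD.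
  - rewrite /A -spl5_scale; apply: eq_spl3 => p q s.
    apply: eq_spl3 => a b c; rewrite map_cat/= (T2C _ _ _ kk) -catA/=.
    by rewrite (twist_sdeg gV_full _ _ hm' hd') (mlinZ _ _ _ _ Km).
rewrite (key l l')// ?(key l' l)//; try by [left|right].
rewrite (addrC l' l) addrAC addrK [in RHS]addrAC addrK scalerDr scalerA.
by rewrite (mulrC l' l) sgn_sqr scale1r addrC.
Qed.

Lemma homog_mlin_prefix (N : lmodType R) (f : seq V -> N) p y : mlin f ->
  mlin (fun x => f (p ++ x ++ y)).
Proof. by move=> fm a q c u v; rewrite -!catA !catA -!(catA (p ++ a)); exact: fm. Qed.

(** Twisting the first j arguments produces the sign (-1)^(eps_j). The circle product also contains
    insertions of the empty block, r = 0, which vanish because [g [::] = 0]. *)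
Lemma sum_insert f g a d : mlin f -> g [::] = 0 -> homog gV a d ->
  \sum_(1 <= r < (size a).+1) \sum_(0 <= j < (size a - r).+1)
    sgn (eps d j) *: insert f g j r a = gc 1 f g a.
Proof.
move=> fm g0 ha; rewrite /gcirc [RHS]big_ltn//.
rewrite [X in _ = X + _]big1 ?add0r => [|j _]; last first.
  by rewrite take0 g0 mlin0.
apply: eq_bigr => r _; apply: eq_bigr => j _; rewrite /insert.
have hj : homog gV (take j a) (take j d).
  have := ha; rewrite -{1}(cat_take_drop j a) => /homog_cat[d1 [d2 [-> h1 h2]]].
  have sd1 : size d1 = size (take j a) by case: h1.
  have [ja|ja] := leqP (size a) j.
    have [s2 _] := h2; move: s2; rewrite drop_oversize// => /size0nil ->.
    have sj : (size d1 <= j)%N by rewrite sd1 size_take_min geq_minl.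
    by rewrite cats0 (take_oversize sj).
  have sj : size d1 = j by rewrite sd1 size_takel// ltnW.
  by rewrite take_size_cat.
have := mlin_twist gV_full 1 (homog_mlin_prefix [::]
  (g (take r (drop j a)) :: drop (j + r) a) fm) hj.
by rewrite /= mul1r => ->.
Qed.

End Circle.

(** * Compositions of a list into blocks *)

Section Blocks.
Context {R : realType} {V : lmodType R}.
Variable gV : gspace V.
Hypothesis gV_full : gcar gV = setT.
Local Notation I := {i01 R}.
Local Notation tw := (twist gV).
Local Notation gc := (gcirc gV).
Local Notation sgn k := ((-1 : R) ^ (k : int)).
Implicit Types (K : seq V -> V) (gs : seq (seq V -> V)).

(* The sum of K (g_1 x_1, .., g_r x_r) over the factorizations
   x = x_1 ++ .. ++ x_r, for gs = [:: g_1; ..; g_r] *)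
Fixpoint blocks gs K (x : seq V) : V :=
  if gs is g :: gs' then spl (fun p q => blocks gs' (fun y => K (g p :: y)) q) x
  else if x is [::] then K [::] else 0.

(* The same sum, with g_j replaced by g'_j and g_i by tau \o g_i for i < j,
   summed over j *)
Fixpoint tblocks (tau : V -> V) gs gs' K (x : seq V) : V :=
  match gs, gs' with
  | g :: gs1, g' :: gs1' =>
      spl (fun p q => blocks gs1 (fun y => K (g' p :: y)) q
                    + tblocks tau gs1 gs1' (fun y => K (tau (g p) :: y)) q) x
  | _, _ => 0
  end.

Lemma eq_blocks gs K K' x : (forall y, K y = K' y) -> blocks gs K x = blocks gs K' x.
Proof. by move=> /funext ->. Qed.

Lemma blocksD gs K K' x :
  blocks gs (fun y => K y + K' y) x = blocks gs K x + blocks gs K' x.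
Proof.
elim: gs K K' x => [|g gs IH] K K' x /=.
  by case: x => // v x; rewrite addr0.
by rewrite -splD; apply: eq_spl => p q; rewrite IH.
Qed.

Lemma blocks_linear (U : lmodType R) gs (K : U -> seq V -> V) x :
  (forall y, linear (fun u => K u y)) -> linear (fun u => blocks gs (K u) x).
Proof.
elim: gs K x => [|g gs IH] K x Kl /=.
  by case: x => [|v x]; [exact: Kl|move=> c u v'; rewrite scaler0 addr0].
apply: spl_linear => p q; exact: (IH (fun u y => K u (g p :: y))).
Qed.

Lemma mlin_head K : mlin K -> forall y, linear (fun u => K (u :: y)).
Proof. by move=> Km y; exact: (Km [::] y). Qed.

(** Insertion is a derivation: the entry produced by [a] falls into exactly one block. The twist of
    the arguments in front of it becomes a twist of the values of the earlier blocks, since the maps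
    in [gs] commute with [twist]. *)
Lemma gc_blocks l gs K a x : mlin K ->
  (forall i p, (i < size gs)%N ->
     nth (fun=> 0) gs i (map (tw l) p) = tw l (nth (fun=> 0) gs i p)) ->
  gc l (blocks gs K) a x = tblocks (tw l) gs [seq gc l g a | g <- gs] K x.
Proof.
elim: gs K x => [|g gs IH] K x Km gtw /=.
  rewrite gcircE -[RHS](spl0 x); apply: eq_spl => p r.
  by rewrite -[RHS](spl0 r); apply: eq_spl => q s /=; case: p.
rewrite gcircE.
under eq_spl3 do rewrite /= spl_cat_cons spl_map.
rewrite spl3D splD [in RHS]addrC; congr (_ + _).
  rewrite (spl4_left (fun p1 p2 q s => blocks gs
     (fun y => K (g (map (tw l) p1) :: y)) (map (tw l) p2 ++ a q :: s))).
  apply: eq_spl => p r; rewrite -IH; last 2 first.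
  - exact: mlin_cons.
  - by move=> i; exact: (gtw i.+1).
  rewrite gcircE; apply: eq_spl3 => p1 q s.
  by have -> : g (map (tw l) p) = tw l (g p) := gtw 0%N p isT.
rewrite (spl4_right (fun p q c d => blocks gs
   (fun y => K (g (map (tw l) p ++ a q :: c) :: y)) d)).
apply: eq_spl => p q; rewrite gcircE.
rewrite (spl3_morph (h := fun v => blocks gs (fun y => K (v :: y)) q))//.
apply: linD; apply: (@blocks_linear V gs (fun v y => K (v :: y)) q).
exact: mlin_head.
Qed.

Lemma tblocks_nseq tau r (g g' : seq V -> V) K x :
  tblocks tau (nseq r g) (nseq r g') K x =
  \sum_(0 <= j < r) blocks (nseq j (tau \o g) ++ g' :: nseq (r - j.+1) g) K x.
Proof.
elim: r K x => [|r IH] K x /=; first by rewrite big_nil.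
rewrite big_nat_recl//= subn1/= splD; congr (_ + _).
under eq_spl do rewrite IH.
elim: (index_iota 0 r) => [|j s IHs].
  by rewrite big_nil; under eq_spl do rewrite big_nil; rewrite spl0.
by rewrite big_cons -IHs -splD; apply: eq_spl => p q; rewrite big_cons subSS.
Qed.

(** Used with H in the marked slot and its s-derivative H \o a + F \o c: the first summand stays
    with the derivation terms, the second is split off. *)
Lemma tblocks_slot l1 l1' h h1 h2 l2 l2' K x : mlin K -> size l1 = size l1' ->
  tblocks id (l1 ++ h :: l2) (l1' ++ (fun y => h1 y + h2 y) :: l2') K x =
  tblocks id (l1 ++ h :: l2) (l1' ++ h1 :: l2') K x + blocks (l1 ++ h2 :: l2) K x.
Proof.
elim: l1 l1' K x => [|f l1 IH] [|f' l1'] // K x Km /=.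
  move=> _; rewrite -splD; apply: eq_spl => p q.
  rewrite (linD (@blocks_linear V _ (fun v y => K (v :: y)) _ (mlin_head Km))).
  by rewrite addrAC.
move=> [sl]; rewrite -splD; apply: eq_spl => p q.
by rewrite IH ?addrA//; exact: mlin_cons.
Qed.

Section Derivation.
Variable D : (I -> I -> R) -> (I -> I -> R) -> Prop.
Hypothesis D_mul : forall (g g' h h' : I -> I -> R), D g g' -> D h h' ->
  D (fun s t => g s t * h s t) (fun s t => g' s t * h s t + g s t * h' s t).

Lemma vten_spl (T : Type) (F F' : I -> I -> seq T -> seq T -> V) x :
  (forall p q, vten D (fun s t => F s t p q) (fun s t => F' s t p q)) ->
  vten D (fun s t => spl (F s t) x) (fun s t => spl (F' s t) x).
Proof.
elim: x F F' => [|v x IH] F F' DF /=; first exact: DF.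
apply: vtenD; first exact: DF.
exact: (IH (fun s t p q => F s t (v :: p) q) (fun s t p q => F' s t (v :: p) q)).
Qed.

Lemma vten_gc l (f f' g g' : I -> I -> seq V -> V) :
  (forall s t, mlin (f s t)) -> (forall s t, mlin (f' s t)) ->
  (forall x, vten D (fun s t => f s t x) (fun s t => f' s t x)) ->
  (forall x, vten D (fun s t => g s t x) (fun s t => g' s t x)) ->
  forall x, vten D (fun s t => gc l (f s t) (g s t) x)
    (fun s t => gc l (f' s t) (g s t) x + gc l (f s t) (g' s t) x).
Proof.
move=> fm fm' Df Dg x.
apply: (vten_ext (u := fun s t => spl3 (fun p q r => f s t (map (tw l) p ++ g s t q :: r)) x)
  (u' := fun s t => spl3 (fun p q r => f' s t (map (tw l) p ++ g s t q :: r)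
     + f s t (map (tw l) p ++ g' s t q :: r)) x)).
- apply: vten_spl => p r; apply: vten_spl => q {}r.
  apply: (vten_subst D_mul (f := fun s t v => f s t (map (tw l) p ++ v :: r))
    (f' := fun s t v => f' s t (map (tw l) p ++ v :: r))) => // s t.
    exact: fm.
  exact: fm'.
- by move=> s t; rewrite gcircE.
- by move=> s t; rewrite !gcircE spl3D.
Qed.

Definition der_family (gs gs' : seq (I -> I -> seq V -> V)) := size gs = size gs' /\
  forall i x, (i < size gs)%N -> vten D (fun s t => nth (fun _ _ _ => 0) gs i s t x)
    (fun s t => nth (fun _ _ _ => 0) gs' i s t x).

Lemma vten_blocks (gs gs' : seq (I -> I -> seq V -> V)) (K K' : I -> I -> seq V -> V) x : der_family gs gs' ->
  (forall s t, mlin (K s t)) -> (forall s t, mlin (K' s t)) ->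
  (forall y, vten D (fun s t => K s t y) (fun s t => K' s t y)) ->
  vten D (fun s t => blocks [seq g s t | g <- gs] (K s t) x)
    (fun s t => tblocks id [seq g s t | g <- gs] [seq g s t | g <- gs'] (K s t) x
              + blocks [seq g s t | g <- gs] (K' s t) x).
Proof.
elim: gs gs' K K' x => [|g gs IH] [|g' gs'] K K' x [//= sg Dg] Km Km' DK.
  case: x => [|v x]; first by apply: (vten_ext (DK [::])) => // s t; rewrite add0r.
  by apply: (vten_ext (vten0 D)) => // s t; rewrite add0r.
have Dg0 p : vten D (fun s t => g s t p) (fun s t => g' s t p) := Dg 0%N p isT.
have fam : der_family gs gs'.
  by split=> [|i]; [case: sg|exact: (Dg i.+1)].
apply: (vten_ext (vten_spl x (fun p q => IH gs' (fun s t y => K s t (g s t p :: y))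
   (fun s t y => K' s t (g s t p :: y) + K s t (g' s t p :: y)) q fam _ _ _))) => //.
- by move=> p _ s t; exact: (mlin_cons _ (Km s t)).
- by move=> p _ s t; exact: (mlin_add (mlin_cons _ (Km' s t)) (mlin_cons _ (Km s t))).
- move=> p _ y; apply: (vten_subst D_mul (f := fun s t v => K s t (v :: y))
    (f' := fun s t v => K' s t (v :: y))) => // s t.
    exact: mlin_head (Km s t) y.
  exact: mlin_head (Km' s t) y.
move=> s t; rewrite -splD; apply: eq_spl => p q.
by rewrite blocksD addrC -addrA [RHS]addrC.
Qed.

End Derivation.
End Blocks.

(** * Comparison with sums over compositions of an integer *)

Section Compositions.
Context {T : Type} {Z : zmodType}.
Implicit Types (Phi : seq (seq T) -> Z).

(* The sum of Phi [:: x_1; ..; x_r] over the factorizations of x into r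
   (possibly empty) blocks *)
Fixpoint csum (r : nat) Phi (x : seq T) : Z :=
  if r is r'.+1 then spl (fun p q => csum r' (fun bs => Phi (p :: bs)) q) x
  else if x is [::] then Phi [::] else 0.

Lemma eq_csum r Phi Phi' x : (forall bs, size bs = r -> Phi bs = Phi' bs) ->
  csum r Phi x = csum r Phi' x.
Proof.
elim: r Phi Phi' x => [|r IH] Phi Phi' x E /=; first by case: x => //; exact: E.
by apply: eq_spl => p q; apply: IH => bs sb; apply: E; rewrite /= sb.
Qed.

Lemma csum0 r x : csum r (fun=> 0) x = 0.
Proof.
elim: r x => [|r IH] x /=; first by case: x.
by rewrite -[RHS](spl0 x); exact: eq_spl.
Qed.

Lemma csumD r Phi Phi' x :
  csum r (fun bs => Phi bs + Phi' bs) x = csum r Phi x + csum r Phi' x.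
Proof.
elim: r Phi Phi' x => [|r IH] Phi Phi' x /=; first by case: x => // ? ?; rewrite addr0.
by rewrite -splD; apply: eq_spl => p q; rewrite IH.
Qed.

Lemma csumN r Phi x : csum r (fun bs => - Phi bs) x = - csum r Phi x.
Proof.
elim: r Phi x => [|r IH] Phi x /=; first by case: x => // ? ?; rewrite oppr0.
by rewrite -splN; apply: eq_spl => p q; rewrite IH.
Qed.

Lemma csum_sum (J : Type) (js : seq J) r (Phi : J -> seq (seq T) -> Z) x :
  csum r (fun bs => \sum_(j <- js) Phi j bs) x = \sum_(j <- js) csum r (Phi j) x.
Proof.
elim: js => [|j js IH].
  by rewrite big_nil -[RHS](csum0 r x); apply: eq_csum => bs _; rewrite big_nil.
by rewrite big_cons -IH -csumD; apply: eq_csum => bs _; rewrite big_cons.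
Qed.

(** Induction on r, the head of the tuple being the length of the first block. As [size x < N], no
    block length is excluded by the type ['I_N]. *)
Lemma csum_tuples N r Phi x : (size x < N)%N ->
  \sum_(s : r.-tuple 'I_N | sumn [seq val i | i <- s] == size x)
    Phi (reshape [seq val i | i <- s] x) = csum r Phi x.
Proof.
elim: r Phi x => [|r IH] Phi x xN.
  rewrite big_mkcond (big_pred1 [tuple]) => [|s]; first by case: x xN.
  by rewrite /= (tuple0 s); apply/esym/eqP.
rewrite (reindex (fun p : 'I_N * r.-tuple 'I_N => [tuple of p.1 :: p.2]))/=; last first.
  exists (fun s : r.+1.-tuple 'I_N => (thead s, [tuple of behead s])).
    by move=> [i s] _; congr (_, _); apply: val_inj.
  by move=> s _; rewrite /= -tuple_eta.
rewrite -(pair_big_dep xpredT (fun (i : 'I_N) (s : r.-tuple 'I_N) =>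
    (val i + sumn [seq val j | j <- s] == size x)%N)
  (fun (i : 'I_N) (s : r.-tuple 'I_N) => Phi (take i x ::
      reshape [seq val j | j <- s] (drop i x))))/=.
rewrite spl_big (big_nat_widen _ _ N)// big_mkord [RHS]big_mkcond/=.
apply: eq_bigr => i _; rewrite ltnS; case: leqP => ix; last first.
  rewrite big_pred0// => s; apply/eqP => E; move: ix.
  by rewrite -E ltnNge leq_addr.
rewrite -IH; last by rewrite size_drop (leq_ltn_trans (leq_subr _ _)).
apply: eq_bigl => s; rewrite size_drop.
by rewrite -[RHS](eqn_add2l i) subnKC.
Qed.

(** Compositions have positive parts, while [csum] allows empty blocks; the additional terms vanish
    by the hypothesis on [Phi]. *)
Lemma csum_pos_tuples N r Phi x : (size x < N)%N ->
  (forall bs, has (@nilp T) bs -> Phi bs = 0) ->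
  \sum_(s : r.-tuple 'I_N | all (fun i : nat => 0 < i)%N [seq val i | i <- s] &&
        (sumn [seq val i | i <- s] == size x))
    Phi (reshape [seq val i | i <- s] x) = csum r Phi x.
Proof.
move=> xN P0; rewrite -(csum_tuples _ _ xN).
rewrite [RHS](bigID (fun s : r.-tuple 'I_N =>
  all (fun i : nat => 0 < i)%N [seq val i | i <- s]))/= [X in _ = _ + X]big1.
  by rewrite addr0; apply: eq_bigl => s; rewrite andbC.
move=> s /andP[_]; rewrite -has_predC => hs; apply: P0.
elim: [seq val i | i <- s] x {xN} hs => //= -[|i] sh IH x /=; first by rewrite take0.
by move=> /IH ->; rewrite orbT.
Qed.

End Compositions.

Section BlockSums.
Context {R : realType} {V : lmodType R}.
Implicit Types (g K : seq V -> V) (gs : seq (seq V -> V)).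

Lemma blocks_csum gs K x :
  blocks gs K x = csum (size gs) (fun bs => K [seq f.1 f.2 | f <- zip gs bs]) x.
Proof.
elim: gs K x => [|g gs IH] K x //=.
by apply: eq_spl => p q; rewrite IH.
Qed.

Lemma blocks_nseq_csum r g K x :
  blocks (nseq r g) K x = csum r (fun bs => K (map g bs)) x.
Proof.
rewrite blocks_csum size_nseq; apply: eq_csum => bs <-; congr K.
by elim: bs => //= b bs ->.
Qed.

Lemma blocks_marked_csum r j g h g' K x : (j < r)%N ->
  blocks (nseq j g ++ h :: nseq (r - j.+1) g') K x =
  csum r (fun bs => K (map g (take j bs) ++ h (nth [::] bs j) ::
                       map g' (drop j.+1 bs))) x.
Proof.
move=> jr; rewrite blocks_csum size_cat/= !size_nseq addnS -addSn subnKC//.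
apply: eq_csum => bs sb; congr K; move: jr; rewrite -sb.
elim: bs j {sb} => //= b bs IH [_|j]; last by rewrite ltnS subSS => /IH /= ->.
rewrite /= subn1/= drop0; congr (_ :: _).
by elim: bs {IH} => //= b' bs ->.
Qed.

(** The identity morphism as a family of maps on lists. It is also the tree without vertices. *)
Definition unary (x : seq V) : V := if x is [:: v] then v else 0.

Lemma blocks0 gs x : blocks gs (fun=> 0) x = 0.
Proof.
elim: gs x => [|g gs IH] x /=; first by case: x.
by under eq_spl do rewrite IH; rewrite spl0.
Qed.

Lemma spl_head (T : Type) (F : seq T -> seq T -> V) x :
  (forall v p q, F (v :: p) q = 0) -> spl F x = F [::] x.
Proof.
case: x => //= v x F0; rewrite (eq_spl (G := fun _ _ => 0)) ?spl0 ?addr0//.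
Qed.

(** Only the factorization into single entries survives, and it has exactly [size x] blocks. *)
Lemma blocks_unary r K x : mlin K ->
  blocks (nseq r unary) K x = if size x == r then K x else 0.
Proof.
elim: r K x => [|r IH] K x Km /=; first by case: x.
have Z y : blocks (nseq r unary) (fun z => K (0 :: z)) y = 0.
  rewrite -[RHS](blocks0 (nseq r unary) y); apply: eq_blocks => z.
  exact: (mlin0 [::] z Km).
case: x => [|v x] /=; first exact: Z.
rewrite Z add0r spl_head => [|w p q]; last exact: Z.
by rewrite IH//; exact: mlin_cons.
Qed.

End BlockSums.

(** * Extension of multilinear maps to pairs u + dt u' *)

Section Marked.
Context {R : realType} {V : lmodType R}.
Variable gV : gspace V.
Hypothesis gV_full : gcar gV = setT.
Local Notation tw := (twist gV).
Local Notation gc := (gcirc gV).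
Local Notation sgn k := ((-1 : R) ^ (k : int)).
Implicit Types (f g K : seq V -> V).

Section Mark.
Context {T : Type}.
Implicit Types (F : seq T -> T -> seq T -> V).

(** Selects blocks of length one, so that a sum over marked entries becomes a [spl3] and the
    rearrangements of five blocks apply. *)
Definition sing (m : seq T) (h : T -> V) : V := if m is [:: x] then h x else 0.

(* The sum of F p x q over the factorizations w = p ++ x :: q *)
Fixpoint mark F (w : seq T) : V :=
  if w is x :: w' then F [::] x w' + mark (fun p => F (x :: p)) w' else 0.

Lemma mark_big F w (x0 : T) :
  mark F w = \sum_(0 <= j < size w) F (take j w) (nth x0 w j) (drop j.+1 w).
Proof.
elim: w F => [|x w IH] F /=; first by rewrite big_nil.
by rewrite big_nat_recl//= drop0 IH.
Qed.

Lemma mark_spl3 F w : mark F w = spl3 (fun p m q => sing m (fun x => F p x q)) w.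
Proof.
elim: w F => [|x w IH] F //=; rewrite IH {IH} /spl3/=; congr (_ + _).
rewrite add0r (spl_head (F := fun m q => sing (x :: m) (fun y => F [::] y q)))//.
Qed.

Lemma eq_mark F G w : (forall p x q, F p x q = G p x q) -> mark F w = mark G w.
Proof.
elim: w F G => //= x w IH F G E; rewrite E (IH _ (fun p => G (x :: p)))//.
Qed.

Lemma mark0 w : mark (fun _ _ _ => 0) w = 0.
Proof. by elim: w => //= x w ->; rewrite addr0. Qed.

Lemma markZ c F w : mark (fun p x q => c *: F p x q) w = c *: mark F w.
Proof.
elim: w F => [|x w IH] F /=; first by rewrite scaler0.
by rewrite (IH (fun p => F (x :: p))) scalerDr.
Qed.

Lemma mark_cat_cons F p w s : mark F (p ++ w :: s) =
  mark (fun a x b => F a x (b ++ w :: s)) p + F p w s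
  + mark (fun a x b => F (p ++ w :: a) x b) s.
Proof.
elim: p F => [|v p IH] F /=; first by rewrite add0r.
by rewrite IH !addrA.
Qed.

Lemma sing_spl (U : Type) m (F : T -> seq U -> seq U -> V) y :
  sing m (fun x => spl (F x) y) = spl (fun p q => sing m (fun x => F x p q)) y.
Proof. by case: m => [|x [|x' m]] //=; rewrite spl0. Qed.

Lemma sing_spl3 (U : Type) m (F : T -> seq U -> seq U -> seq U -> V) y :
  sing m (fun x => spl3 (F x) y) = spl3 (fun p q s => sing m (fun x => F x p q s)) y.
Proof.
rewrite /spl3 sing_spl; apply: eq_spl => p r; exact: sing_spl.
Qed.

End Mark.

Lemma mark_map (T U : Type) (h : T -> U) (F : seq U -> U -> seq U -> V) w :
  mark F (map h w) = mark (fun p x q => F (map h p) (h x) (map h q)) w.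
Proof. by elim: w F => //= x w IH F; rewrite IH. Qed.

(** The dt-coefficient of the extension of [f] to forms at a fixed t, without the factor (-1)^||f||.
    The twist is the sign of pulling dt out past the earlier entries. *)
Definition dext f (w : seq (V * V)) : V :=
  mark (fun p x q => f ([seq tw 1 y.1 | y <- p] ++ x.2 :: [seq y.1 | y <- q])) w.

(** The analogue of [twist] on u + dt u' for the total degree: dt raises the degree by one, whence
    the extra sign on the second component. *)
Definition ptwist l (y : V * V) : V * V := (tw l y.1, sgn l *: tw l y.2).

(** Extension to forms is compatible with the circle product. The marked dt-entry stands to the
    right of the arguments of [g], among them, or to their left; these cases are [left_], [inside]
    and [right_], and they match on both sides by the Koszul rule. *)
Lemma dext_gc l f g w : mlin f -> mlin g -> sdeg gV l g ->
  dext (gc l f g) w = sgn l *: spl3 (fun p q s =>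
     dext f (map (ptwist l) p ++ (g [seq y.1 | y <- q], sgn l *: dext g q) :: s)) w.
Proof.
move=> fm gm gd; rewrite /dext.
pose fst1 := map (fun y : V * V => y.1).
pose tw1 := map (fun y : V * V => tw 1 y.1).
pose twl := map (fun y : V * V => tw l (tw 1 y.1)).
pose left_ := spl5 (fun a b c m d => sing m (fun x : V * V =>
   f (twl a ++ g (tw1 b) :: tw1 c ++ x.2 :: fst1 d))) w.
pose inside := spl5 (fun a b m c d => sing m (fun x : V * V =>
   f (twl a ++ g (tw1 b ++ x.2 :: fst1 c) :: fst1 d))) w.
pose right_ := spl5 (fun a m b c d => sing m (fun x : V * V =>
   f (twl a ++ tw l x.2 :: map (tw l) (fst1 b) ++ g (fst1 c) :: fst1 d))) w.
have mapE (h h' : V * V -> V) (k : V -> V) p : (forall y, k (h y) = h' y) ->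
    map k (map h p) = map h' p.
  by move=> E; rewrite -map_comp; exact: eq_map.
transitivity (left_ + inside + right_).
  rewrite mark_spl3.
  have E p m q : sing m (fun x : V * V => gc l f g (tw1 p ++ x.2 :: fst1 q)) =
     spl3 (fun a b c => sing m (fun x => f (twl a ++ g (tw1 b) :: tw1 c ++ x.2 :: fst1 q))) p
   + spl (fun a b => spl (fun c d => sing m (fun x =>
        f (twl a ++ g (tw1 b ++ x.2 :: fst1 c) :: fst1 d))) q) p
   + spl3 (fun b c d => sing m (fun x =>
        f (twl p ++ tw l x.2 :: map (tw l) (fst1 b) ++ g (fst1 c) :: fst1 d))) q.
    rewrite -sing_spl3 -sing_spl3.
    under eq_spl do rewrite -sing_spl.
    rewrite -sing_spl; case: m => [|x [|x' m]] //=; rewrite ?addr0//.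
    rewrite gcircE spl3_cat_cons; congr (_ + _ + _).
    - rewrite /tw1 spl3_map; apply: eq_spl3 => a b c.
      by congr (f (_ ++ _)); exact: mapE.
    - rewrite /tw1 spl_map; apply: eq_spl => a b.
      rewrite /fst1 spl_map; apply: eq_spl => c d.
      by congr (f (_ ++ _)); exact: mapE.
    - rewrite /fst1 spl3_map; apply: eq_spl3 => a b c.
      rewrite map_cat/= -catA/=.
      by congr (f (_ ++ _)); exact: mapE.
  under eq_spl3 do rewrite E.
  rewrite !spl3D; congr (_ + _ + _).
  - by rewrite spl5_left.
  - by rewrite spl5_around.
rewrite -spl3_scale.
transitivity (right_ + inside + left_); first by rewrite addrC addrA addrAC.
have E p q s : sgn l *: mark (fun a x b => f ([seq tw 1 y.1 | y <- a] ++ x.2 :: fst1 b))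
       (map (ptwist l) p ++ (g (fst1 q), sgn l *: dext g q) :: s) =
    spl3 (fun a m b => sing m (fun x : V * V =>
      f (twl a ++ tw l x.2 :: map (tw l) (fst1 b) ++ g (fst1 q) :: fst1 s))) p
  + spl3 (fun a m b => sing m (fun x : V * V =>
      f (twl p ++ g (tw1 a ++ x.2 :: fst1 b) :: fst1 s))) q
  + spl3 (fun a m b => sing m (fun x : V * V =>
      f (twl p ++ g (tw1 q) :: tw1 a ++ x.2 :: fst1 b))) s.
  have twlE a : [seq tw 1 y.1 | y <- map (ptwist l) a] = twl a.
    by rewrite -map_comp; apply: eq_map => y /=; rewrite twistC.
  have fstE a : fst1 (map (ptwist l) a) = map (tw l) (fst1 a).
    by rewrite /fst1 -!map_comp.
  rewrite mark_cat_cons !scalerDr; congr (_ + _ + _).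
  - rewrite -mark_spl3 mark_map -markZ; apply: eq_mark => a x b.
    rewrite twlE /fst1 map_cat/= -/(fst1 _) fstE (mlinZ _ _ _ _ fm) scalerA sgn_sqr.
    by rewrite scale1r.
  - rewrite -mark_spl3 twlE (mlinZ _ _ _ _ fm) scalerA sgn_sqr scale1r /dext.
    rewrite !mark_spl3 (spl3_morph (h := fun v => f (_ ++ v :: _))); last exact: linD (fm _ _).
    apply: eq_spl3 => a m b; case: m => [|x [|x' m]] //=; exact: mlin0.
  - rewrite -mark_spl3 -markZ; apply: eq_mark => a x b.
    rewrite map_cat/= twlE -catA/= (twist_sdeg gV_full _ _ gm gd) mul1r.
    by rewrite -/fst1 (mlinZ _ _ _ _ fm) scalerA sgn_sqr scale1r -map_comp.
under [RHS]eq_spl3 do rewrite E.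
rewrite !spl3D; congr (_ + _ + _).
- by rewrite (spl5_left (fun a m b q s => sing m (fun x : V * V =>
      f (twl a ++ tw l x.2 :: map (tw l) (fst1 b) ++ g (fst1 q) :: fst1 s)))).
- by rewrite (spl5_inside (fun p a m b s => sing m (fun x : V * V =>
      f (twl p ++ g (tw1 a ++ x.2 :: fst1 b) :: fst1 s)))).
Qed.

End Marked.

(** * Transport along a path *)

Section MoreCalculus.
Context {R : realType} {V : lmodType R}.
Local Notation I := {i01 R}.
Implicit Types u w : I -> I -> V.

Lemma vtail_vten u : vsm u -> vten int_scal u (vtail u).
Proof.
move=> /vsm_rep[N [h [v [sh eu]]]].
apply: (vten_ext (vten_sum (D := int_scal) (g := fun i => restr (h i))
  (g' := fun i => restr (tail_int (h i))) v _)) => [i|s t|s t].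
- by exists (h i).
- by rewrite eu.
- by rewrite (rep_vtail sh eu).
Qed.

Lemma vten_vtail u w : vten int_scal u w -> forall s t, w s t = vtail u s t.
Proof.
move=> /vten_rep[N [g [g' [v [/choice[h Dg] eu eu']]]]] s t.
have sh i : tsmooth (h i) by have [] := Dg i.
have eu0 s' t' : u s' t' = \sum_i restr (h i) s' t' *: v i.
  by rewrite eu; apply: eq_bigr => i _; have [_ -> _] := Dg i.
rewrite (rep_vtail sh eu0) eu'; apply: eq_bigr => i _.
by have [_ _ ->] := Dg i.
Qed.

Lemma vtail1 u t : vsm u -> vtail u 1%:i01 t = 0.
Proof.
move=> /vsm_rep[N [h [v [sh eu]]]]; rewrite (rep_vtail sh eu) big1// => i _.
by rewrite /restr /tail_int clamp_id ?subrr ?scale0r//= ler01 lexx.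
Qed.

Lemma vsmD u w : vsm u -> vsm w -> vsm (fun s t => u s t + w s t).
Proof. by move=> [u' du] [w' dw]; eexists; exact: vtenD du dw. Qed.

Lemma vsm_cst (v : V) : vsm (fun _ _ => v).
Proof. by exists (fun _ _ => 0); exact: (vten_cst dt_cst). Qed.

Lemma vtailD u w s t : vsm u -> vsm w ->
  vtail (fun s t => u s t + w s t) s t = vtail u s t + vtail w s t.
Proof.
by move=> su sw; rewrite -(vten_vtail (vtenD (vtail_vten su) (vtail_vten sw))).
Qed.

Lemma vderivD u w s t : vsm u -> vsm w ->
  vderiv (fun t => u s t + w s t) t = vderiv (u s) t + vderiv (w s) t.
Proof.
by move=> su sw; rewrite -(is_dt_vderiv (vtenD (is_dt_deriv su) (is_dt_deriv sw))).
Qed.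

Lemma vsm_eq u w : (forall s t, u s t = w s t) -> vsm u -> vsm w.
Proof. by move=> E [u' du]; exists u'; apply: (vten_ext du). Qed.

End MoreCalculus.

Section LinearCalculus.
Context {R : realType} {V W : lmodType R}.
Local Notation I := {i01 R}.
Implicit Types (u : I -> I -> V) (h : V -> W).

Lemma vsm_lin h u : linear h -> vsm u -> vsm (fun s t => h (u s t)).
Proof. by move=> hl [u' du]; eexists; exact: vten_lin hl du. Qed.

Lemma vtail_lin h u s t : linear h -> vsm u ->
  vtail (fun s t => h (u s t)) s t = h (vtail u s t).
Proof. by move=> hl su; rewrite -(vten_vtail (vten_lin hl (vtail_vten su))). Qed.

Lemma vderiv_lin h u s t : linear h -> vsm u ->
  vderiv (fun t => h (u s t)) t = h (vderiv (u s) t).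
Proof. by move=> hl su; rewrite -(is_dt_vderiv (vten_lin hl (is_dt_deriv su))). Qed.

End LinearCalculus.

Section Families.
Context {R : realType} {V : lmodType R}.
Variable gV : gspace V.
Hypothesis gV_full : gcar gV = setT.
Local Notation I := {i01 R}.
Local Notation tw := (twist gV).
Local Notation gc := (gcirc gV).
Implicit Types (f g : I -> I -> seq V -> V).

Lemma linear_scale c : linear (fun v : V => c *: v).
Proof. by move=> d u v; rewrite scalerDr !scalerA mulrC. Qed.

Lemma linear_opp : linear (fun v : V => - v).
Proof. by move=> d u v; rewrite opprD scalerN. Qed.

Lemma vsmN (u : I -> I -> V) : vsm u -> vsm (fun s t => - u s t).
Proof. exact: vsm_lin linear_opp. Qed.

Definition dtf f : I -> I -> seq V -> V := fun s t x => vderiv (fun t => f s t x) t.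

Lemma dtf_mlin f s t : (forall s t, mlin (f s t)) ->
  (forall x, vsm (fun s t => f s t x)) -> mlin (dtf f s t).
Proof.
move=> fm sf p q c u v; rewrite /dtf.
under eq_fun do rewrite fm.
rewrite (@vderivD _ _ (fun s t => c *: f s t (p ++ u :: q)) (fun s t => f s t (p ++ v :: q)))//.
  by rewrite (@vderiv_lin _ _ _ (fun v : V => c *: v) (fun s t => f s t (p ++ u :: q)))//;
    exact: linear_scale.
by apply: (@vsm_lin _ _ _ (fun v : V => c *: v)) => //; exact: linear_scale.
Qed.

Lemma gc_dt l f g x : (forall s t, mlin (f s t)) ->
  (forall x, vsm (fun s t => f s t x)) -> (forall x, vsm (fun s t => g s t x)) ->
  is_dt (fun s t => gc l (f s t) (g s t) x)
        (fun s t => gc l (dtf f s t) (g s t) x + gc l (f s t) (dtf g s t) x).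
Proof.
move=> fm sf sg; apply: (vten_gc gV dt_mul) => // [s t|y|y].
- exact: dtf_mlin.
- exact: is_dt_deriv (sf y).
- exact: is_dt_deriv (sg y).
Qed.

Lemma gc_vsm l f g x : (forall s t, mlin (f s t)) ->
  (forall x, vsm (fun s t => f s t x)) -> (forall x, vsm (fun s t => g s t x)) ->
  vsm (fun s t => gc l (f s t) (g s t) x).
Proof. by move=> fm sf sg; eexists; exact: gc_dt. Qed.

Lemma vtail_mlin f s t : (forall s t, mlin (f s t)) ->
  (forall x, vsm (fun s t => f s t x)) ->
  mlin (fun x => vtail (fun s t => f s t x) s t).
Proof.
move=> fm sf p q c u v.
have -> : (fun s t => f s t (p ++ (c *: u + v) :: q)) =
    (fun s t => c *: f s t (p ++ u :: q) + f s t (p ++ v :: q)).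
  by apply/funext => s'; apply/funext => t'; exact: fm.
rewrite vtailD//; last first.
  by apply: (@vsm_lin _ _ _ (fun v : V => c *: v)) => //; exact: linear_scale.
by rewrite (@vtail_lin _ _ _ (fun v : V => c *: v))//; exact: linear_scale.
Qed.

Lemma vtail_sdeg f s t k : (forall s t, sdeg gV k (f s t)) ->
  (forall x, vsm (fun s t => f s t x)) ->
  sdeg gV k (fun x => vtail (fun s t => f s t x) s t).
Proof.
move=> fd sf a d ha; split; first exact: gcar_full.
rewrite -vtail_lin//; last exact: gproj_linear.
congr (vtail _ s t); apply/funext => s'; apply/funext => t'.
by have [_] := fd s' t' a d ha.
Qed.

Lemma sdeg_add k (f g : seq V -> V) : sdeg gV k f -> sdeg gV k g ->
  sdeg gV k (fun x => f x + g x).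
Proof. by move=> fd gd a d ha; apply: gdegD; [|exact: fd|exact: gd]. Qed.

Lemma sdeg_opp k (f : seq V -> V) : sdeg gV k f -> sdeg gV k (fun x => - f x).
Proof.
by move=> fd a d ha; rewrite -scaleN1r; apply: gdegZ => //; exact: fd.
Qed.

Lemma unary_mlin : mlin (@unary R V).
Proof.
case=> [|w [|w' p]] [|w'' q] c u v //=; rewrite ?scaler0 ?addr0//.
Qed.

Lemma unary_sdeg : sdeg gV 0 (@unary R V).
Proof.
move=> a d ha; case: a ha => [|v [|w a]] /=; try by move=> _; exact: gdeg0.
case: d => [[]//|e [|e' d]] /homog_cons[ve []// _ _].
by rewrite big_seq1 addr0 subrK.
Qed.

End Families.

Section Transport.
Context {R : realType} {V : lmodType R}.
Variable gV : gspace V.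
Hypothesis gV_full : gcar gV = setT.
Local Notation I := {i01 R}.
Local Notation tw := (twist gV).
Local Notation gc := (gcirc gV).

Lemma eq_gc_shorter l (K K' a : seq V -> V) x : mlin K -> mlin K' ->
  a [::] = 0 -> (forall v, a [:: v] = 0) ->
  (forall y, (size y < size x)%N -> K y = K' y) -> gc l K a x = gc l K' a x.
Proof.
move=> Km Km' a0 a1 E; rewrite !gcircE; apply: eq_spl_in => p r e.
apply: eq_spl_in => q s e'; subst r x.
case: q E => [|v [|w q]] E; rewrite ?a0 ?a1 ?mlin0//.
by apply: E; rewrite ?size_cat/= ?size_cat/= ?size_map; lia.
Qed.

(** Unlike [a], the family [c] may have a nonzero component of arity one, so [K] is also evaluated
    on lists as long as [x], though never on the empty list. *)
Lemma eq_gc_nonlonger l (K K' c : seq V -> V) x : mlin K -> mlin K' ->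
  c [::] = 0 ->
  (forall y, (0 < size y <= size x)%N -> K y = K' y) -> gc l K c x = gc l K' c x.
Proof.
move=> Km Km' c0 E; rewrite !gcircE; apply: eq_spl_in => p r e.
apply: eq_spl_in => q s e'; subst r x.
case: q E => [|w q] E; rewrite ?c0 ?mlin0//.
by apply: E; rewrite ?size_cat/= ?size_cat/= ?size_map; lia.
Qed.

Lemma mlin_zero (N : lmodType R) : mlin (fun _ : seq V => 0 : N).
Proof. by move=> p q c u v; rewrite scaler0 addr0. Qed.

Lemma gc0f l (a : seq V -> V) x : gc l (fun=> 0) a x = 0.
Proof.
by rewrite gcircE -[RHS](spl0 x); apply: eq_spl => p r; exact: spl0.
Qed.

Lemma gc_shorter0 l (K a : seq V -> V) x : mlin K ->
  a [::] = 0 -> (forall v, a [:: v] = 0) ->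
  (forall y, (size y < size x)%N -> K y = 0) -> gc l K a x = 0.
Proof.
move=> Km a0 a1 E; rewrite -[RHS](gc0f l a x).
by apply: eq_gc_shorter => //; exact: mlin_zero.
Qed.

Lemma gc_nonlonger0 l (K c : seq V -> V) x : mlin K -> c [::] = 0 ->
  (forall y, (0 < size y <= size x)%N -> K y = 0) -> gc l K c x = 0.
Proof.
move=> Km c0 E; rewrite -[RHS](gc0f l c x).
by apply: eq_gc_nonlonger => //; exact: mlin_zero.
Qed.

Variables (a c : I -> I -> seq V -> V).
Hypotheses (am : forall s t, mlin (a s t)) (cm : forall s t, mlin (c s t)).
Hypotheses (ad : forall s t, sdeg gV 0 (a s t)).
Hypotheses (cd : forall s t, sdeg gV (-1) (c s t)).
Hypotheses (asm : forall x, vsm (fun s t => a s t x)).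
Hypotheses (csm : forall x, vsm (fun s t => c s t x)).
Hypotheses (a0 : forall s t, a s t [::] = 0) (c0 : forall s t, c s t [::] = 0).
Hypotheses (a1 : forall s t v, a s t [:: v] = 0).

(** The term of order i in the Picard iteration for dF/ds = F \o a with F = Id at s = 1, the sign
    (-1)^i of the tree formula included. *)
Fixpoint Fterm (i : nat) : I -> I -> seq V -> V :=
  if i is i'.+1 then fun s t x =>
    - vtail (fun s t => gc 0 (Fterm i' s t) (a s t) x) s t
  else fun _ _ => unary.

(** The corresponding contribution of trees with i vertices, exactly one of which carries [c]. *)
Fixpoint Tterm (i : nat) : I -> I -> seq V -> V :=
  if i is i'.+1 then fun s t x =>
    - vtail (fun s t => gc 0 (Tterm i' s t) (a s t) x
                      + gc (-1) (Fterm i' s t) (c s t) x) s t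
  else fun _ _ _ => 0.

Lemma Fterm_spec i : [/\ forall s t, mlin (Fterm i s t),
  forall s t, sdeg gV 0 (Fterm i s t) & forall x, vsm (fun s t => Fterm i s t x)].
Proof.
elim: i => [|i [Xm Xd Xs]] /=.
  split=> *; [exact: unary_mlin|exact: unary_sdeg|exact: vsm_cst].
have gs x : vsm (fun s t => gc 0 (Fterm i s t) (a s t) x) by exact: gc_vsm.
have gm s t : mlin (fun x => gc 0 (Fterm i s t) (a s t) x) by exact: gc_mlin.
split=> [s t|s t|x].
- exact: (mlin_opp (vtail_mlin (f := fun s t => gc 0 (Fterm i s t) (a s t)) s t gm gs)).
- apply: sdeg_opp => //; apply: (vtail_sdeg gV_full (f := fun s t => gc 0 (Fterm i s t) (a s t))) => //.
  by move=> {}s {}t; have := gc_sdeg gV_full 0 (Xd s t) (ad s t); rewrite addr0.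
- exact/vsmN/vtail_vsm.
Qed.

Lemma Tterm_spec i : [/\ forall s t, mlin (Tterm i s t),
  forall s t, sdeg gV (-1) (Tterm i s t) & forall x, vsm (fun s t => Tterm i s t x)].
Proof.
elim: i => [|i [Ym Yd Ys]] /=.
  split=> *; [exact: mlin_zero|by move=> ? ? ?; exact: gdeg0|exact: vsm_cst].
have [Xm Xd Xs] := Fterm_spec i.
have gs x : vsm (fun s t => gc 0 (Tterm i s t) (a s t) x
                   + gc (-1) (Fterm i s t) (c s t) x).
  by apply: vsmD; exact: gc_vsm.
have gm s t : mlin (fun x => gc 0 (Tterm i s t) (a s t) x
                   + gc (-1) (Fterm i s t) (c s t) x).
  by apply: mlin_add; exact: gc_mlin.
split=> [s t|s t|x].
- exact: (mlin_opp (vtail_mlin (f := fun s t x => gc 0 (Tterm i s t) (a s t) x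
                   + gc (-1) (Fterm i s t) (c s t) x) s t gm gs)).
- apply: sdeg_opp => //; apply: (vtail_sdeg gV_full (f := fun s t x => gc 0 (Tterm i s t) (a s t) x
                   + gc (-1) (Fterm i s t) (c s t) x)) => //.
  move=> {}s {}t; apply: sdeg_add => //.
    by have := gc_sdeg gV_full 0 (Yd s t) (ad s t); rewrite addr0.
  by have := gc_sdeg gV_full (-1) (Xd s t) (cd s t); rewrite add0r.
- exact/vsmN/vtail_vsm.
Qed.

Lemma vtail0 s t : vtail (fun _ _ => 0 : V) s t = 0.
Proof.
exact/esym/(vten_vtail (vten0 int_scal)).
Qed.

Lemma eq_vtail (u w : I -> I -> V) s t : (forall s t, u s t = w s t) ->
  vtail u s t = vtail w s t.
Proof.
by move=> E; congr (vtail _ s t); apply/funext => s'; apply/funext => t'.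
Qed.

(** Each vertex lowers the number of entries by at least one and a single entry must remain, so i
    vertices need i + 1 inputs. *)
Lemma Fterm_vanish i s t x : (0 < i)%N -> (size x <= i)%N -> Fterm i s t x = 0.
Proof.
elim: i s t x => //= i IH s t x _ xi.
rewrite (eq_vtail (w := fun _ _ => 0)) ?vtail0 ?oppr0// => s' t'.
have [Xm _ _] := Fterm_spec i.
rewrite gc_shorter0// => y yx; case: i IH Xm xi => [|i] IH Xm xi.
  by case: y yx => // v y; move: xi; case: x => [|w [|]].
by apply: IH => //; lia.
Qed.

(** The vertex carrying [c] may be unary, so i vertices need only i inputs. This is why the sum for
    the form-valued maps has one term more than that for the morphism. *)
Lemma Tterm_vanish i s t x : (size x < i)%N -> Tterm i s t x = 0.
Proof.
elim: i s t x => //= i IH s t x xi.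
rewrite (eq_vtail (w := fun _ _ => 0)) ?vtail0 ?oppr0// => s' t'.
have [Xm _ _] := Fterm_spec i; have [Ym _ _] := Tterm_spec i.
rewrite gc_shorter0//; last by move=> y yx; apply: IH; lia.
rewrite add0r gc_nonlonger0// => y yx.
by apply: Fterm_vanish; lia.
Qed.

(* The components of the transport from s to 1 along the a-connection, and of
   the dt-part of the transport for a + dt c. *)
Definition transp s t x := \sum_(0 <= i < (size x).+1) Fterm i s t x.
Definition dtransp s t x := \sum_(0 <= i < (size x).+1) Tterm i s t x.

Lemma transpE N s t x : (size x < N)%N ->
  transp s t x = \sum_(0 <= i < N) Fterm i s t x.
Proof.
move=> xN; rewrite /transp [RHS](big_cat_nat _ (n := (size x).+1))//=.
have Z : \sum_((size x).+1 <= i < N) Fterm i s t x = 0.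
  rewrite big_nat_cond big1// => i /andP[/andP[xi _] _].
  by apply: Fterm_vanish => //; lia.
by rewrite Z addr0.
Qed.

Lemma dtranspE N s t x : (size x < N)%N ->
  dtransp s t x = \sum_(0 <= i < N) Tterm i s t x.
Proof.
move=> xN; rewrite /dtransp [RHS](big_cat_nat _ (n := (size x).+1))//=.
have Z : \sum_((size x).+1 <= i < N) Tterm i s t x = 0.
  rewrite big_nat_cond big1// => i /andP[/andP[xi _] _].
  exact: Tterm_vanish.
by rewrite Z addr0.
Qed.

Section SizedSum.
Variables (U : nat -> I -> I -> seq V -> V) (k : int).
Hypothesis US : forall i, [/\ forall s t, mlin (U i s t),
  forall s t, sdeg gV k (U i s t) & forall x, vsm (fun s t => U i s t x)].

Lemma psum_spec (r : seq nat) : [/\ forall s t, mlin (fun x => \sum_(i <- r) U i s t x),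
  forall s t, sdeg gV k (fun x => \sum_(i <- r) U i s t x) &
  forall x, vsm (fun s t => \sum_(i <- r) U i s t x)].
Proof.
split=> [s t p q d u v|s t x d hx|x].
- by rewrite scaler_sumr -big_split/=; apply: eq_bigr => i _; have [Um _ _] := US i;
   exact: Um.
- elim: r => [|i r IH]; first by rewrite big_nil; exact: gdeg0.
  by rewrite big_cons; apply: gdegD => //; have [_ Ud _] := US i; exact: Ud.
- elim: r => [|i r IH].
    by apply: vsm_eq (vsm_cst (0 : V)) => s t; rewrite big_nil.
  have [_ _ Us] := US i.
  by apply: vsm_eq (vsmD (Us x) IH) => s t; rewrite big_cons.
Qed.

Lemma sized_spec : [/\ forall s t, mlin (fun x => \sum_(0 <= i < (size x).+1) U i s t x),
  forall s t, sdeg gV k (fun x => \sum_(0 <= i < (size x).+1) U i s t x) &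
  forall x, vsm (fun s t => \sum_(0 <= i < (size x).+1) U i s t x)].
Proof.
split=> [s t p q d u v|s t x d hx|x].
- rewrite !size_cat/=.
  by have [Um _ _] := psum_spec (index_iota 0 (size p + (size q).+1).+1); exact: Um.
- by have [_ Ud _] := psum_spec (index_iota 0 (size x).+1); exact: Ud hx.
- by have [_ _ Us] := psum_spec (index_iota 0 (size x).+1); exact: Us.
Qed.

End SizedSum.

Lemma transp_spec : [/\ forall s t, mlin (transp s t),
  forall s t, sdeg gV 0 (transp s t) & forall x, vsm (fun s t => transp s t x)].
Proof. exact: (sized_spec Fterm_spec). Qed.

Lemma dtransp_spec : [/\ forall s t, mlin (dtransp s t),
  forall s t, sdeg gV (-1) (dtransp s t) & forall x, vsm (fun s t => dtransp s t x)].
Proof. exact: (sized_spec Tterm_spec). Qed.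

Lemma vtail_sum (T : Type) (r : seq T) (u : T -> I -> I -> V) s t :
  (forall i, vsm (u i)) ->
  vtail (fun s t => \sum_(i <- r) u i s t) s t = \sum_(i <- r) vtail (u i) s t.
Proof.
move=> us; elim: r => [|i r IH].
  by rewrite big_nil -[RHS](vtail0 s t); apply: eq_vtail => ? ?; rewrite big_nil.
rewrite big_cons -IH -vtailD//.
  by apply: eq_vtail => ? ?; rewrite big_cons.
elim: r {IH} => [|j r IH].
  by apply: vsm_eq (vsm_cst (0 : V)) => ? ?; rewrite big_nil.
by apply: vsm_eq (vsmD (us j) IH) => ? ?; rewrite big_cons.
Qed.

Lemma gc_suml l (T : Type) (r : seq T) (f : T -> seq V -> V) g x :
  gc l (fun y => \sum_(i <- r) f i y) g x = \sum_(i <- r) gc l (f i) g x.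
Proof.
elim: r => [|i r IH]; first by rewrite big_nil -[RHS](gc0f l g x); apply: eq_gc => // y; rewrite big_nil.
by rewrite big_cons -IH -gcDl; apply: eq_gc => // y; rewrite big_cons.
Qed.

(** Summing the recursion gives the integral equation. The sums are cut off according to the length
    of the list, and on the shorter lists reached by [\o a] the cut-offs agree by vanishing of the
    higher terms. *)
Lemma transp_fix s t x :
  transp s t x = unary x - vtail (fun s t => gc 0 (transp s t) (a s t) x) s t.
Proof.
have [Gm _ _] := transp_spec.
rewrite {1}/transp big_nat_recl//=; congr (_ + _).
rewrite sumrN -vtail_sum; last first.
  by move=> i; have [Xm _ Xs] := Fterm_spec i; exact: gc_vsm.
congr (- _); apply: eq_vtail => {}s {}t; rewrite -gc_suml.
apply: eq_gc_shorter => // [|y yx].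
  by have [] := psum_spec Fterm_spec (index_iota 0 (size x)).
by rewrite -transpE.
Qed.

Lemma dtransp_fix s t x :
  dtransp s t x = - vtail (fun s t => gc 0 (dtransp s t) (a s t) x
                                    + gc (-1) (transp s t) (c s t) x) s t.
Proof.
have [Gm _ _] := transp_spec; have [Hm _ _] := dtransp_spec.
(* One vanishing term is added: after removal of order zero the index still runs up to [size x], as
   required for F on the lists of full length reached by [\o c]. *)
rewrite (@dtranspE (size x).+2)// big_nat_recl//= add0r.
rewrite sumrN -vtail_sum; last first.
  move=> i; have [Xm _ Xs] := Fterm_spec i; have [Ym _ Ys] := Tterm_spec i.
  by apply: vsmD; exact: gc_vsm.
congr (- _); apply: eq_vtail => {}s {}t; rewrite big_split/= -!gc_suml.
have [Gm' _ _] := psum_spec Fterm_spec (index_iota 0 (size x).+1).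
have [Hm' _ _] := psum_spec Tterm_spec (index_iota 0 (size x).+1).
congr (_ + _).
  by apply: eq_gc_shorter => // y yx; rewrite -dtranspE//; lia.
by apply: eq_gc_nonlonger => // y yx; rewrite -transpE//; lia.
Qed.

Lemma transp_ds x : is_ds (fun s t => transp s t x)
  (fun s t => gc 0 (transp s t) (a s t) x).
Proof.
have [Gm _ Gs] := transp_spec.
have gs : vsm (fun s t => gc 0 (transp s t) (a s t) x) by exact: gc_vsm.
apply: (vten_ext (vtenD (vten_cst ds_cst (unary x)) (vten_lin linear_opp (vtail_ds gs)))) => s t.
  by rewrite [RHS]transp_fix.
by rewrite add0r opprK.
Qed.

Lemma dtransp_ds x : is_ds (fun s t => dtransp s t x)
  (fun s t => gc 0 (dtransp s t) (a s t) x + gc (-1) (transp s t) (c s t) x).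
Proof.
have [Gm _ Gs] := transp_spec; have [Hm _ Hs] := dtransp_spec.
have gs : vsm (fun s t => gc 0 (dtransp s t) (a s t) x + gc (-1) (transp s t) (c s t) x).
  by apply: vsmD; exact: gc_vsm.
apply: (vten_ext (vten_lin linear_opp (vtail_ds gs))) => s t.
  by rewrite [RHS]dtransp_fix.
by rewrite opprK.
Qed.

Lemma transp1 t x : transp 1%:i01 t x = unary x.
Proof.
have [Gm _ Gs] := transp_spec.
by rewrite transp_fix vtail1 ?subr0//; exact: gc_vsm.
Qed.

Lemma dtransp1 t x : dtransp 1%:i01 t x = 0.
Proof.
have [Gm _ Gs] := transp_spec; have [Hm _ Hs] := dtransp_spec.
by rewrite dtransp_fix vtail1 ?oppr0//; apply: vsmD; exact: gc_vsm.
Qed.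

(** The integral equation is differentiated in t under the integral sign and then in s, so no
    exchange of mixed partial derivatives is needed. *)
Lemma dtf_transp_ds x : is_ds (fun s t => dtf transp s t x)
  (fun s t => gc 0 (dtf transp s t) (a s t) x + gc 0 (transp s t) (dtf a s t) x).
Proof.
have [Gm _ Gs] := transp_spec.
have D := gc_dt gV 0 x Gm Gs asm.
have D' := vtenD (vten_cst dt_cst (unary x)) (vten_lin linear_opp (vtail_dt D)).
apply: (vten_ext (vten_lin linear_opp (vtail_ds (is_dt_vsm' D)))) => s t.
  rewrite -[LHS]add0r (is_dt_vderiv D'); congr (vderiv _ t).
  by apply/funext => t'; rewrite [RHS]transp_fix.
by rewrite opprK.
Qed.

End Transport.

(** * The morphism and homotopy equations *)

(** Identities in abelian groups: all terms are moved to one side, then each named atom is cancelled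
    against its opposite. *)
Ltac zmod_start := apply/eqP; rewrite -subr_eq0; apply/eqP;
  rewrite !opprD ?opprK -[LHS]add0r !addrA.
Ltac zmod_cancel x := repeat rewrite [in LHS](addrAC _ x);
  repeat rewrite [in LHS](addrAC _ (- x)); rewrite addrK.

Section Morphism.
Context {R : realType} {V : lmodType R}.
Variable gV : gspace V.
Hypothesis gV_full : gcar gV = setT.
Local Notation I := {i01 R}.
Local Notation tw := (twist gV).
Local Notation gc := (gcirc gV).

(* The terms of the s-derivative of the homotopy equation; the hypotheses are
   the pre-Lie identities for (H; a, m), (F; a, b) and (F; c, m). *)
Lemma homotopy_algebra (Z : zmodType) (x1 x2 x3 x4 x5 x6 x7 x8 x9 y1 y2 y3 y4 y5 y6 : Z) :
  x1 - x2 = x3 - x4 -> x5 - x6 = x7 - x8 -> y1 - y2 = - (y3 - y4) ->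
  (y5 + x9) - (y6 + y3) - ((x1 + y1) + (x4 - x2))
    - (x5 + (x9 - y4 - y2 - (x6 - x8))) = y5 - y6 - x3 - x7.
Proof.
move=> /eqP; rewrite subr_eq => /eqP ->.
move=> /eqP; rewrite subr_eq => /eqP ->.
move=> /eqP; rewrite subr_eq => /eqP ->.
zmod_start.
zmod_cancel x2. zmod_cancel x3. zmod_cancel x4. zmod_cancel x6. zmod_cancel x7.
zmod_cancel x8. zmod_cancel x9. zmod_cancel y2. zmod_cancel y3. zmod_cancel y4.
by zmod_cancel y5; zmod_cancel y6.
Qed.

(** The analogue for the morphism equation, the hypothesis being the pre-Lie identity for (F; a,
    m). *)
Lemma morphism_algebra (Z : zmodType) (x1 x2 x3 x4 y : Z) :
  x1 - x2 = x3 - x4 -> y - (x1 + (x4 - x2)) = y - x3.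
Proof.
move=> /eqP; rewrite subr_eq => /eqP ->; zmod_start.
by zmod_cancel x2; zmod_cancel x3; zmod_cancel x4; zmod_cancel y.
Qed.

Lemma spl_last (T : Type) (F : seq T -> seq T -> V) x :
  (forall v p q, F p (v :: q) = 0) -> spl F x = F x [::].
Proof.
elim: x F => //= v x IH F F0.
by rewrite F0 add0r (IH (fun p q => F (v :: p) q)).
Qed.

Lemma gc_unary l f x : gc l unary f x = f x.
Proof.
rewrite gcircE /spl3 spl_head => [|v p q]; last first.
  by rewrite -[RHS](spl0 q); apply: eq_spl => q1 q2; case: p.
by rewrite spl_last.
Qed.

Lemma blocks_mlin (gs : seq (seq V -> V)) K :
  (forall i, (i < size gs)%N -> mlin (nth (fun=> 0) gs i)) -> mlin K ->
  mlin (blocks gs K).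
Proof.
elim: gs K => [|g gs IH] K gm Km p q /=.
  by case: p => [|w p] c u v /=; rewrite scaler0 addr0.
have g0 : mlin g := gm 0%N isT.
have {}IH y : mlin (blocks gs (fun x => K (y :: x))).
  by apply: IH; [move=> i; exact: (gm i.+1)|exact: mlin_cons].
have E v := spl_cat_cons (fun p q => blocks gs (fun y => K (g p :: y)) q) p v q.
move=> c u v; rewrite !E {E}; move: c u v; apply: linear_add.
  by apply: spl_linear => a b; exact: IH.
apply: spl_linear => a b c u v; rewrite g0.
exact: (@blocks_linear _ V V gs (fun v y => K (v :: y)) b (mlin_head Km)).
Qed.

Lemma blocks_zero_slot l1 h l2 (K : seq V -> V) x : mlin K ->
  (forall y, h y = 0) -> blocks (l1 ++ h :: l2) K x = 0.
Proof.
move=> Km h0; elim: l1 K Km x => [|g l1 IH] K Km x /=; rewrite -[RHS](spl0 x);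
  apply: eq_spl => p q; last by apply: IH; exact: mlin_cons.
rewrite -[RHS](blocks0 l2 q); apply: eq_blocks => y; rewrite h0.
exact: (mlin0 [::] y Km).
Qed.

Lemma tw0E : tw 0 = id. Proof. by apply/funext => v; exact: twist0. Qed.

Variables (m a b c : I -> I -> seq V -> V).
Hypotheses (mm : forall s t, mlin (m s t)) (am : forall s t, mlin (a s t)).
Hypotheses (bm : forall s t, mlin (b s t)) (cm : forall s t, mlin (c s t)).
Hypotheses (md : forall s t, sdeg gV 1 (m s t)) (ad : forall s t, sdeg gV 0 (a s t)).
Hypotheses (bd : forall s t, sdeg gV 0 (b s t)) (cd : forall s t, sdeg gV (-1) (c s t)).
Hypotheses (asm : forall x, vsm (fun s t => a s t x)).
Hypotheses (csm : forall x, vsm (fun s t => c s t x)).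
Hypotheses (a0 : forall s t, a s t [::] = 0) (c0 : forall s t, c s t [::] = 0).
Hypotheses (a1 : forall s t v, a s t [:: v] = 0).
Hypothesis m_ds : forall x, is_ds (fun s t => m s t x)
  (fun s t => gc 0 (m s t) (a s t) x - gc 1 (a s t) (m s t) x).
Hypothesis b_ds : forall x, is_ds (fun s t => b s t x)
  (fun s t => dtf a s t x - gc (-1) (m s t) (c s t) x - gc 1 (c s t) (m s t) x
            - (gc 0 (a s t) (b s t) x - gc 0 (b s t) (a s t) x)).
Variable muB : seq V -> V.
Hypothesis m1 : forall t x, m 1%:i01 t x = muB x.
Hypothesis b1 : forall t x, b 1%:i01 t x = 0.

Local Notation G := (transp gV a).
Local Notation H := (dtransp gV a c).

Let Gspec := transp_spec gV_full am ad asm.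
Let Hspec := dtransp_spec gV_full am cm ad cd asm csm.
Let Gm : forall s t, mlin (G s t). Proof. by have [] := Gspec. Qed.
Let Hm : forall s t, mlin (H s t). Proof. by have [] := Hspec. Qed.
Let Gd : forall s t, sdeg gV 0 (G s t). Proof. by have [] := Gspec. Qed.
Let Hd : forall s t, sdeg gV (-1) (H s t). Proof. by have [] := Hspec. Qed.
Let Gs : forall x, vsm (fun s t => G s t x). Proof. by have [] := Gspec. Qed.
Let Hs : forall x, vsm (fun s t => H s t x). Proof. by have [] := Hspec. Qed.
Let muBm : mlin muB.
Proof. have -> : muB = m 1%:i01 0%:i01; [exact/esym/funext|exact: mm]. Qed.

(* A solution of du/ds = u \o a vanishing at s = 1 is zero, by induction on
   the number of arguments: a^1 = 0, so u \o a only involves fewer arguments. *)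
Lemma connection_unique N (u : I -> I -> seq V -> V) :
  (forall s t, mlin (u s t)) ->
  (forall x, (size x < N)%N ->
    is_ds (fun s t => u s t x) (fun s t => gc 0 (u s t) (a s t) x)) ->
  (forall t x, (size x < N)%N -> u 1%:i01 t x = 0) ->
  forall s t x, (size x < N)%N -> u s t x = 0.
Proof.
move=> um du u1 s t x.
have [n] := ubnP (size x); elim: n s t x => // n IH s t x xn xN.
rewrite (is_ds0_cst (du x xN)) ?u1// => {}s {}t.
by apply: gc_shorter0 => // y yx; apply: IH; lia.
Qed.

Lemma const_ds x : is_ds (fun _ _ => muB x) (fun _ _ => 0).
Proof. exact: (vten_cst ds_cst). Qed.

Lemma blocks_ds gs gs' x : der_family ds_scal gs gs' ->
  is_ds (fun s t => blocks [seq g s t | g <- gs] muB x)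
        (fun s t => tblocks id [seq g s t | g <- gs] [seq g s t | g <- gs'] muB x).
Proof.
move=> D; apply: (vten_ext (vten_blocks ds_mul (K := fun _ _ => muB)
  (K' := fun _ _ _ => 0) x D _ _ const_ds)) => // s t.
  exact: mlin_zero.
by rewrite blocks0 addr0.
Qed.

Lemma nseq_blocks_ds r x : is_ds (fun s t => blocks (nseq r (G s t)) muB x)
  (fun s t => gc 0 (blocks (nseq r (G s t)) muB) (a s t) x).
Proof.
have D : der_family ds_scal (nseq r G) (nseq r (fun s t => gc 0 (G s t) (a s t))).
  split=> [|i y]; rewrite !size_nseq// => ir; rewrite !nth_nseq ir.
  exact: transp_ds.
apply: (vten_ext (blocks_ds x D)) => s t; first by rewrite map_nseq.
rewrite gc_blocks//; last first.
  by move=> i p _; rewrite twist0// tw0E map_id.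
by rewrite tw0E !map_nseq.
Qed.

Lemma mlin_sum (T : Type) (r : seq T) (f : T -> seq V -> V) :
  (forall i, mlin (f i)) -> mlin (fun x => \sum_(i <- r) f i x).
Proof.
move=> fm p q d u v; rewrite scaler_sumr -big_split/=.
by apply: eq_bigr => i _; exact: fm.
Qed.

Lemma vten_big (D : (I -> I -> R) -> (I -> I -> R) -> Prop) (T : Type) (r : seq T)
    (u u' : T -> I -> I -> V) : (forall i, vten D (u i) (u' i)) ->
  vten D (fun s t => \sum_(i <- r) u i s t) (fun s t => \sum_(i <- r) u' i s t).
Proof.
move=> du; elim: r => [|i r IH].
  by apply: (vten_ext (vten0 D)) => s t; rewrite big_nil.
by apply: (vten_ext (vtenD (du i) IH)) => s t; rewrite big_cons.
Qed.

Lemma vten_opp (D : (I -> I -> R) -> (I -> I -> R) -> Prop) (u u' : I -> I -> V) :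
  vten D u u' -> vten D (fun s t => - u s t) (fun s t => - u' s t).
Proof. exact: vten_lin linear_opp. Qed.

Lemma nseq_blocks_mlin r s t : mlin (blocks (nseq r (G s t)) muB).
Proof.
apply: blocks_mlin => // i; rewrite size_nseq nth_nseq => ->; exact: Gm.
Qed.

Lemma gc_m_ds f f' x : (forall s t, mlin (f s t)) -> (forall s t, mlin (f' s t)) ->
  (forall x, is_ds (fun s t => f s t x) (fun s t => f' s t x)) ->
  is_ds (fun s t => gc 1 (f s t) (m s t) x)
    (fun s t => gc 1 (f' s t) (m s t) x + (gc 1 (f s t) (gc 0 (m s t) (a s t)) x
                                       - gc 1 (f s t) (gc 1 (a s t) (m s t)) x)).
Proof.
move=> fm fm' df; apply: (vten_ext (vten_gc gV ds_mul 1 fm fm' df m_ds x)) => // s t.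
by rewrite gcDr// gcNr.
Qed.

(** Bounding the number of blocks by an [N] that does not depend on the list allows [\o a] to be
    taken termwise in the sum. *)
Lemma transp_morphism N s t x : (size x < N)%N ->
  \sum_(0 <= r < N) blocks (nseq r (G s t)) muB x = gc 1 (G s t) (m s t) x.
Proof.
move=> xN; apply/eqP; rewrite -subr_eq0; apply/eqP; move: s t x xN.
apply: (connection_unique (u := fun s t x =>
  \sum_(0 <= r < N) blocks (nseq r (G s t)) muB x - gc 1 (G s t) (m s t) x)).
- move=> s t; apply: mlin_add; last by apply: mlin_opp; exact: gc_mlin.
  by apply: mlin_sum => r; exact: nseq_blocks_mlin.
- move=> x _.
  have d1 := vten_big (index_iota 0 N) (fun r => nseq_blocks_ds r x).
  have d2 := gc_m_ds x Gm (fun s t => gc_mlin gV_full 0 (Gm s t) (am s t))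
    (transp_ds gV_full am ad asm a0 a1).
  apply: (vten_ext (vtenD d1 (vten_opp d2))) => // s t.
  rewrite gcDl gcNl gc_suml; apply: morphism_algebra.
  have := gc_prelie gV_full x (Gm s t) (am s t) (mm s t) (ad s t) (md s t).
  by rewrite mul0r expr0z scale1r add0r.
(* At s = 1 the transport is the identity morphism; only r = [size x] contributes on the left, and
   both sides are [muB x]. *)
- move=> t x xN; rewrite (eq_gc _ _ _ (fun y => transp1 gV_full am ad asm a0 a1 t y) (m1 t)).
  rewrite gc_unary (_ : G 1%:i01 t = unary); last by apply/funext => y; exact: transp1.
  under eq_bigr do rewrite blocks_unary//.
  rewrite (bigD1_seq (size x)) ?mem_index_iota ?iota_uniq//= eqxx big1 ?addr0 ?subrr//.
  by move=> r; rewrite eq_sym => /negPf ->.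
Qed.

(** The twist of the blocks in front of H is the sign that [dext] produces when dt is pulled out of
    the block carrying [dt H]. *)
Definition dmorph N s t x := \sum_(0 <= r < N) \sum_(0 <= j < r)
  blocks (nseq j (tw 1 \o G s t) ++ H s t :: nseq (r - j.+1) (G s t)) muB x.

Lemma twG s t y : tw 1 (G s t y) = G s t (map (tw 1) y).
Proof. by rewrite (twist_sdeg gV_full _ _ (Gm s t) (Gd s t)) mulr0 expr0z scale1r. Qed.

Lemma dmorph_mlin N s t : mlin (dmorph N s t).
Proof.
apply: mlin_sum => r; apply: mlin_sum => j; apply: blocks_mlin => // i _.
rewrite nth_cat size_nseq nth_nseq; case: ltnP => ij.
  by apply: mlin_comp => //; exact: twist_linear.
case: (i - j)%N => [|k] /=; first exact: Hm.
by rewrite nth_nseq; case: ifP => _; [exact: Gm|exact: mlin_zero].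
Qed.

(** In dH/ds = H \o a + F \o c the first summand joins the derivatives of the blocks F to give
    [dmorph \o a]. The second yields all ways to insert [c] into one block of m_1(F, .., F),
    twisting the earlier blocks. *)
Lemma dmorph_ds N x : (size x < N)%N -> is_ds (fun s t => dmorph N s t x)
  (fun s t => gc 0 (dmorph N s t) (a s t) x
            + gc (-1) (gc 1 (G s t) (m s t)) (c s t) x).
Proof.
move=> xN.
pose gs r j : seq (I -> I -> seq V -> V) :=
  nseq j (fun s t => tw 1 \o G s t) ++ H :: nseq (r - j.+1) G.
pose Ga s t y := gc 0 (G s t) (a s t) y.
pose gs' r j : seq (I -> I -> seq V -> V) :=
  nseq j (fun s t => tw 1 \o Ga s t) ++
  (fun s t y => gc 0 (H s t) (a s t) y + gc (-1) (G s t) (c s t) y) ::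
  nseq (r - j.+1) Ga.
have dG y := transp_ds gV_full am ad asm a0 a1 y.
have dH y := dtransp_ds gV_full am cm ad cd asm csm a0 c0 a1 y.
have D r j : der_family ds_scal (gs r j) (gs' r j).
  split=> [|i y _]; first by rewrite !size_cat/= !size_nseq.
  rewrite !nth_cat !size_nseq !nth_nseq; case: ltnP => ij.
    exact: (vten_lin (twist_linear gV_full 1) (dG y)).
  case: (i - j)%N => [|k] /=; first exact: dH.
  rewrite !nth_nseq; case: ifP => _; first exact: dG.
  exact: vten0.
have dQ := vten_big (index_iota 0 N) (fun r => vten_big (index_iota 0 r)
  (fun j => blocks_ds x (D r j))).
apply: (vten_ext dQ) => s t.
  apply: eq_bigr => r _; apply: eq_bigr => j _.
  by rewrite /gs map_cat/= !map_nseq.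
(* The morphism equation applies under [\o c], since only lists of length at most [size x < N] occur
   there. *)
have -> : gc (-1) (gc 1 (G s t) (m s t)) (c s t) x =
    \sum_(0 <= r < N) gc (-1) (blocks (nseq r (G s t)) muB) (c s t) x.
  rewrite -gc_suml; apply: eq_gc_nonlonger => //.
  - exact: gc_mlin.
  - by apply: mlin_sum => r; exact: nseq_blocks_mlin.
  - by move=> y yx; rewrite transp_morphism//; lia.
rewrite gc_suml -big_split/=; apply: eq_bigr => r _.
have -> : gc (-1) (blocks (nseq r (G s t)) muB) (c s t) x =
    \sum_(0 <= j < r) blocks (nseq j (tw 1 \o G s t) ++
       gc (-1) (G s t) (c s t) :: nseq (r - j.+1) (G s t)) muB x.
  rewrite gc_blocks//; last first.
    by move=> i p; rewrite size_nseq nth_nseq => ->; rewrite !twistN// twG;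
       congr (G s t _); apply: eq_map => v; rewrite twistN.
  rewrite map_nseq tblocks_nseq; apply: eq_bigr => j _; congr blocks.
  congr (nseq _ _ ++ _); apply/funext => y /=; exact: twistN.
rewrite gc_suml -big_split/=; apply: eq_bigr => j _.
rewrite /gs /gs' !map_cat/= !map_nseq tblocks_slot ?size_nseq//; congr (_ + _).
rewrite gc_blocks//; last first.
  by move=> i p _; rewrite twist0// tw0E map_id.
rewrite tw0E map_cat/= !map_nseq; congr tblocks.
congr (nseq _ _ ++ _); apply/funext => y /=.
by rewrite /Ga !gc0E//; apply: spl3_morph; exact/linD/twist_linear.
Qed.

Lemma dtransp_homotopy N s t x : (size x < N)%N ->
  dtf G s t x - dmorph N s t x = gc 1 (H s t) (m s t) x + gc 0 (G s t) (b s t) x.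
Proof.
move=> xN; apply/eqP; rewrite -subr_eq0 opprD addrA; apply/eqP; move: s t x xN.
apply: (connection_unique (u := fun s t x =>
  dtf G s t x - dmorph N s t x - gc 1 (H s t) (m s t) x - gc 0 (G s t) (b s t) x)).
- move=> s t; apply: mlin_add; last by apply: mlin_opp; exact: gc_mlin.
  apply: mlin_add; last by apply: mlin_opp; exact: gc_mlin.
  by apply: mlin_add; [exact: dtf_mlin|apply: mlin_opp; exact: dmorph_mlin].
- move=> x xN.
  have dG := transp_ds gV_full am ad asm a0 a1.
  have dH := dtransp_ds gV_full am cm ad cd asm csm a0 c0 a1.
  have d1 := dtf_transp_ds gV_full am ad asm a0 a1 x.
  have d2 := dmorph_ds xN.
  have d3 := gc_m_ds x Hm (fun s t => mlin_add (gc_mlin gV_full 0 (Hm s t) (am s t))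
    (gc_mlin gV_full (-1) (Gm s t) (cm s t))) dH.
  have d4 := vten_gc gV ds_mul 0 Gm (fun s t => gc_mlin gV_full 0 (Gm s t) (am s t))
    dG b_ds x.
  apply: (vten_ext (vtenD (vtenD (vtenD d1 (vten_opp d2)) (vten_opp d3)) (vten_opp d4)))
    => // s t.
  rewrite !gcDl !gcNl.
  have E : gc 0 (G s t) (fun x => dtf a s t x - gc (-1) (m s t) (c s t) x
     - gc 1 (c s t) (m s t) x
     - (gc 0 (a s t) (b s t) x - gc 0 (b s t) (a s t) x)) x =
     gc 0 (G s t) (dtf a s t) x - gc 0 (G s t) (gc (-1) (m s t) (c s t)) x
     - gc 0 (G s t) (gc 1 (c s t) (m s t)) x
     - (gc 0 (G s t) (gc 0 (a s t) (b s t)) x - gc 0 (G s t) (gc 0 (b s t) (a s t)) x).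
    by rewrite !gcDr// !gcNr// gcDr// gcNr.
  rewrite E; apply: homotopy_algebra.
  + have := gc_prelie gV_full x (Hm s t) (am s t) (mm s t) (ad s t) (md s t).
    by rewrite mul0r expr0z scale1r add0r.
  + have := gc_prelie gV_full x (Gm s t) (am s t) (bm s t) (ad s t) (bd s t).
    by rewrite mul0r expr0z scale1r add0r.
  + have := gc_prelie gV_full x (Gm s t) (cm s t) (mm s t) (cd s t) (md s t).
    by rewrite mulr1 addNr => ->; rewrite exprN1 invrN1 scaleN1r.
(* At s = 1 every term vanishes: F is the identity for all t, so its t-derivative is zero, and H and
   b are zero. *)
- move=> t x xN.
  have -> : dtf G 1%:i01 t x = 0.
    rewrite /dtf; have D := vten_cst dt_cst (unary x).
    rewrite (is_dt_vderiv D 1%:i01 t); congr (vderiv _ t); apply/funext => t'.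
    exact: transp1.
  have H1 y : H 1%:i01 t y = 0 by exact: dtransp1.
  have -> : dmorph N 1%:i01 t x = 0.
    rewrite /dmorph big1// => r _; rewrite big1// => j _.
    exact: blocks_zero_slot.
  rewrite (eq_gc _ _ _ H1 (fun y => erefl)) gc0f (eq_gc _ _ _ (fun y => erefl) (b1 t)).
  have -> : gc 0 (G 1%:i01 t) (fun=> 0) x = 0.
    rewrite gcircE -[RHS](spl0 x); apply: eq_spl => p q'.
    by rewrite -[RHS](spl0 q'); apply: eq_spl => q q''; rewrite mlin0.
  by rewrite !subr0.
Qed.

End Morphism.

(** * Components of the Maurer-Cartan equation *)

Section MaurerCartanComponents.
Context {R : realType} {V : lmodType R}.
Variable gV : gspace V.
Hypothesis gV_full : gcar gV = setT.
Local Notation I := {i01 R}.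
Local Notation gc := (gcirc gV).

Lemma hom_deg_mlin (f : seq V -> V) (k : int) :
  (forall n, hom_deg gV gV n (1 - n%:Z + k) f) -> mlin f /\ sdeg gV k f.
Proof.
move=> H; split=> [p q c u v|a d ha].
  have [fm _] := H (size p + size q).+1.
  by apply: fm => // *; exact: gcar_full.
have [_ fd] := H (size a); have := fd a d erefl ha.
have [sd _] := ha; congr (gdeg gV _ _).
by rewrite sum_shift sd; ring.
Qed.

Lemma sdeg_hom_deg (f : seq V -> V) (k : int) n :
  mlin f -> sdeg gV k f -> hom_deg gV gV n (1 - n%:Z + k) f.
Proof.
move=> fm fd; split=> [x y c u v _ _ _ _ _|a d sa ha]; first exact: fm.
have := fd a d ha; have [sd _] := ha; congr (gdeg gV _ _).
by rewrite sum_shift sd sa; ring.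
Qed.

Lemma half_double (v : V) : (2^-1 : R) *: (v + v) = v.
Proof.
have e : 2^-1 + 2^-1 = 1 :> R by lra.
by rewrite scalerDr -scalerDl e scale1r.
Qed.

Variable alpha : sqform V.
Hypothesis alphaMC : maurer_cartan gV alpha.
Local Notation m := (alpha false false).
Local Notation a := (alpha true false).
Local Notation b := (alpha false true).
Local Notation c := (alpha true true).

Lemma alpha_mlin p q s t : mlin (alpha p q s t).
Proof. by have [/(_ p q)[H _] _] := alphaMC; have [] := hom_deg_mlin (H s t). Qed.

Lemma alpha_sdeg (p q : bool) s t : sdeg gV (1 - (p + q)%N%:Z) (alpha p q s t).
Proof. by have [/(_ p q)[H _] _] := alphaMC; have [] := hom_deg_mlin (H s t). Qed.

Lemma alpha_vsmooth2 p q x : vsmooth2 (fun s t => alpha p q s t x).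
Proof. by have [/(_ p q)[_ H] _] := alphaMC. Qed.

Lemma alpha_vsm p q x : vsm (fun s t => alpha p q s t x).
Proof. by have [] := vsmooth2_rep (alpha_vsmooth2 p q x). Qed.

Lemma alpha_ds p q x : is_ds (fun s t => alpha p q s t x)
  (fun s t => vderiv (fun s' => alpha p q s' t x) s).
Proof. by have [] := vsmooth2_rep (alpha_vsmooth2 p q x). Qed.

(** Here and in the next two lemmas the coefficients of 1, ds and ds dt are read off. The factor 1/2
    disappears because [m, m] = 2 m \o m and every mixed bracket occurs twice. *)
Lemma mc00 s t x : gc 1 (m s t) (m s t) x = 0.
Proof.
have [_ /(_ false false s t x)] := alphaMC.
rewrite /sq_bracket !big_bool/=.
do !rewrite big_mkcond big_bool/=.
rewrite !(add0r, addr0, addn0, subr0, mulr0, muln0, expr0z, expr0, mulr1, scale1r).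
by rewrite /gbracket expr1z scaleN1r opprK half_double.
Qed.

Lemma m_ds x : is_ds (fun s t => m s t x)
  (fun s t => gc 0 (m s t) (a s t) x - gc 1 (a s t) (m s t) x).
Proof.
apply: (vten_ext (alpha_ds false false x)) => // s t.
have [_ /(_ true false s t x)] := alphaMC.
rewrite /sq_bracket !big_bool/=.
do !rewrite big_mkcond big_bool/=.
rewrite !(add0r, addr0, add0n, addn0, subr0, subrr, mulr0, muln0, mul0r, expr0z, expr0,
  mulr1, scale1r, expr1z).
rewrite /gbracket mul0r mulr0 expr0z !scale1r scaleN1r opprB half_double.
by move=> /eqP; rewrite addr_eq0 opprB => /eqP.
Qed.

Lemma b_ds x : is_ds (fun s t => b s t x)
  (fun s t => dtf a s t x - gc (-1) (m s t) (c s t) x - gc 1 (c s t) (m s t) x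
            - (gc 0 (a s t) (b s t) x - gc 0 (b s t) (a s t) x)).
Proof.
apply: (vten_ext (alpha_ds false true x)) => // s t.
have [_ /(_ true true s t x)] := alphaMC.
rewrite /sq_bracket !big_bool/=.
do !rewrite big_mkcond big_bool/=.
rewrite !(add0r, addr0, add0n, addn0, subr0, subrr, mulr0, muln0, mul0r, expr0z, expr0,
  mulr1, scale1r, expr1z).
have -> : 1 - (1 + 1)%N%:Z = -1 :> int by [].
have -> : (-1 : R) ^ (1 * (1 + 1)%N%:Z) = 1 by rewrite mul1r -exprnP sqrrN expr1n.
rewrite mul1r mul1n expr1 scale1r scaleN1r /gbracket mul0r expr0z !scale1r opprB.
rewrite mulr1 mul1r exprN1 invrN1 !scaleN1r !opprK.
set u1 := gc 1 _ _ _; set u2 := gc (-1) _ _ _; set w := gc 0 _ _ _ - _.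
rewrite (addrC u2) (addrC w) half_double -/(dtf a s t x).
move: u1 u2 w (dtf a s t x) => u1 u2 w u3.
move=> /eqP; rewrite addr_eq0 subr_eq => /eqP ->; zmod_start.
zmod_cancel u1; zmod_cancel u2; zmod_cancel w.
by zmod_cancel u3.
Qed.

End MaurerCartanComponents.

(** * The tree formula *)

Section Trees.
Context {R : realType} {V : lmodType R}.
Variable gV : gspace V.
Hypothesis gV_full : gcar gV = setT.
Local Notation I := {i01 R}.
Local Notation form := ((I -> V) * (I -> V))%type.
Local Notation gc := (gcirc gV).
Local Notation tw := (twist gV).
Local Notation sgn k := ((-1 : R) ^ (k : int)).

Lemma sum_insert0 (K g : seq V -> V) x : mlin K -> g [::] = 0 ->
  \sum_(1 <= r < (size x).+1) \sum_(0 <= j < (size x - r).+1) insert K g j r x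
  = gc 0 K g x.
Proof.
move=> Km g0; rewrite gc0E// spl3_big [RHS]big_ltn// [X in _ = X + _]big1 ?add0r//.
by move=> j _; rewrite take0 g0 mlin0.
Qed.

Lemma tree_mlin (A : I -> seq V -> V) s : (forall s, mlin (A s)) ->
  (forall s, A s [::] = 0) -> mlin (tree A s) /\
  forall s1 x, tree A (s1 :: s) x = gc 0 (tree A s) (A s1) x.
Proof.
move=> Am A0.
have step s' s1 x : mlin (tree A s') ->
    tree A (s1 :: s') x = gc 0 (tree A s') (A s1) x.
  by move=> tm; rewrite -sum_insert0.
suff tm : mlin (tree A s) by split=> // s1 x; exact: step.
elim: s => [|s1 s IH]; first exact: unary_mlin.
have -> : tree A (s1 :: s) = gc 0 (tree A s) (A s1).
  by apply/funext => x; exact: step.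
exact: gc_mlin.
Qed.

(** As dt dt = 0, at most one vertex of a tree built from a + dt c carries c. This sum, with exactly
    one such vertex, is the dt-coefficient of the tree on constant forms. *)
Fixpoint dtree (A C : I -> seq V -> V) (s : seq I) (x : seq V) : V :=
  if s is s1 :: s' then
    gc 0 (dtree A C s') (A s1) x + gc (-1) (tree A s') (C s1) x
  else 0.

Lemma dtree_mlin A C s : (forall s, mlin (A s)) -> (forall s, A s [::] = 0) ->
  (forall s, mlin (C s)) -> mlin (dtree A C s).
Proof.
move=> Am A0 Cm; elim: s => [|s1 s IH] /=; first exact: mlin_zero.
by apply: mlin_add; apply: gc_mlin => //; have [] := tree_mlin s Am A0.
Qed.

(* These functionals commute with integration and are stable under
   K |-> K \o g, which allows an induction on the tree formula. *)
Definition evsum (P : (seq V -> V) -> V) := exists Y : seq (seq V),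
  forall K, P K = \sum_(y <- Y) K y.

Lemma evsum_eval y : evsum (fun K => K y).
Proof. by exists [:: y] => K; rewrite big_seq1. Qed.

Lemma evsum_add P Q : evsum P -> evsum Q -> evsum (fun K => P K + Q K).
Proof.
by move=> [Y HY] [Z HZ]; exists (Y ++ Z) => K; rewrite big_cat HY HZ.
Qed.

Lemma evsum_zero : evsum (fun _ => 0).
Proof. by exists [::] => K; rewrite big_nil. Qed.

Lemma evsum_ext P Q : (forall K, P K = Q K) -> evsum P -> evsum Q.
Proof. by move=> /funext ->. Qed.

Lemma evsum_spl (F : seq V -> seq V -> (seq V -> V) -> V) x :
  (forall p q, evsum (F p q)) -> evsum (fun K => spl (fun p q => F p q K) x).
Proof.
elim: x F => [|v x IH] F FE /=; first exact: FE.
by apply: evsum_add; [exact: FE|exact: (IH (fun p q => F (v :: p) q))].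
Qed.

Lemma evsum_gc l g P : evsum P -> evsum (fun K => P (gc l K g)).
Proof.
move=> [Y HY].
apply: (evsum_ext (P := fun K => \sum_(y <- Y) gc l K g y)) => [K|].
  by rewrite HY.
elim: Y {HY} => [|y Y IH].
  by apply: evsum_ext evsum_zero => K; rewrite big_nil.
have E : evsum (fun K => gc l K g y).
  apply: (evsum_ext (P := fun K => spl3 (fun p q s => K (map (tw l) p ++ g q :: s)) y)).
    by move=> K; rewrite gcircE.
  by apply: evsum_spl => p r; apply: evsum_spl => q s; exact: evsum_eval.
by apply: evsum_ext (evsum_add E IH) => K; rewrite big_cons.
Qed.

Lemma evsumD P (K K' : seq V -> V) : evsum P -> P (fun x => K x + K' x) = P K + P K'.
Proof. by move=> [Y HY]; rewrite !HY big_split. Qed.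

Variables (a c : I -> I -> seq V -> V).
Hypotheses (am : forall s t, mlin (a s t)) (cm : forall s t, mlin (c s t)).
Hypotheses (ad : forall s t, sdeg gV 0 (a s t)).
Hypotheses (cd : forall s t, sdeg gV (-1) (c s t)).
Hypotheses (asm : forall x, vsm (fun s t => a s t x)).
Hypotheses (csm : forall x, vsm (fun s t => c s t x)).
Hypotheses (a0 : forall s t, a s t [::] = 0) (c0 : forall s t, c s t [::] = 0).
Hypotheses (a1 : forall s t v, a s t [:: v] = 0).

Lemma evsum_vsm P (u : I -> I -> seq V -> V) : evsum P ->
  (forall x, vsm (fun s t => u s t x)) -> vsm (fun s t => P (u s t)).
Proof.
move=> [Y HY] us; elim: Y P HY => [|y Y IH] P HY.
  by apply: vsm_eq (vsm_cst (0 : V)) => s t; rewrite HY big_nil.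
apply: vsm_eq (vsmD (us y) (IH (fun K => \sum_(y <- Y) K y) (fun K => erefl))) => s t.
by rewrite HY big_cons.
Qed.

Lemma evsum_vtail P (u : I -> I -> seq V -> V) s t : evsum P ->
  (forall x, vsm (fun s t => u s t x)) ->
  vtail (fun s t => P (u s t)) s t = P (fun x => vtail (fun s t => u s t x) s t).
Proof.
move=> [Y HY] us; rewrite HY -vtail_sum//.
by apply: eq_vtail => *; rewrite HY.
Qed.

(** Peeling off [s_1] replaces P by P(- \o a) and Q by P(- \o c) + Q(- \o a), so the induction has
    to range over all such functionals. Being finite sums of evaluations, they commute with the
    integral. *)
Lemma simplex_int_dtree i S t P Q : evsum P -> evsum Q ->
  simplex_int (@vint R V) i S
    (fun s => P (dtree (a^~ t) (c^~ t) s) + Q (tree (a^~ t) s))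
  = ((-1 : R) ^+ i) *: (P (Tterm gV a c i S t) + Q (Fterm gV a i S t)).
Proof.
elim: i S P Q => [|i IH] S P Q eP eQ; first by rewrite expr0 scale1r.
have [Xm _ Xs] := Fterm_spec gV_full am ad asm i.
have [Ym _ Ys] := Tterm_spec gV_full am cm ad cd asm csm i.
have cN : linear (fun v : V => ((-1) ^+ i) *: v) by exact: linear_scale.
pose u s t x := gc 0 (Tterm gV a c i s t) (a s t) x
               + gc (-1) (Fterm gV a i s t) (c s t) x.
pose w s t x := gc 0 (Fterm gV a i s t) (a s t) x.
have us x : vsm (fun s t => u s t x) by apply: vsmD; exact: gc_vsm.
have ws x : vsm (fun s t => w s t x) by exact: gc_vsm.
transitivity (vtail (fun s t => ((-1) ^+ i) *: (P (u s t) + Q (w s t))) S t).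
  rewrite /vtail /=; congr (vint S _); apply/funext => s1.
  pose P1 K := P (gc 0 K (a s1 t)).
  pose Q1 K := P (gc (-1) K (c s1 t)) + Q (gc 0 K (a s1 t)).
  have eP1 : evsum P1 by exact: evsum_gc.
  have eQ1 : evsum Q1 by apply: evsum_add; exact: evsum_gc.
  have -> : P (u s1 t) + Q (w s1 t) =
      P1 (Tterm gV a c i s1 t) + Q1 (Fterm gV a i s1 t).
    by rewrite /P1 /Q1 /u evsumD// addrA.
  rewrite -(IH s1 P1 Q1 eP1 eQ1); congr (simplex_int _ i s1 _); apply/funext => s'.
  rewrite evsumD// /P1 /Q1 addrA; congr (_ + _ + _).
  congr Q; apply/funext => x.
  have [_ E] := tree_mlin s' (fun s => am s t) (fun s => a0 s t).
  exact: (E s1 x).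
have PQ : vsm (fun s t => P (u s t) + Q (w s t)).
  by apply: vsmD; exact: evsum_vsm.
etransitivity; first exact: (vtail_lin S t cN PQ).
rewrite vtailD; try exact: evsum_vsm.
rewrite !evsum_vtail// exprS mulN1r scaleNr -scalerN opprD; congr (_ *: (_ + _)).
  have [Y HY] := eP.
  by rewrite !HY -sumrN; apply: eq_bigr => y _; rewrite /= opprK.
have [Y HY] := eQ.
by rewrite !HY -sumrN; apply: eq_bigr => y _; rewrite /= opprK.
Qed.

Lemma simplex_int_tree i S t x :
  simplex_int (@vint R V) i S (fun s => tree (a^~ t) s x)
  = ((-1 : R) ^+ i) *: Fterm gV a i S t x.
Proof.
have := simplex_int_dtree i S t evsum_zero (evsum_eval x).
rewrite add0r => <-; congr simplex_int; apply/funext => s; by rewrite add0r.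
Qed.

Lemma scale_sign (i : nat) (v : V) : ((-1 : R) ^+ i) *: (((-1 : R) ^+ i) *: v) = v.
Proof. by rewrite scalerA -exprMn mulrNN mulr1 expr1n scale1r. Qed.

Definition at_t (t : I) (w : form) : V * V := (w.1 t, w.2 t).

Lemma form_ext2 k f (w : seq form) t : (form_ext gV k f w).2 t =
  sgn k *: dext gV (f t) (map (at_t t) w).
Proof.
rewrite /form_ext/= /dext mark_map (mark_big _ _ 0) scaler_sumr.
apply: eq_bigr => j _; congr (_ *: f t (_ ++ _ :: _)); by rewrite -map_comp.
Qed.

Lemma form_ext1 k f (w : seq form) t : (form_ext gV k f w).1 t =
  f t [seq x.1 | x <- map (at_t t) w].
Proof. by rewrite /= -map_comp. Qed.

Lemma dext_unary w : dext gV unary w = unary [seq x.2 | x <- w].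
Proof.
case: w => [|x [|y w]] //=; first by rewrite /dext /= addr0.
have sW : size [:: x, y & w] = (size w).+2 by [].
rewrite /dext (mark_big _ _ 0); move: [:: x, y & w] sW => W sW.
rewrite big_nat_cond big1// => j /andP[/andP[_ jw] _].
have : size ([seq tw 1 z.1 | z <- take j W]
    ++ (nth 0 W j).2 :: [seq z.1 | z <- drop j.+1 W]) = (size w).+2.
  rewrite size_cat/= !size_map size_drop size_takel ?(ltnW jw)//.
  by rewrite addnS -addSn subnKC.
by case: (_ ++ _) => [|? [|? ?]].
Qed.

Lemma dext_slotD f p u v v' q : mlin f ->
  dext gV f (p ++ (u, v + v') :: q) =
  dext gV f (p ++ (u, v) :: q) + f ([seq tw 1 y.1 | y <- p] ++ v' :: [seq y.1 | y <- q]).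
Proof.
move=> fm; rewrite /dext !mark_cat_cons/= (linD (fm _ _)) [RHS]addrAC !addrA.
congr (_ + _ + _ + _); apply: eq_mark => p' x q'; by rewrite !map_cat.
Qed.

Lemma dext_slot0 f p q : mlin f -> dext gV f (p ++ (0, 0) :: q) = 0.
Proof.
move=> fm; rewrite /dext mark_cat_cons/= mlin0//.
have Z1 : mark (fun a x b => f ([seq tw 1 y.1 | y <- a] ++
    x.2 :: [seq y.1 | y <- b ++ (0, 0) :: q])) p = 0.
  apply: etrans (mark0 p); apply: eq_mark => p' x q'; rewrite map_cat.
  have := mlin0 ([seq tw 1 y.1 | y <- p'] ++ x.2 :: [seq y.1 | y <- q'])
     [seq y.1 | y <- q] fm.
  by rewrite -catA.
rewrite Z1 addr0 add0r; apply: etrans (mark0 q); apply: eq_mark => p' x q'.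
by rewrite map_cat/= (lin0 (twist_linear gV_full 1)) -catA/= mlin0.
Qed.

Lemma dext_const f (w : seq (V * V)) : mlin f -> all (fun x => x.2 == 0) w ->
  dext gV f w = 0.
Proof.
move=> fm w0; rewrite /dext (mark_big _ _ 0) big_nat_cond big1// => j /andP[/andP[_ jw] _].
by have /eqP -> := all_nthP 0 w0 j jw; exact: mlin0.
Qed.

End Trees.

Lemma sum_pos_spl3 (T : Type) (Z : zmodType) (X : seq T -> seq T -> seq T -> Z) x :
  (forall p s, X p [::] s = 0) ->
  \sum_(1 <= r < (size x).+1) \sum_(0 <= j < (size x - r).+1)
    X (take j x) (take r (drop j x)) (drop (j + r) x) = spl3 X x.
Proof.
move=> X0; rewrite spl3_big [RHS]big_ltn// [X in _ = X + _]big1 ?add0r//.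
by move=> j _; rewrite take0.
Qed.

(** * The form-valued tree formula, pointwise in t *)

Section Hat.
Context {R : realType} {V : lmodType R}.
Variable gV : gspace V.
Hypothesis gV_full : gcar gV = setT.
Local Notation I := {i01 R}.
Local Notation form := ((I -> V) * (I -> V))%type.
Local Notation gc := (gcirc gV).
Local Notation tw := (twist gV).
Local Notation sgn k := ((-1 : R) ^ (k : int)).

Lemma form_sum1 (T : Type) (r : seq T) (P : pred T) (F : T -> form) t :
  (\sum_(i <- r | P i) F i).1 t = \sum_(i <- r | P i) (F i).1 t.
Proof.
by elim: r => [|i r IH]; rewrite ?big_nil// !big_cons; case: ifP; rewrite -IH.
Qed.

Lemma form_sum2 (T : Type) (r : seq T) (P : pred T) (F : T -> form) t :
  (\sum_(i <- r | P i) F i).2 t = \sum_(i <- r | P i) (F i).2 t.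
Proof.
by elim: r => [|i r IH]; rewrite ?big_nil// !big_cons; case: ifP; rewrite -IH.
Qed.

Lemma form_eq (w w' : form) : (forall t, w.1 t = w'.1 t) ->
  (forall t, w.2 t = w'.2 t) -> w = w'.
Proof.
case: w w' => [w1 w2] [w1' w2'] /= E1 E2.
by congr (_, _); apply/funext.
Qed.

Lemma ptwist0 (p : seq (V * V)) : map (ptwist gV 0) p = p.
Proof.
rewrite -[RHS]map_id; apply: eq_map => -[u v].
by rewrite /ptwist !twist0// expr0z scale1r.
Qed.

Variable alpha : sqform V.
Local Notation a := (alpha true false).
Local Notation c := (alpha true true).
Hypotheses (am : forall s t, mlin (a s t)) (cm : forall s t, mlin (c s t)).
Hypotheses (ad : forall s t, sdeg gV 0 (a s t)).
Hypotheses (cd : forall s t, sdeg gV (-1) (c s t)).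
Hypotheses (asm : forall x, vsm (fun s t => a s t x)).
Hypotheses (csm : forall x, vsm (fun s t => c s t x)).
Hypotheses (a0 : forall s t, a s t [::] = 0) (c0 : forall s t, c s t [::] = 0).
Hypotheses (a1 : forall s t v, a s t [:: v] = 0).

Lemma hat_a_at s t (w : seq form) : at_t t (hat_a gV alpha s w) =
  (a s t [seq x.1 | x <- map (at_t t) w],
   dext gV (a s t) (map (at_t t) w) + c s t [seq x.1 | x <- map (at_t t) w]).
Proof.
have -> : at_t t (hat_a gV alpha s w) =
  ((form_ext gV 0 (a s) w).1 t + 0, (form_ext gV 0 (a s) w).2 t
      + (form_ext gV (-1) (c s) w).1 t) by [].
by rewrite form_ext2 !form_ext1 addr0 expr0z scale1r.
Qed.

(** Induction on the vertices. The part with [a] alone extends to forms by [dext_gc], without sign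
    as [a] has shifted degree 0; the term dt c is additive in its slot and produces [dtree]. *)
Lemma tree_hat s t (w : seq form) : at_t t (tree (hat_a gV alpha) s w) =
  (tree (a^~ t) s [seq x.1 | x <- map (at_t t) w],
   dext gV (tree (a^~ t) s) (map (at_t t) w)
     + dtree gV (a^~ t) (c^~ t) s [seq x.1 | x <- map (at_t t) w]).
Proof.
elim: s w => [|s1 s IH] w.
  rewrite /= dext_unary addr0; case: w => [|x [|y w]] //.
set T := tree (a^~ t) s in IH *; set dT := dtree gV (a^~ t) (c^~ t) s in IH *.
have [Tm TE] := tree_mlin gV_full s (fun s => am s t) (fun s => a0 s t).
have dTm : mlin dT := dtree_mlin gV_full s (fun s => am s t) (fun s => a0 s t)
  (fun s => cm s t).
have I1 y : (tree (hat_a gV alpha) s y).1 t = T [seq x.1 | x <- map (at_t t) y].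
  exact: (congr1 fst (IH y)).
have {IH} I2 y : (tree (hat_a gV alpha) s y).2 t = dext gV T (map (at_t t) y)
    + dT [seq x.1 | x <- map (at_t t) y].
  exact: (congr1 snd (IH y)).
rewrite [LHS]/at_t; congr (_, _).
  rewrite /= form_sum1 !size_map; apply: eq_bigr => k _.
  rewrite form_sum1; apply: eq_bigr => j _.
  rewrite /insert I1 !(map_cat, map_cons) hat_a_at/=.
  by rewrite -!map_take -!map_drop -!map_take.
transitivity (spl3 (fun p q r =>
    dext gV T (p ++ (a s1 t [seq x.1 | x <- q], dext gV (a s1 t) q
       + c s1 t [seq x.1 | x <- q]) :: r)
  + dT ([seq x.1 | x <- p] ++ a s1 t [seq x.1 | x <- q] :: [seq x.1 | x <- r]))
  (map (at_t t) w)).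
  rewrite spl3_map -sum_pos_spl3 => [|p r]; last first.
    by rewrite /= a0 c0 addr0 dext_slot0// mlin0// addr0.
  rewrite /= form_sum2; apply: eq_bigr => k _.
  rewrite form_sum2; apply: eq_bigr => j _.
  by rewrite /insert I2 !(map_cat, map_cons) hat_a_at.
have TE' : tree (a^~ t) (s1 :: s) = gc 0 T (a s1 t) by apply/funext => x; exact: TE.
rewrite TE' (dext_gc gV_full _ Tm (am s1 t) (ad s1 t)) expr0z scale1r.
under eq_spl3 do rewrite dext_slotD//.
rewrite !spl3D -addrA; congr (_ + _).
  by apply: eq_spl3 => p q r; rewrite ptwist0 scale1r.
rewrite [dtree _ _ _ _ _]/= addrC -/T -/dT; congr (_ + _).
  by rewrite gc0E// [RHS]spl3_map.
rewrite gc_parity// gcircE [RHS]spl3_map; apply: eq_spl3 => p q r.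
by rewrite -!map_comp.
Qed.

Lemma simplex_form1 i S (Phi : seq I -> form) t :
  (simplex_int (@form_int R V) i S Phi).1 t =
  simplex_int (@vint R V) i S (fun s => (Phi s).1 t).
Proof.
elim: i S Phi => //= i IH S Phi; congr (vint S _); apply/funext => s; exact: IH.
Qed.

Lemma simplex_form2 i S (Phi : seq I -> form) t :
  (simplex_int (@form_int R V) i S Phi).2 t =
  simplex_int (@vint R V) i S (fun s => (Phi s).2 t).
Proof.
elim: i S Phi => //= i IH S Phi; congr (vint S _); apply/funext => s; exact: IH.
Qed.

Lemma path_morphismE t x : path_morphism alpha t x = transp gV a 0%:i01 t x.
Proof.
rewrite /path_morphism /tree_formula.
under eq_bigr do rewrite (simplex_int_tree gV_full am cm ad cd asm csm a0) scale_sign.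
(* The tree formula stops at order [(size x).-1]; the further term of [transp] vanishes for lack of
   inputs. *)
have -> : transp gV a 0%:i01 t x =
    \sum_(0 <= i < (size x).-1.+1) Fterm gV a i 0%:i01 t x.
  case: x => [|v x] //.
  have Z := Fterm_vanish gV_full am ad asm a0 a1 0%:i01 t (ltn0Sn (size x))
    (leqnn (size (v :: x))).
  by rewrite /transp big_nat_recr// Z; exact: addr0.
by rewrite [RHS]big_ltn.
Qed.

(** On constant forms all dt-components vanish, so the extension of the tree contributes nothing to
    the dt-coefficient and only [dtree] remains. *)
Lemma hat_G_const x : hat_G gV alpha [seq const_form v | v <- x] =
  (fun t => transp gV a 0%:i01 t x, fun t => dtransp gV a c 0%:i01 t x).
Proof.
have atc t : map (at_t t) [seq const_form v | v <- x] = [seq (v, 0) | v <- x].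
  by rewrite -map_comp.
have fstc : [seq y.1 | y <- [seq (v, 0 : V) | v <- x]] = x.
  by rewrite -map_comp map_id_in.
have add1 (A B : form) t : (A + B).1 t = A.1 t + B.1 t by [].
have add2 (A B : form) t : (A + B).2 t = A.2 t + B.2 t by [].
apply: form_eq => t; rewrite /hat_G /tree_formula ?add1 ?add2.
  rewrite /transp [RHS]big_ltn// form_sum1 size_map; congr (_ + _).
    by case: x {atc fstc} => [|v [|]].
  apply: eq_bigr => i _.
  transitivity ((-1) ^+ i *: (simplex_int (@form_int R V) i 0%:i01 (fun s =>
    tree (hat_a gV alpha) s [seq const_form v | v <- x])).1 t); first by [].
  rewrite simplex_form1.
  rewrite -[RHS](scale_sign i) -(simplex_int_tree gV_full am cm ad cd asm csm a0).
  congr (_ *: simplex_int _ _ _ _); apply/funext => s.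
  have -> : (tree (hat_a gV alpha) s [seq const_form v | v <- x]).1 t =
    (at_t t (tree (hat_a gV alpha) s [seq const_form v | v <- x])).1 by [].
  by rewrite tree_hat atc fstc.
rewrite [RHS]/dtransp [RHS]big_ltn// form_sum2 size_map; congr (_ + _).
  by case: x {atc fstc} => [|v [|]].
apply: eq_bigr => i _.
transitivity ((-1) ^+ i *: (simplex_int (@form_int R V) i 0%:i01 (fun s =>
    tree (hat_a gV alpha) s [seq const_form v | v <- x])).2 t); first by [].
rewrite simplex_form2 -[RHS](scale_sign i); congr (_ *: _).
have H := simplex_int_dtree gV_full am cm ad cd asm csm a0 i 0%:i01 t
  (evsum_eval x) (@evsum_zero R V).
rewrite -[Tterm _ _ _ _ _ _ _]addr0 -H; congr (simplex_int _ _ _ _); apply/funext => s.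
have -> : (tree (hat_a gV alpha) s [seq const_form v | v <- x]).2 t =
  (at_t t (tree (hat_a gV alpha) s [seq const_form v | v <- x])).2 by [].
rewrite tree_hat atc fstc/= dext_const ?add0r ?addr0//.
  by have [] := tree_mlin gV_full s (fun s => am s t) (fun s => a0 s t).
by rewrite all_map; apply/allP => v _ /=.
Qed.

End Hat.

(** * The algebra of forms *)

Section FormsAlgebra.
Context {R : realType} {V : lmodType R}.
Variable gV : gspace V.
Hypothesis gV_full : gcar gV = setT.
Local Notation I := {i01 R}.
Local Notation form := ((I -> V) * (I -> V))%type.
Local Notation gc := (gcirc gV).
Local Notation tw := (twist gV).
Local Notation sgn k := ((-1 : R) ^ (k : int)).

Lemma vsm_vsmooth (u : I -> I -> V) s : vsm u -> vsmooth (gcar gV) (u s).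
Proof.
move=> /vsm_rep[N [h [v [sh eu]]]]; exists N, (fun i => h i s%:num), v; split.
- by move=> i; exact: tsmooth_smooth1.
- by move=> i; exact: gcar_full.
- by move=> t; rewrite eu.
Qed.

Lemma vsmooth_vsm C (u : I -> V) : vsmooth C u -> vsm (fun _ : I => u).
Proof.
move=> [N [g [v [sg _ eu]]]].
apply: (@rep_vsm _ _ _ N (fun i _ => g i) v) => [i|s t]; last exact: eu.
exact: smooth1_tsmooth.
Qed.

Lemma mark_linear (T : Type) (U : lmodType R) (F : U -> seq T -> T -> seq T -> V) w :
  (forall p x q, linear (fun u => F u p x q)) -> linear (fun u => mark (F u) w).
Proof.
elim: w F => [|x w IH] F Fl /=; first by move=> c u v; rewrite scaler0 addr0.
by apply: linear_add; [exact: Fl|exact: (IH (fun u p => F u (x :: p)))].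
Qed.
Lemma dext_mlin f : mlin f -> mlin (dext gV f).
Proof.
move=> fm p q; rewrite /dext.
have E v := mark_cat_cons (fun p x q => f ([seq tw 1 y.1 | y <- p] ++
  x.2 :: [seq y.1 | y <- q])) p v q.
move=> c u v; rewrite !E {E}; move: c u v; apply: linear_add; first apply: linear_add.
- apply: mark_linear => a x b c u v; rewrite !map_cat/=.
  by have := fm ([seq tw 1 y.1 | y <- a] ++ x.2 :: [seq y.1 | y <- b])
    [seq y.1 | y <- q] c u.1 v.1; rewrite -!catA.
- by move=> c u v; exact: fm.
- apply: mark_linear => a x b c u v; rewrite !map_cat/= twist_linear//.
  by rewrite -!catA; exact: fm.
Qed.

(** Leibniz rule for a multilinear map with constant coefficients; with the t-derivative it says
    that d is a derivation with respect to [f]. *)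
Lemma vten_mlin (D : (I -> I -> R) -> (I -> I -> R) -> Prop)
    (D_cst : forall c : R, D (fun _ _ => c) (fun _ _ => 0))
    (D_mul : forall g g' h h', D g g' -> D h h' ->
      D (fun s t => g s t * h s t) (fun s t => g' s t * h s t + g s t * h' s t))
    (f : seq V -> V) (T : Type) (u u' : T -> I -> I -> V) (W : seq T) :
  mlin f -> (forall x, vten D (u x) (u' x)) ->
  vten D (fun s t => f [seq u x s t | x <- W])
    (fun s t => mark (fun p x q => f ([seq u y s t | y <- p] ++ u' x s t ::
                                      [seq u y s t | y <- q])) W).
Proof.
move=> fm du; elim: W f fm => [|x W IH] f fm /=; first exact: vten_cst.
apply: (vten_ext (vten_subst D_mul
  (f := fun s t v => f (v :: [seq u y s t | y <- W]))
  (f' := fun s t v => mark (fun p y q => f (v :: [seq u z s t | z <- p] ++ u' y s t ::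
     [seq u z s t | z <- q])) W) _ _ _ (du x))) => //.
- by move=> s t; exact: mlin_head.
- by move=> s t; apply: mark_linear => p y q; exact: mlin_head.
- by move=> v; apply: (IH (fun y => f (v :: y))); exact: mlin_cons.
- by move=> s t; rewrite addrC.
Qed.

Lemma vsm_mlin (f : seq V -> V) (us : seq (I -> I -> V)) : mlin f ->
  (forall i, (i < size us)%N -> vsm (nth (fun _ _ => 0) us i)) ->
  vsm (fun s t => f [seq u s t | u <- us]).
Proof.
move=> fm sus.
have := vten_mlin dt_cst dt_mul (u := nth (fun _ _ => 0) us \o val)
  (u' := fun i s t => vderiv (nth (fun _ _ => 0) us (val i) s) t)
  (enum 'I_(size us)) fm (fun i => is_dt_deriv (sus i (ltn_ord i))).
move=> H; eexists; apply: (vten_ext H) => // s t.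
have E : [seq nth (fun _ _ => 0) us (val i) | i <- enum 'I_(size us)] = us.
  rewrite (map_comp (nth (fun _ _ => 0) us) val) val_enum_ord; exact: mkseq_nth.
by congr f; rewrite -[in RHS]E -[RHS]map_comp.
Qed.

Lemma at_fst t (w : seq form) : [seq x.1 | x <- map (at_t t) w] = [seq x.1 t | x <- w].
Proof. by rewrite -map_comp. Qed.

(* The degrees of the coefficients of 1 and dt of forms of degrees d_i. *)
Fixpoint phomog (W : seq (V * V)) (d : seq int) : Prop :=
  match W, d with
  | [::], [::] => True
  | x :: W', e :: d' => [/\ gdeg gV e x.1, gdeg gV (e - 1) x.2 & phomog W' d']
  | _, _ => False
  end.

Lemma phomog_fst W d : phomog W d -> homog gV [seq x.1 | x <- W] d.
Proof.
elim: W d => [|x W IH] [|e d] //=.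
by move=> [h1 _ /IH h]; exact/homog_cons.
Qed.

Lemma homog_at (w : seq form) d t : homog (Omega gV) w d -> phomog (map (at_t t) w) d.
Proof.
elim: w d => [|x w IH] d; first by move=> /homog_nil ->.
case: d => [[]//|e d] /homog_cons[[[s1 s2] ex] /IH h] /=; split=> //; split=> /=.
- exact: gcar_full.
- by rewrite -[in RHS]ex.
- exact: gcar_full.
- by rewrite -[in RHS]ex.
Qed.

Lemma dext_gdeg f k W d : sdeg gV k f -> phomog W d ->
  gdeg gV (\sum_(e <- d) (e - 1) + k) (dext gV f W).
Proof.
move=> fk hW; rewrite /dext.
(* Entries already passed by the mark have been twisted, so the induction carries them along as a
   homogeneous prefix. *)
suff : forall p dp, homog gV p dp ->
   gdeg gV (\sum_(e <- dp) (e - 1) + \sum_(e <- d) (e - 1) + k)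
     (mark (fun P x Q => f (p ++ [seq tw 1 y.1 | y <- P] ++ x.2 :: [seq y.1 | y <- Q])) W).
  by move=> /(_ [::] [::]); rewrite big_nil add0r; apply.
elim: W d hW => [|x W IH] [|e d] //= hW p dp hp; first exact: gdeg0.
have [h1 h2 hW'] := hW; apply: gdegD => //.
  have := fk _ _ (cat_homog hp ((homog_cons gV _ _ _ _).2 (conj h2 (phomog_fst hW')))).
  by congr (gdeg gV _ _); rewrite big_cat/= !big_cons; ring.
have hx : homog gV [:: tw 1 x.1] [:: e].
  by apply/homog_cons; split=> //; rewrite (twist_homog gV_full 1 h1); exact: gdegZ.
have := IH d hW' _ _ (cat_homog hp hx).
rewrite big_cat/= big_seq1 big_cons.
rewrite (eq_mark (G := fun P y Q => f (p ++ (tw 1 x.1 :: [seq tw 1 z.1 | z <- P]) ++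
   y.2 :: [seq z.1 | z <- Q]))); last by move=> P y Q; rewrite -catA.
by congr (gdeg gV _ _); ring.
Qed.

(** A homogeneous form of degree e is an eigenvector of [ptwist gV 1] for (-1)^(e-1): the extra sign
    on the dt-component makes up for its degree e - 1. *)
Lemma ptwist_phomog (F : seq (V * V) -> V) P Z d : mlin F -> phomog P d ->
  F (map (ptwist gV 1) P ++ Z) = sgn (\sum_(e <- d) (e - 1)) *: F (P ++ Z).
Proof.
elim: P d F => [|x P IH] [|e d] F Fm //=.
  by rewrite big_nil expr0z scale1r.
move=> [h1 h2 hP].
rewrite (IH d (fun y => F (ptwist gV 1 x :: y)))//; last exact: mlin_cons.
have -> : ptwist gV 1 x = sgn (e - 1) *: x.
  rewrite /ptwist (twist_homog gV_full 1 h1) (twist_homog gV_full 1 h2) scalerA -sgnD.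
  rewrite (_ : 1 + 1 * (e - 1 - 1) = e - 1) ?mul1r; last by ring.
  by case: x {h1 h2}.
rewrite (mlinZ [::])//= scalerA big_cons -sgnD; congr (sgn _ *: _); ring.
Qed.

Variable mu : seq V -> V.
Hypotheses (mum : mlin mu) (mud : sdeg gV 1 mu) (mu0 : mu [::] = 0).
Hypothesis mumu : forall x, gc 1 mu mu x = 0.

Definition dpart (w : seq form) (t : I) : V := if w is [:: x] then vderiv x.1 t else 0.

Lemma Omega_mu1 w t : (Omega_mu gV mu w).1 t = mu [seq x.1 | x <- map (at_t t) w].
Proof.
have -> : (Omega_mu gV mu w).1 t = (if w is [:: x] then form_d x else 0).1 t +
   (form_ext gV 1 (fun=> mu) w).1 t by [].
by rewrite form_ext1; case: w => [|x [|y w]]; rewrite add0r.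
Qed.

Lemma Omega_mu2 w t : (Omega_mu gV mu w).2 t = dpart w t - dext gV mu (map (at_t t) w).
Proof.
have -> : (Omega_mu gV mu w).2 t = (if w is [:: x] then form_d x else 0).2 t +
   (form_ext gV 1 (fun=> mu) w).2 t by [].
by rewrite form_ext2 expr1z scaleN1r; case: w => [|x [|y w]].
Qed.

Lemma at_mu w t : at_t t (Omega_mu gV mu w) =
  (mu [seq x.1 | x <- map (at_t t) w], dpart w t - dext gV mu (map (at_t t) w)).
Proof. by rewrite -Omega_mu1 -Omega_mu2. Qed.

Lemma vsmooth_mlin (f : seq V -> V) (us : seq (I -> V)) : mlin f ->
  (forall i, (i < size us)%N -> vsmooth (gcar gV) (nth 0 us i)) ->
  vsmooth (gcar gV) (fun t => f [seq u t | u <- us]).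
Proof.
move=> fm sus.
have H := @vsm_mlin f [seq (fun=> u) | u <- us] fm.
have : vsm (fun s t => f [seq u s t | u <- [seq (fun _ : I => u) | u <- us]]).
  apply: H => i; rewrite size_map => iu; rewrite (nth_map 0)//.
  exact: vsmooth_vsm (sus i iu).
move=> /(vsm_vsmooth 0%:i01); congr (vsmooth _ _); apply/funext => t.
by rewrite -map_comp.
Qed.

Lemma vsmooth_sum (T : Type) (r : seq T) (u : T -> I -> V) :
  (forall i, vsmooth (gcar gV) (u i)) -> vsmooth (gcar gV) (fun t => \sum_(i <- r) u i t).
Proof.
move=> su; elim: r => [|i r IH].
  by under eq_fun do rewrite big_nil; exact: vsmooth0.
under eq_fun do rewrite big_cons.
have -> : (fun t => u i t + \sum_(j <- r) u j t) =
   (1 : R) *: u i + (fun t => \sum_(j <- r) u j t).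
  by rewrite scale1r.
exact: vsmoothP.
Qed.

Lemma vsmooth_twist l (u : I -> V) : vsmooth (gcar gV) u ->
  vsmooth (gcar gV) (fun t => tw l (u t)).
Proof.
move=> su; have := @vsmooth_mlin (fun x => tw l (unary x)) [:: u].
apply; last by case.
by apply: mlin_comp; [exact: twist_linear|exact: unary_mlin].
Qed.

Lemma vsmooth_vderiv (u : I -> V) : vsmooth (gcar gV) u ->
  vsmooth (gcar gV) (vderiv u).
Proof.
move=> /vsmooth_vsm/is_dt_deriv/is_dt_vsm' H.
exact: (vsm_vsmooth 0%:i01 H).
Qed.

Lemma Omega_mu_car (w : seq form) :
  (forall i, (i < size w)%N -> Omega_car gV (nth 0 w i)) ->
  Omega_car gV (Omega_mu gV mu w).
Proof.
move=> cw; split.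
  have -> : (Omega_mu gV mu w).1 = fun t => mu [seq u t | u <- [seq x.1 | x <- w]].
    by apply/funext => t; rewrite Omega_mu1 at_fst -[in RHS]map_comp.
  apply: vsmooth_mlin => // i; rewrite size_map => iw.
  by rewrite (nth_map 0)//; have [] := cw i iw.
have -> : (Omega_mu gV mu w).2 = (-1 : R) *: (fun t => dext gV mu (map (at_t t) w))
    + (dpart w).
  by apply/funext => t; rewrite Omega_mu2 addrC -scaleN1r.
apply: vsmoothP; last first.
  case: w cw => [|x [|y w]] cw /=; try exact: vsmooth0.
  by apply: vsmooth_vderiv; have [] := cw 0%N isT.
have -> : (fun t => dext gV mu [seq at_t t i | i <- w]) = fun t =>
    (* The guard makes every summand smooth without restriction on j, as [vsmooth_sum] asks. *)
    \sum_(0 <= j < size w) (if (j < size w)%N then mu [seq u t | u <-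
      [seq (fun t => tw 1 (x.1 t)) | x <- take j w] ++ (nth 0 w j).2 ::
      [seq x.1 | x <- drop j.+1 w]] else 0).
  apply/funext => t; rewrite /dext mark_map (mark_big _ _ 0).
  apply: eq_big_nat => j /andP[_ ->].
  by rewrite map_cat/= -!map_comp.
apply: vsmooth_sum => j; case: (ltnP j (size w)) => jw; last exact: vsmooth0.
apply: vsmooth_mlin => // i _.
rewrite nth_cat size_map size_takel ?(ltnW jw)//; case: ltnP => ij.
  rewrite (nth_map 0) ?size_takel ?(ltnW jw)// nth_take//.
  by apply: vsmooth_twist; have [] := cw i (ltn_trans ij jw).
case: (i - j)%N => [|k] /=; first by have [] := cw j jw.
have [kw|kw] := ltnP k (size (drop j.+1 w)); last first.
  by rewrite nth_default ?size_map//; exact: vsmooth0.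
rewrite (nth_map 0)// nth_drop.
by move: kw; rewrite size_drop ltn_subRL => /cw[].
Qed.

Lemma Omega_hom_deg n : (0 < n)%N ->
  hom_deg (Omega gV) (Omega gV) n (2 - n%:Z) (Omega_mu gV mu).
Proof.
move=> n0; split=> [x y c u v _ _ _ cu cv|w d sw hw].
  have lin_at t (f : seq (V * V) -> V) : mlin f ->
      f (map (at_t t) (x ++ (c *: u + v) :: y)) =
      c *: f (map (at_t t) (x ++ u :: y)) + f (map (at_t t) (x ++ v :: y)).
    by move=> fm; rewrite !map_cat/=; exact: (fm (map (at_t t) x) (map (at_t t) y) c (at_t t u) (at_t t v)).
  have mufst : mlin (fun W : seq (V * V) => mu [seq x.1 | x <- W]).
    by move=> p q e u' v'; rewrite !map_cat/=; exact: mum.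
  apply: form_eq => t.
    have -> : forall a b : form, (c *: a + b).1 t = c *: a.1 t + b.1 t by [].
    by rewrite !Omega_mu1 (lin_at t _ mufst).
  have -> : forall a b : form, (c *: a + b).2 t = c *: a.2 t + b.2 t by [].
  rewrite !Omega_mu2 (lin_at t _ (dext_mlin mum)) scalerBr addrACA opprD.
  congr (_ + _).
  case: x {lin_at} => [|x0 [|x1 x]] /=; last 2 first.
  - by rewrite scaler0 addr0.
  - by rewrite scaler0 addr0.
  case: y => [|y0 y] /=; last by rewrite scaler0 addr0.
  have [su _] := cu; have [sv _] := cv.
  have cl : linear (fun v : V => c *: v) by exact: linear_scale.
  have su' := vsmooth_vsm su; have sv' := vsmooth_vsm sv.
  apply: etrans (vderivD 0%:i01 t (vsm_lin cl su') sv') _.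
  by rewrite (vderiv_lin 0%:i01 t cl su').
have sd : size d = size w by have [] := hw.
split.
  apply: Omega_mu_car => i iw; have [_ /(_ i iw)[]] := hw; exact.
apply: form_eq => t.
  have hd := mud (phomog_fst (homog_at t hw)).
  have -> : (gproj (Omega gV) (\sum_(e <- d) e + (2 - n%:Z)) (Omega_mu gV mu w)).1 t =
    gproj gV (\sum_(e <- d) e + (2 - n%:Z)) ((Omega_mu gV mu w).1 t) by [].
  rewrite Omega_mu1; have [_] := hd; congr (gproj gV _ _ = _).
  by rewrite sum_shift sd sw; ring.
have -> : (gproj (Omega gV) (\sum_(e <- d) e + (2 - n%:Z)) (Omega_mu gV mu w)).2 t =
    gproj gV (\sum_(e <- d) e + (2 - n%:Z) - 1) ((Omega_mu gV mu w).2 t) by [].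
suff : gdeg gV (\sum_(e <- d) e + (2 - n%:Z) - 1) ((Omega_mu gV mu w).2 t) by case.
rewrite Omega_mu2; apply: gdegD => //; last first.
  rewrite -scaleN1r; apply: gdegZ => //.
  have := dext_gdeg mud (homog_at t hw); congr (gdeg gV _ _).
  by rewrite sum_shift sd sw; ring.
case: w d hw sw sd => [|x [|y w]] [|e [|e' d]] //= hw sw _; try exact: gdeg0.
have /homog_cons[[cx ex] _] := hw; have [sx _] := cx.
split; first exact: gcar_full.
rewrite big_seq1 -sw (_ : e + (2 - 1) - 1 = e); last by ring.
rewrite -(vderiv_lin 0%:i01 t (gproj_linear gV e) (vsmooth_vsm sx)).
congr (vderiv _ t); apply/funext => t'.
by rewrite -[in RHS]ex.
Qed.

Lemma vderiv0 (t : I) : vderiv (fun=> 0 : V) t = 0.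
Proof. exact/esym/(is_dt_vderiv (vten0 dt_scal) 0%:i01 t). Qed.

(** The coefficient of 1 is the relation for [mu]. In the dt-coefficient the terms without d vanish
    by [dext_gc] and [mu \o mu = 0]; the others are d(mu(..)) and the terms mu(.., dx, ..), which
    cancel because d is a derivation with respect to [mu]. *)
Lemma Omega_relation (w : seq form) d : (0 < size w)%N -> homog (Omega gV) w d ->
  \sum_(1 <= r < (size w).+1) \sum_(0 <= j < (size w - r).+1)
    sgn (eps d j) *: insert (Omega_mu gV mu) (Omega_mu gV mu) j r w = 0.
Proof.
move=> w0 hw; have sd : size d = size w by have [] := hw.
apply: form_eq => t.
  rewrite form_sum1; under eq_bigr do rewrite form_sum1.
  have := sum_insert gV_full mum mu0 (phomog_fst (homog_at t hw)).
  rewrite mumu => E; rewrite -[RHS]E !size_map; apply: eq_bigr => r _.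
  apply: eq_bigr => j _.
  have -> : forall e (a : form), (e *: a).1 t = e *: a.1 t by [].
  congr (_ *: _); rewrite /insert Omega_mu1 !(map_cat, map_cons) at_mu/=.
  by rewrite -!map_take -!map_drop -!map_take.
rewrite form_sum2; under eq_bigr do rewrite form_sum2.
pose fst_ (p : seq form) := [seq x.1 | x <- map (at_t t) p].
(* The de Rham part of the outer operation has arity one, so it is present only when the inner
   operation consumes the whole list. *)
pose outer (p q s : seq form) : V := if p is [::] then if s is [::] then
   vderiv (fun t => mu [seq x.1 | x <- map (at_t t) q]) t else 0 else 0.
pose X p q s := outer p q s -
  dext gV mu (map (ptwist gV 1) (map (at_t t) p) ++
    (mu (fst_ q), dpart q t - dext gV mu (map (at_t t) q)) :: map (at_t t) s).
have hj j : homog (Omega gV) (take j w) (take j d).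
  split; first by rewrite !size_take_min sd.
  move=> i; rewrite size_take_min leq_min => /andP[ij iw].
  by rewrite !nth_take//; have [_ /(_ i iw)] := hw.
transitivity (\sum_(1 <= r < (size w).+1) \sum_(0 <= j < (size w - r).+1)
   X (take j w) (take r (drop j w)) (drop (j + r) w)).
  apply: eq_bigr => r _; apply: eq_bigr => j _.
  have -> : forall e (a : form), (e *: a).2 t = e *: a.2 t by [].
  rewrite /insert Omega_mu2 /X scalerBr; congr (_ - _).
    rewrite /outer; have := hj j; case: (take j w) => [|x [|y p]] /= hp.
    - case: (drop (j + r) w) => [|z q]; last by rewrite scaler0.
      rewrite /eps; have -> : take j d = [::] by exact: homog_nil hp.
      rewrite big_nil expr0z scale1r; congr (vderiv _ t); apply/funext => t'.
      exact: Omega_mu1.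
    - by rewrite scaler0.
    - by rewrite scaler0.
  rewrite !(map_cat, map_cons) (ptwist_phomog _ (dext_mlin mum) (homog_at t (hj j))).
  by rewrite at_mu.
rewrite sum_pos_spl3 => [|p s]; last first.
  rewrite /X /fst_/= mu0 /dext/= subr0 -/(dext gV mu _) dext_slot0//.
  rewrite /outer subr0; case: p => // ; case: s => //.
  by under eq_fun do rewrite /= mu0; exact: vderiv0.
(* The sign (-1)^(eps_j) and the sign of pulling dt to the front are both twists by 1 and cancel, so
   dx enters [mu] without a sign. *)
have XE p q s : X p q s = outer p q s
   - dext gV mu (map (ptwist gV 1) (map (at_t t) p) ++
       (mu (fst_ q), - dext gV mu (map (at_t t) q)) :: map (at_t t) s)
   - mu (fst_ p ++ dpart q t :: fst_ s).
  rewrite /X addrC [dpart q t - _]addrC dext_slotD// opprD addrC addrA.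
  congr (_ - mu (_ ++ _)); rewrite /fst_ -!map_comp; apply: eq_map => x /=.
  by rewrite -{1}(twistN gV_full 1) twistD// addNr twist0.
rewrite (eq_spl3 _ XE) !spl3D !spl3N.
have -> : spl3 (fun p q s => dext gV mu (map (ptwist gV 1) (map (at_t t) p) ++
       (mu (fst_ q), - dext gV mu (map (at_t t) q)) :: map (at_t t) s)) w = 0.
  have := dext_gc gV_full (map (at_t t) w) mum mum mud.
  rewrite (_ : gc 1 mu mu = fun=> 0) /dext ?mark0; last exact/funext.
  rewrite expr1z scaleN1r => /esym/eqP; rewrite oppr_eq0 => /eqP E.
  rewrite -[RHS]E spl3_map; apply: eq_spl3 => p q s.
  by rewrite /dext scaleN1r.
rewrite subr0; apply/eqP; rewrite subr_eq0; apply/eqP.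
rewrite /spl3 spl_head => [|v p q]; last by rewrite (eq_spl (G := fun _ _ => 0)) ?spl0.
rewrite spl_last//.
have cw x : (exists2 i, (i < size w)%N & x = nth 0 w i) -> vsmooth (gcar gV) x.1.
  by move=> [i iw ->]; have [_ /(_ i iw)[[]]] := hw.
have D := vten_mlin dt_cst dt_mul (u := fun (i : 'I_(size w)) _ t => (nth 0 w i).1 t)
  (u' := fun i _ t => vderiv (nth 0 w (val i)).1 t) (enum 'I_(size w)) mum
  (fun i => is_dt_deriv (vsmooth_vsm (cw _ (ex_intro2 _ _ (val i) (ltn_ord i) erefl)))).
have wE : [seq nth 0 w (val i) | i <- enum 'I_(size w)] = w.
  rewrite (map_comp (nth 0 w) val) val_enum_ord; exact: mkseq_nth.
transitivity (mark (fun p x q => mu (fst_ p ++ vderiv x.1 t :: fst_ q)) w).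
  rewrite -[in RHS]wE mark_map.
  have := is_dt_vderiv D 0%:i01 t => /= E; rewrite -[LHS]/(outer [::] w [::]) /outer.
  transitivity (vderiv (fun t => mu [seq (nth 0 w (val i)).1 t | i <- enum 'I_(size w)]) t).
    congr (vderiv _ t); apply/funext => t'; congr mu.
    by rewrite -{1}wE -!map_comp.
  rewrite -E; apply: eq_mark => p x q; rewrite /fst_ -!map_comp.
  by [].
rewrite mark_spl3; apply: eq_spl3 => p q s.
by case: q => [|x [|y q]] //=; rewrite mlin0.
Qed.

End FormsAlgebra.

(** * From circle products and block sums to A-infinity relations *)

Lemma has_nilp_split (T : Type) (bs : seq (seq T)) : has (@nilp T) bs ->
  exists p q, bs = p ++ [::] :: q.
Proof.
elim: bs => //= b bs IH /orP[|/IH[p [q ->]]]; last by exists (b :: p), q.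
by case: b => // _; exists [::], bs.
Qed.

Section Bridge.
Context {R : realType} {V : lmodType R}.
Variable gV : gspace V.
Hypothesis gV_full : gcar gV = setT.
Local Notation I := {i01 R}.
Local Notation form := ((I -> V) * (I -> V))%type.
Local Notation gc := (gcirc gV).
Local Notation tw := (twist gV).
Local Notation sgn k := ((-1 : R) ^ (k : int)).
Implicit Types mu : seq V -> V.

Lemma ainf_algebraP mu : mlin mu -> sdeg gV 1 mu -> mu [::] = 0 ->
  (forall x, gc 1 mu mu x = 0) -> ainf_algebra gV mu.
Proof.
move=> mum mud mu0 mumu; split=> [n _|x d _ hx]; last first.
  by rewrite (sum_insert gV_full mum mu0 hx).
have := sdeg_hom_deg n mum mud; congr (hom_deg _ _ _ _ _); ring.
Qed.

Lemma Omega_ainf mu : mlin mu -> sdeg gV 1 mu -> mu [::] = 0 ->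
  (forall x, gc 1 mu mu x = 0) -> ainf_algebra (Omega gV) (Omega_mu gV mu).
Proof.
by move=> mum mud mu0 mumu; split=> [n n0|w d w0 hw];
  [exact: Omega_hom_deg|exact: Omega_relation hw].
Qed.

Lemma composition_sum (muB : seq V -> V) (F : seq V -> V) x : mlin muB ->
  F [::] = 0 -> (0 < size x)%N ->
  \sum_(1 <= r < (size x).+1)
    \sum_(s : r.-tuple 'I_(size x).+1 |
        all (fun i : nat => 0 < i)%N [seq val i | i <- s] &&
        (sumn [seq val i | i <- s] == size x))
      muB [seq F b | b <- reshape [seq val i | i <- s] x]
  = \sum_(0 <= r < (size x).+1) blocks (nseq r F) muB x.
Proof.
move=> Bm F0 x0; rewrite [RHS]big_ltn// (_ : blocks _ _ _ = 0) ?add0r; last first.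
  by case: x x0.
apply: eq_bigr => r _; rewrite blocks_nseq_csum.
rewrite (@csum_pos_tuples _ _ (size x).+1 r (fun bs => muB (map F bs)))//.
by move=> bs /has_nilp_split[p [q ->]]; rewrite map_cat/= F0 mlin0.
Qed.

(** The composition with a single block contributes dF/dt through the de Rham part of mu^1. In the
    rest dt comes from exactly one block, the earlier ones being twisted. *)
Lemma form_composition_sum (muB : seq V -> V) (F Theta : I -> seq V -> V) x t :
  mlin muB -> (forall t, F t [::] = 0) -> (forall t, Theta t [::] = 0) ->
  (0 < size x)%N ->
  (\sum_(1 <= r < (size x).+1)
    \sum_(s : r.-tuple 'I_(size x).+1 |
        all (fun i : nat => 0 < i)%N [seq val i | i <- s] &&
        (sumn [seq val i | i <- s] == size x))
      Omega_mu gV muB [seq (F^~ b, Theta^~ b) | b <- reshape [seq val i | i <- s] x]).2 t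
  = vderiv (F^~ x) t - \sum_(0 <= r < (size x).+1) \sum_(0 <= j < r)
      blocks (nseq j (tw 1 \o F t) ++ Theta t :: nseq (r - j.+1) (F t)) muB x.
Proof.
move=> Bm F0 T0 x0.
pose Phi bs := (Omega_mu gV muB [seq (F^~ b, Theta^~ b) | b <- bs]).2 t.
have atE bs : map (at_t t) [seq (F^~ b, Theta^~ b) | b <- bs] =
    [seq (F t b, Theta t b) | b <- bs] by rewrite -map_comp.
have Phi0 bs : has (@nilp V) bs -> Phi bs = 0.
  move=> /has_nilp_split[p [q ->]]; rewrite /Phi Omega_mu2 atE !map_cat/= F0 T0.
  rewrite dext_slot0// subr0; case: p => [|b [|b' p]] //=; case: q => //=.
  have -> : F^~ [::] = fun=> 0 by apply/funext.
  exact: vderiv0.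
rewrite form_sum2.
transitivity (\sum_(1 <= r < (size x).+1) csum r Phi x).
  apply: eq_bigr => r _; rewrite form_sum2.
  exact: (@csum_pos_tuples _ _ (size x).+1 r Phi).
transitivity (\sum_(1 <= r < (size x).+1) ((if r == 1%N then vderiv (F^~ x) t else 0)
   - \sum_(0 <= j < r)
      blocks (nseq j (tw 1 \o F t) ++ Theta t :: nseq (r - j.+1) (F t)) muB x)).
  apply: eq_big_nat => r /andP[r0 _].
  transitivity (csum r (fun bs => dpart [seq (F^~ b, Theta^~ b) | b <- bs] t) x
    - csum r (fun bs => dext gV muB [seq (F t b, Theta t b) | b <- bs]) x).
    rewrite (eq_csum (Phi' := fun bs => dpart [seq (F^~ b, Theta^~ b) | b <- bs] t
       - dext gV muB [seq (F t b, Theta t b) | b <- bs])); last first.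
      by move=> bs _; rewrite /Phi Omega_mu2 atE.
    by rewrite csumD csumN.
  congr (_ - _).
    case: r r0 => [//|[|r]] _ /=; first by rewrite spl_last.
    exact: (csum0 r.+2 x).
  rewrite (eq_csum (Phi' := fun bs => \sum_(0 <= j < r)
     muB ([seq (tw 1 \o F t) b | b <- take j bs] ++ Theta t (nth [::] bs j) ::
          map (F t) (drop j.+1 bs)))) => [|bs <-]; last first.
    by rewrite /dext mark_map (mark_big _ _ [::]); apply: eq_bigr => j _;
      rewrite -!map_comp.
  rewrite csum_sum; apply: eq_big_nat => j /andP[_ jr].
  by rewrite blocks_marked_csum.
rewrite sumrB; congr (_ - _); last by rewrite [RHS]big_ltn// big_nil add0r.
by rewrite big_ltn//= big_nat_cond big1 ?addr0// => r /andP[/andP[r1 _] _]; case: r r1 => [|[]].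
Qed.

Definition path_homotopy (alpha : sqform V) (t : I) : seq V -> V :=
  dtransp gV (alpha true false) (alpha true true) 0%:i01 t.

End Bridge.

Theorem theorem4p4 (R : realType) (V : lmodType R) (gV : gspace V)
    (gV_full : gcar gV = setT)
    (alpha : sqform V) (alphaMC : maurer_cartan gV alpha)
    (alpha_0 : forall (p q : bool) (s t : {i01 R}), alpha p q s t [::] = 0)
    (alpha_1_1 : forall (s t : {i01 R}) (v : V),
       alpha true false s t [:: v] = 0 /\ alpha false true s t [:: v] = 0)
    (muA muB : seq V -> V)
    (edge0 : forall (t : {i01 R}) (a : seq V),
       alpha false false 0%:i01 t a = muA a /\ alpha false true 0%:i01 t a = 0)
    (edge1 : forall (t : {i01 R}) (a : seq V),
       alpha false false 1%:i01 t a = muB a /\ alpha false true 1%:i01 t a = 0) :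
  let F := path_morphism alpha in
  let phi := fun a : seq V => hat_G gV alpha [seq const_form v | v <- a] in
  exists Theta : {i01 R} -> seq V -> V,
    [/\ forall a : seq V, (0 < size a)%N ->
          phi a = (fun t => F t a, fun t => Theta t a),
        diff_homotopy gV muA muB F Theta &
        ainf_morphism gV (Omega gV) muA (Omega_mu gV muB) phi].
Proof.
move=> F phi.
have am := alpha_mlin gV_full alphaMC true false.
have bm := alpha_mlin gV_full alphaMC false true.
have cm := alpha_mlin gV_full alphaMC true true.
have mm := alpha_mlin gV_full alphaMC false false.
have ad : forall s t, sdeg gV 0 (alpha true false s t) :=
  alpha_sdeg gV_full alphaMC true false.
have bd : forall s t, sdeg gV 0 (alpha false true s t) :=
  alpha_sdeg gV_full alphaMC false true.
have cd : forall s t, sdeg gV (-1) (alpha true true s t) :=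
  alpha_sdeg gV_full alphaMC true true.
have md : forall s t, sdeg gV 1 (alpha false false s t) :=
  alpha_sdeg gV_full alphaMC false false.
have asm := alpha_vsm alphaMC true false.
have csm := alpha_vsm alphaMC true true.
have a0 := alpha_0 true false; have c0 := alpha_0 true true.
have a1 s t v : alpha true false s t [:: v] = 0 by have [] := alpha_1_1 s t v.
have m1 t x : alpha false false 1%:i01 t x = muB x by have [] := edge1 t x.
have m0 t x : alpha false false 0%:i01 t x = muA x by have [] := edge0 t x.
have b1 t x : alpha false true 1%:i01 t x = 0 by have [] := edge1 t x.
have b0 t x : alpha false true 0%:i01 t x = 0 by have [] := edge0 t x.
have dm := m_ds alphaMC; have db := b_ds alphaMC.
have EA t : alpha false false 0%:i01 t = muA by exact/funext.
have EB t : alpha false false 1%:i01 t = muB by exact/funext.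
pose Theta := path_homotopy gV alpha.
have FE : F = fun t => transp gV (alpha true false) 0%:i01 t.
  apply/funext => t; apply/funext => x.
  exact: (path_morphismE gV_full am cm ad cd asm csm a0 a1).
have phiE : phi = fun x : seq V => (F^~ x, Theta^~ x).
  apply/funext => x; rewrite /phi (hat_G_const gV_full am cm ad cd asm csm a0 c0).
  by congr (_, _); apply/funext => t; rewrite FE.
have [Gm Gd Gs] := transp_spec gV_full am ad asm.
have [Hm Hd Hs] := dtransp_spec gV_full am cm ad cd asm csm.
have Fm t : mlin (F t) by rewrite FE; exact: Gm.
have Tm t : mlin (Theta t) by exact: Hm.
have Fd t : sdeg gV 0 (F t) by rewrite FE; exact: Gd.
have Td t : sdeg gV (-1) (Theta t) by exact: Hd.
have F0 t : F t [::] = 0 by rewrite FE /transp big_nat1.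
have T0 t : Theta t [::] = 0 by rewrite /Theta /path_homotopy /dtransp big_nat1.
have Am : mlin muA by rewrite -(EA 0%:i01); exact: mm.
have Bm : mlin muB by rewrite -(EB 0%:i01); exact: mm.
have Ad : sdeg gV 1 muA by rewrite -(EA 0%:i01); exact: md.
have Bd : sdeg gV 1 muB by rewrite -(EB 0%:i01); exact: md.
have A0 : muA [::] = 0 by rewrite -(EA 0%:i01); exact: alpha_0.
have B0 : muB [::] = 0 by rewrite -(EB 0%:i01); exact: alpha_0.
have AA x : gcirc gV 1 muA muA x = 0 by rewrite -(EA 0%:i01); exact: mc00.
have BB x : gcirc gV 1 muB muB x = 0 by rewrite -(EB 0%:i01); exact: mc00.
have FA : ainf_algebra gV muA by exact: ainf_algebraP.
have morphE t x : \sum_(0 <= r < (size x).+1) blocks (nseq r (F t)) muB x =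
    gcirc gV 1 (F t) muA x.
  by rewrite FE -(EA t); apply: (transp_morphism gV_full mm am md ad asm a0 a1 dm m1).
have morphF t : ainf_morphism gV gV muA muB (F t).
  split=> //; first exact: ainf_algebraP.
    move=> n _; have := sdeg_hom_deg n (Fm t) (Fd t).
    by rewrite addr0.
  move=> x d x0 hx; rewrite composition_sum// morphE.
  by rewrite (sum_insert gV_full (Fm t) A0 hx).
have morphPhi : ainf_morphism gV (Omega gV) muA (Omega_mu gV muB)
    (fun x : seq V => (F^~ x, Theta^~ x)).
  split=> //; first exact: Omega_ainf.
    move=> n _; split=> [p q c u v _ _ _ _ _|x d sx hx].
      by apply: form_eq => t; [exact: Fm|exact: Tm].
    have sd : size d = size x by have [] := hx.
    split; first split.
    - by rewrite FE; exact: (vsm_vsmooth gV_full 0%:i01 (Gs x)).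
    - exact: (vsm_vsmooth gV_full 0%:i01 (Hs x)).
    apply: form_eq => t.
      have [_] := Fd t x d hx; congr (gproj gV _ _ = _).
      by rewrite sum_shift sd sx; ring.
    have [_] := Td t x d hx; congr (gproj gV _ _ = _).
    by rewrite sum_shift sd sx; ring.
  move=> x d x0 hx; apply: form_eq => t.
    rewrite !form_sum1.
    (* The coefficient of 1 only involves the first components and is the morphism equation for
       [F t]. *)
    transitivity (gcirc gV 1 (F t) muA x).
      rewrite -morphE -composition_sum//; apply: eq_bigr => r _.
      rewrite form_sum1; apply: eq_bigr => s _.
      by rewrite Omega_mu1 -!map_comp.
    rewrite -(sum_insert gV_full (Fm t) A0 hx); apply: eq_bigr => r _.
    by rewrite form_sum1.
  rewrite form_composition_sum//.
  (* The homotopy equation at s = 0, where m is [muA], with the block bound [N = (size x).+1] that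
     occurs in the sum over compositions. *)
  have H := dtransp_homotopy gV_full mm am bm cm md ad bd cd asm csm a0 c0 a1 dm db m1 b1
    0%:i01 t (ltnSn (size x)).
  transitivity (gcirc gV 1 (Theta t) muA x).
    transitivity (dtf (transp gV (alpha true false)) 0%:i01 t x
      - dmorph gV (alpha true false) (alpha true true) muB (size x).+1 0%:i01 t x).
      by rewrite /dtf /dmorph FE.
    rewrite H (EA t) (eq_gc _ _ _ (fun y => erefl) (b0 t)).
    rewrite [X in _ + X](_ : _ = 0) ?addr0// gcircE.
    rewrite -[RHS](spl0 x); apply: eq_spl => p r; rewrite -[RHS](spl0 r).
    by apply: eq_spl => q s; rewrite mlin0.
  rewrite form_sum2 -(sum_insert gV_full (Tm t) A0 hx); apply: eq_bigr => r _.
  by rewrite form_sum2.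
exists Theta; split.
- by move=> x _; rewrite phiE.
- by split.
- by rewrite phiE.
Qed.
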